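(* Let $k\in\{0,1,2\}$. For every partition $\lambda$, quasi-dual equivalence on $\mathrm{SRT}(\lambda)$ is a coarsening of $\equiv^k$: if $T,T'\in\mathrm{SRT}(\lambda)$ satisfy $\mathrm{cw}(T)\equiv^k\mathrm{cw}(T')$, then $T$ and $T'$ are quasi-dual equivalent. In particular, for every composition $\alpha$, the quasisymmetric Schur function $\mathcal S_\alpha$ is a sum, with nonnegative integer coefficients, of functions in $\{f^{(k)}\}$.
   Context: Diagrams of compositions and partitions are in French notation: left-justified rows numbered from bottom to top. A standard filling of a shape of size $n$ uses each of $1,\dots,n$ once. For $\pi\in S_n$ in one-line notation, $\mathrm{ID}(\pi)$ is the set of $i\in[n-1]$ such that $i$ occurs to the right of $i+1$. For $D\subseteq[n-1]$, $F_D=\sum x_{j_1}\cdots x_{j_n}$ over $j_1\le\cdots\le j_n$ such that $j_k=j_{k+1}$ implies $k\notin D$. Elementary dual equivalence. $d_i$ acts on a permutation by: $\ldots i\ldots i-1\ldots i+1\ldots\leftrightarrow\ldots i+1\ldots i-1\ldots i\ldots$ and $\ldots i\ldots i+1\ldots i-1\ldots\leftrightarrow\ldots i-1\ldots i+1\ldots i\ldots$ (all else fixed), and as the identity if $i$ is between $i-1$ and $i+1$. Quasisymmetric Schur functions. $\mathrm{SRCT}(\alpha)$, for $\alpha\vDash n$, is the set of standard fillings of $\alpha$ that increase down the first column (top to bottom), decrease along rows from left to right, and satisfy: for any two values $a>b$ adjacent in a row ($b$ immediately right of $a$), no value in $(b,a)$ occurs below $b$ in the same column as $b$; if $a$ is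 the last entry of its row, the position immediately to its right is treated as having entry $b=0$. The bent reading word $\mathrm{bw}(T)$ reads columns from right to left, each downward, except that the leftmost column is read last and upward. $\mathcal S_\alpha=\sum_{T\in\mathrm{SRCT}(\alpha)}F_{\mathrm{ID}(\mathrm{bw}(T))}$. Quasi-dual equivalence. $\mathrm{SRT}(\lambda)$ is the set of standard fillings of $\lambda$ decreasing bottom to top up columns and left to right along rows. $\mathrm{cw}(T)$ reads columns from right to left, each upward. $d_i$ acts on $\mathrm{SRT}(\lambda)$ through $\mathrm{cw}$. For $2\le i\le n-1$, $d_i^Q(T)=T$ if $i-1,i,i+1$ occupy two cells of the first column and one of the second column, and $d_i^Q(T)=d_i(T)$ otherwise. Quasi-dual equivalence is the equivalence relation on $\mathrm{SRT}(\lambda)$ generated by $T\sim d_i^Q(T)$. Standard Young tableaux. $\mathrm{SYT}(\lambda)$: standard fillings of $\lambda$ increasing left to right along rows and bottom to top up columns; $\mathrm{SYT}(n)=\bigcup_{\lambda\vdash n}\mathrm{SYT}(\lambda)$. The superstandard tableau $U_\lambda$ has bottom row $1,\dots,\lambda_1$, second row $\lambda_1+1,\dots,\lambda_1+\lambda_2$, etc. $\mathrm{rw}(T)$ reads each row left to right, top row first; cells are ordered by this reading order. $\mathrm{ID}(T)=\mathrm{ID}(\mathrm{rw}(T))$, and $d_i$ acts on $\mathrm{SYT}(\lambda)$ through $\mathrm{rw}$. Writing $\mathrm{ID}(T)\cup\{n\}=\{b_1<\dots<b_m\}$, $b_0=0$, the $r$-th run of $T$ is the set of cells with entries in $(b_{r-1},b_r]$,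 and $\beta_r(T)=b_r-b_{r-1}$. $T$ is determined by the sequence of cell sets of its runs (entries increase in reading order within a run). The first $r$ runs form the tableau of entries $\le b_r$. The maps $\mathrm{slink},\mathrm{slink}_*$ on $\mathrm{SYT}(\lambda)$. Let $j$ be minimal such that the first $j$ runs of $T$ do not form a superstandard tableau. If no such $j$ exists, both maps fix $T$. Otherwise: (1) $\mathrm{slink}(T)$ has the same runs as $T$ except runs $j-1$ and $j$: among the cells of runs $j-1$ and $j$ of $T$ strictly below row $j$, the first $\beta_j(T)-1$ in reading order form the new $(j-1)$-th run, and the remaining ones together with the cells of run $j$ in row $j$ form the new $j$-th run. (2) Let $\mu$ be the shape of the first $j$ runs of $T$ and let $i\ge1$ be minimal with $\mu_{i+1}\le\beta_j(T)+i-j$. $\mathrm{slink}_*(T)$ has the same runs as $T$ except runs $i$ and $j$: among the cells of runs $i$ and $j$ of $T$ strictly below row $i+1$, the first $\beta_j(T)+i-j$ in reading order form the new $i$-th run, and the remaining ones together with the cells of run $j$ in rows $\ge i+1$ form the new $j$-th run. For $T\in\mathrm{SYT}(n)$ and $i\in[2,n-2]$, $d_i^R(T)=T$ if $i+1\in\mathrm{ID}(T)\cap\mathrm{ID}(d_i(T))$, and $d_i^R(T)=d_i(T)$ otherwise. Relations. $\equiv^0$, $\equiv^1$, $\equiv^2$ on $\mathrm{SYT}(n)$ are the equivalence relations generated by $T\sim\mathrm{slink}_*(T)$, $T\sim\mathrm{slink}(T)$, and $T\sim d_i^R(T)$ (all $i\in[2,n-2]$), respectively. On $S_n$, with $(P,Q)$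 the RSK insertion and recording tableaux, $\pi\equiv^k\pi'$ means $P(\pi)\equiv^kP(\pi')$ and $Q(\pi)=Q(\pi')$. $\{f^{(k)}\}$ is the set of functions of the form $\sum_{T\in\mathcal C}F_{\mathrm{ID}(T)}$ with $\mathcal C$ a single $\equiv^k$ class of standard Young tableaux. *)

(* Defs.v *)
From Stdlib Require Import Relation_Operators.
From mathcomp Require Import all_boot all_order all_algebra.
From mathcomp.finmap Require Import finmap multiset.

Set Implicit Arguments.
Unset Strict Implicit.
Unset Printing Implicit Defensive.

(* Permutations in S_n are words (one-line notation).  The k-th row from the
   bottom of a diagram in French notation is the item k - 1 of the sequence of
   its rows.  Entries are numbered from 1; cells (r, c) are numbered from 0. *)

Definition is_comp (a : seq nat) : bool := 0 \notin a.
Definition is_part (l : seq nat) : bool := is_comp l && sorted geq l.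

Notation tableau := (seq (seq nat)).
Notation cell := (nat * nat)%type.

(* Outside of the diagram the value is 0. *)
Definition entry (T : tableau) (r c : nat) : nat := nth 0 (nth [::] T r) c.

Definition row_len (sh : seq nat) (r : nat) : nat := nth 0 sh r.

Definition ncols (T : tableau) : nat := foldr maxn 0 (shape T).

Definition col_up (T : tableau) (c : nat) : seq nat :=
  [seq entry T r c | r <- iota 0 (size T) & c < row_len (shape T) r].

Definition fillings (sh : seq nat) : seq tableau :=
  [seq reshape sh w | w <- permutations (iota 1 (sumn sh))].

Definition inv_descents (w : seq nat) : seq nat :=
  [seq i <- iota 1 (size w).-1 | index i.+1 w < index i w].

(* A monomial x_{j_1} ... x_{j_n} is the multiset of its indices, and a formal
   power series in infinitely many variables is its coefficient function. *)
Definition pseries : Type := {mset nat}%mset -> int.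

(* [permutations m] lists, without repetition, the words (j_1, ..., j_n) with
   x_{j_1} ... x_{j_n} = m. *)
Definition fund_qsym (n : nat) (D : seq nat) : pseries := fun m =>
  Posz (count (fun j : seq nat =>
                 [&& size j == n, sorted leq j &
                   all (fun k => (nth 0 j k.-1 == nth 0 j k) ==> (k \notin D))
                       (iota 1 n.-1)])
              (permutations (enum_mset m))).

(** Elementary dual equivalence *)

Definition between (w : seq nat) (a b c : nat) : bool :=
  (index b w < index a w < index c w) || (index c w < index a w < index b w).

Definition swap_val (a b : nat) : nat -> nat := [eta id with a |-> b, b |-> a].

Definition dual_subst (i : nat) (w : seq nat) : nat -> nat :=
  if between w i.-1 i i.+1 then swap_val i i.+1
  else if between w i.+1 i i.-1 then swap_val i.-1 i
  else id.

Definition dual_word (i : nat) (w : seq nat) : seq nat :=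
  map (dual_subst i w) w.

(* The filling of the same shape with rd (dual_tab rd i T) = dual_word i (rd T)
   for a reading word rd. *)
Definition dual_tab (rd : tableau -> seq nat) (i : nat) (T : tableau) :
  tableau := map (map (dual_subst i (rd T))) T.

(** Quasisymmetric Schur functions *)

Definition srct_triples (T : tableau) : bool :=
  all (fun r => all (fun c => all (fun r' =>
         ~~ (entry T r c.+1 < entry T r' c.+1 < entry T r c))
       (iota 0 r)) (iota 0 (row_len (shape T) r))) (iota 0 (size T)).

Definition SRCT (a : seq nat) : seq tableau :=
  [seq T <- fillings a | [&& sorted ltn (rev (col_up T 0)),
                             all (sorted gtn) T & srct_triples T]].

Definition bent_word (T : tableau) : seq nat :=
  flatten [seq if c == 0 then col_up T c else rev (col_up T c)
          | c <- rev (iota 0 (ncols T))].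

Definition qschur (a : seq nat) : pseries := fun m =>
  (\sum_(T <- SRCT a) fund_qsym (sumn a) (inv_descents (bent_word T)) m)%R.

(** Quasi-dual equivalence *)

Definition SRT (l : seq nat) : seq tableau :=
  [seq T <- fillings l | all (sorted gtn) T &&
     all (fun c => sorted gtn (col_up T c)) (iota 0 (ncols T))].

Definition col_word (T : tableau) : seq nat :=
  flatten [seq col_up T c | c <- rev (iota 0 (ncols T))].

Definition quasi_dual (i : nat) (T : tableau) : tableau :=
  let s := [:: i.-1; i; i.+1] in
  if (count (mem s) (col_up T 0) == 2) && (count (mem s) (col_up T 1) == 1)
  then T else dual_tab col_word i T.

Definition quasi_dual_equiv (l : seq nat) : tableau -> tableau -> Prop :=
  clos_refl_sym_trans tableau (fun T T' =>
    T \in SRT l /\ exists2 i, 2 <= i <= (sumn l).-1 & T' = quasi_dual i T).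

(** Standard Young tableaux *)

Definition SYT (l : seq nat) : seq tableau :=
  [seq T <- fillings l | all (sorted ltn) T &&
     all (fun c => sorted ltn (col_up T c)) (iota 0 (ncols T))].

Definition SYTn (n : nat) : pred tableau := fun T =>
  [&& is_part (shape T), sumn (shape T) == n & T \in SYT (shape T)].

Definition superstandard (l : seq nat) : tableau :=
  reshape l (iota 1 (sumn l)).

Definition row_word (T : tableau) : seq nat := flatten (rev T).

Definition ID (T : tableau) : seq nat := inv_descents (row_word T).

(* The cells of a diagram, in the reading order of row_word. *)
Definition rcells (sh : seq nat) : seq cell :=
  [seq (r, c) | r <- rev (iota 0 (size sh)), c <- iota 0 (row_len sh r)].

Definition run_ends (T : tableau) : seq nat :=
  let n := sumn (shape T) in
  [seq b <- iota 1 n | (b \in ID T) || (b == n)].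

Definition nruns (T : tableau) : nat := size (run_ends T).

(* b_r, with b_0 = 0 *)
Definition run_end (T : tableau) (r : nat) : nat := nth 0 (0 :: run_ends T) r.

Definition run (T : tableau) (r : nat) : seq cell :=
  [seq x <- rcells (shape T) |
     run_end T r.-1 < entry T x.1 x.2 <= run_end T r].

Definition run_size (T : tableau) (r : nat) : nat :=
  run_end T r - run_end T r.-1.

(* The tableau formed by the first r runs. *)
Definition first_runs (T : tableau) (r : nat) : tableau :=
  [seq s <- [seq [seq x <- row | x <= run_end T r] | row <- T] | s != [::]].

(* The filling of the diagram sh whose successive runs have the cell sets rs. *)
Definition of_runs (sh : seq nat) (rs : seq (seq cell)) : tableau :=
  let order := flatten [seq [seq x <- rcells sh | x \in s] | s <- rs] in
  [seq [seq (index (r, c) order).+1 | c <- iota 0 (row_len sh r)]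
  | r <- iota 0 (size sh)].

(* Among the cells of runs i and j in rows < h, the first q form the new run i;
   the others, with the cells of run j in the rows satisfying top, form the new
   run j.  Rows are numbered from 1 here. *)
Definition relink (T : tableau) (i j h q : nat) (top : pred nat) : tableau :=
  let pool := [seq x <- rcells (shape T) |
                 (x \in run T i ++ run T j) && (x.1.+1 < h)] in
  let new_i := take q pool in
  let new_j := drop q pool ++ [seq x <- run T j | top x.1.+1] in
  of_runs (shape T)
    [seq if r == i then new_i else if r == j then new_j else run T r
    | r <- iota 1 (nruns T)].

Definition not_superstandard (T : tableau) (j : nat) : bool :=
  first_runs T j != superstandard (shape (first_runs T j)).

(* Both maps fix T when no j exists. *)
Definition first_bad_run (T : tableau) : option nat :=
  ohead [seq j <- iota 1 (nruns T) | not_superstandard T j].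

Definition slink (T : tableau) : tableau :=
  if first_bad_run T is Some j then
    relink T j.-1 j j (run_size T j - 1) (pred1 j)
  else T.

(* The condition defining i always holds at i = j, since the first j runs
   occupy at most j rows: the search can be limited to 1 <= i <= j. *)
Definition slink_star (T : tableau) : tableau :=
  if first_bad_run T is Some j then
    let mu := shape (first_runs T j) in
    let i := head j [seq i <- iota 1 j |
                       row_len mu i + j <= run_size T j + i] in
    relink T i j i.+1 (run_size T j + i - j) (fun r => i.+1 <= r)
  else T.

Definition dual_R (i : nat) (T : tableau) : tableau :=
  let T' := dual_tab row_word i T in
  if (i.+1 \in ID T) && (i.+1 \in ID T') then T else T'.

(** The relations on SYT(n) and on S_n *)

Definition syt_step (k : 'I_3) (n : nat) (T T' : tableau) : Prop :=
  match val k with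
  | 0 => T' = slink_star T
  | 1 => T' = slink T
  | _ => exists2 i, 2 <= i <= n - 2 & T' = dual_R i T
  end.

Definition syt_equiv (k : 'I_3) (n : nat) : tableau -> tableau -> Prop :=
  clos_refl_sym_trans tableau (fun T T' => SYTn n T /\ syt_step k n T T').

Fixpoint row_insert (T : tableau) (x : nat) : tableau :=
  if T is row :: T' then
    let k := find (ltn x) row in
    if k < size row then set_nth 0 row k x :: row_insert T' (nth 0 row k)
    else rcons row x :: T'
  else [:: [:: x]].

(* The new cell of the recording tableau lies in the only row on which the
   shapes of P and of row_insert P x differ. *)
Definition rsk_step (PQ : tableau * tableau) (x : nat) : tableau * tableau :=
  let: (P, Q) := PQ in
  let P' := row_insert P x in
  let r := find (fun r => row_len (shape P) r != row_len (shape P') r)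
                (iota 0 (size P')) in
  (P', set_nth [::] Q r (rcons (nth [::] Q r) (sumn (shape P')))).

Definition rsk (w : seq nat) : tableau * tableau :=
  foldl rsk_step ([::], [::]) w.

Definition perm_equiv (k : 'I_3) (w w' : seq nat) : Prop :=
  syt_equiv k (size w) (rsk w).1 (rsk w').1 /\ (rsk w).2 = (rsk w').2.

(* The family {f^(k)}: the list C enumerates the class of T0. *)
Definition class_function (k : 'I_3) (f : pseries) : Prop :=
  exists n (T0 : tableau) (C : seq tableau),
    [/\ SYTn n T0, uniq C,
        forall T, T \in C <-> SYTn n T /\ syt_equiv k n T0 T
      & forall m, f m = (\sum_(T <- C) fund_qsym n (ID T) m)%R].

Definition nonneg_comb (A : pseries -> Prop) (g : pseries) : Prop :=
  exists (p : nat) (c : 'I_p -> nat) (f : 'I_p -> pseries),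
    (forall i, A (f i)) /\ forall m, g m = (\sum_(i < p) f i m *+ c i)%R.

(* Main.v *)
(* Row insertion P commutes with elementary dual equivalence, preserves inverse
   descents, and is injective on the words cw(T), T in SRT(lambda): inserting the
   r-th letter of a column always adds a cell to the r-th row.  So it suffices to
   follow tableaux under the involutions d_i^R.

   slink and slink_* are compositions of such involutions.  List the cells of a
   tableau by increasing entries; d_i^R then contains the moves x y z u -> x z y u
   for z < x < y, z < u in reading order.  If t and p are increasing lists with
   t before p in reading order, all the lists p' t p'' with p = p' p'',
   |t| <= |p'| < |p| can be moved to p_1 t_1 p_2 t_2 ..., hence to each other.
   Applying this to the pairs of consecutive runs (j-1, j), ..., (i, i+1), both T
   and slink_*(T) reach the same tableau; slink is the case i = j-1.

   If d_i acts nontrivially on T while i-1, i, i+1 occupy two cells of the first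
   column and one of the second, then i+1 is in the first column before and after,
   so i+1 is a descent of both tableaux and d_i^R is the identity.

   Sorting columns embeds SRCT(alpha) into the decreasing-column words,
   preserving inverse descents.  When d_i is not of the excluded kind, it lifts to
   SRCT(alpha) as a permutation of the entries i-1, i, i+1: an exchange of two
   consecutive entries, or a 3-cycle when exchanging them would violate the rules
   of SRCT. *)

Require Import Defs.
From Stdlib Require Import Relation_Operators ClassicalEpsilon.
From mathcomp Require Import all_boot all_order all_algebra.
From mathcomp Require Import zify.

Set Implicit Arguments.
Unset Strict Implicit.
Unset Printing Implicit Defensive.

(** * Row insertion and elementary dual equivalence *)

(** The relations are symmetric closures, so a step must be lifted in both directions; involutivity
    of d_i^R supplies the backward one. For the lifting, a tableau enters through the column of each
    value only. This is why one word serves both families, and why a 3-cycle of entries in a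
    composition tableau can realize a single exchange in its word.

    Injectivity rests on decreasing subsequences whose letters are at least a threshold t. The
    longest decreasing subsequence alone bounds only the height of the tableau; with t equal to the
    inserted letter, the bound becomes the number of letters of its column read so far, which pins
    down the row of the new cell.

    The fourth cell u of a move x y z u has a double role: it prevents the descent at i+1, and its
    existence keeps i at most n-2. Hence the conditions that something remains to the right of a
    list being moved.

    Positivity: insertion maps SRCT(alpha) injectively onto a set closed under the relation, hence
    onto a union of whole classes, and each class contributes its function once. *)

Definition insertion (w : seq nat) : tableau := foldl row_insert [::] w.

Lemma rsk_insertion w : (rsk w).1 = insertion w.
Proof.
rewrite /rsk /insertion -[[::] in RHS]/(([::], [::]) : tableau * tableau).1.
elim: w ([::], [::]) => //= x w IHw [P Q]; exact: IHw.
Qed.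

Definition window (i : nat) : seq nat := [:: i.-1; i; i.+1].

Lemma index_filter_lt (p : pred nat) s a b : p a -> p b ->
  (index a (filter p s) < index b (filter p s)) = (index a s < index b s).
Proof.
move=> pa pb; elim: s => //= x s IHs; case: ifP => px /=.
  by case: eqP => //= _; case: eqP.
by case: eqP => [xa|_]; [rewrite xa pa in px | case: eqP => [xb|_] //; rewrite xb pb in px].
Qed.

(** The clauses of d_i only compare positions of window letters, so any rearrangement of the word
    that keeps these three in order keeps the substitution. *)
Lemma dual_subst_filter i w :
  dual_subst i w = dual_subst i [seq z <- w | z \in window i].
Proof.
have inw z : z \in window i = [|| z == i.-1, z == i | z == i.+1].
  by rewrite !inE.
by rewrite /dual_subst /between !index_filter_lt ?inw ?eqxx ?orbT.
Qed.

Lemma eq_dual_subst i w w' :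
  [seq z <- w | z \in window i] = [seq z <- w' | z \in window i] ->
  dual_subst i w = dual_subst i w'.
Proof. by move=> e; rewrite dual_subst_filter e -dual_subst_filter. Qed.

Lemma dual_subst_out i w z : z \notin window i -> dual_subst i w z = z.
Proof.
rewrite !inE !negb_or => /and3P[/negPf z1 /negPf z2 /negPf z3].
by rewrite /dual_subst; do 2?[case: ifP => _]; rewrite /swap_val /= ?z1 ?z2 ?z3.
Qed.

Lemma filter_window_nil i s :
  (forall z, z \in window i -> z \notin s) -> [seq z <- s | z \in window i] = [::].
Proof.
move=> out; apply/eqP; rewrite -size_eq0 size_filter -leqn0 leqNgt -has_count.
by apply/hasPn=> z zs; apply/negP=> /out; rewrite zs.
Qed.

Definition exchange (p : nat) : nat -> nat := swap_val p p.+1.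

Lemma exchangeE p z : exchange p z = if z == p then p.+1 else if z == p.+1 then p else z.
Proof. by []. Qed.

Lemma index3 (a b c : nat) : uniq [:: a; b; c] ->
  [/\ index a [:: a; b; c] = 0, index b [:: a; b; c] = 1 & index c [:: a; b; c] = 2].
Proof.
rewrite /= !inE !negb_or andbT => /andP[/andP[/negPf ab /negPf ac] /negPf bc].
by rewrite ab ac bc !eqxx.
Qed.

Lemma dual_subst_windowE m :
  [/\ dual_subst m.+1 [:: m; m.+1; m.+2] =1 id,
      dual_subst m.+1 [:: m.+2; m.+1; m] =1 id,
      dual_subst m.+1 [:: m; m.+2; m.+1] =1 exchange m,
      dual_subst m.+1 [:: m.+1; m.+2; m] =1 exchange m &
      dual_subst m.+1 [:: m.+1; m; m.+2] =1 exchange m.+1 /\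
      dual_subst m.+1 [:: m.+2; m; m.+1] =1 exchange m.+1].
Proof.
split; [..|split] => z; rewrite /dual_subst /between [_.+1.-1]/=.
- by have [|->->-> //] := @index3 m m.+1 m.+2; rewrite /= !inE; lia.
- by have [|->->-> //] := @index3 m.+2 m.+1 m; rewrite /= !inE; lia.
- by have [|->->-> //] := @index3 m m.+2 m.+1; rewrite /= !inE; lia.
- by have [|->->-> //] := @index3 m.+1 m.+2 m; rewrite /= !inE; lia.
- by have [|->->-> //] := @index3 m.+1 m m.+2; rewrite /= !inE; lia.
- by have [|->->-> //] := @index3 m.+2 m m.+1; rewrite /= !inE; lia.
Qed.

Lemma perm_window m s : perm_eq s [:: m; m.+1; m.+2] ->
  s \in [:: [:: m; m.+1; m.+2]; [:: m.+2; m.+1; m]; [:: m; m.+2; m.+1];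
            [:: m.+1; m.+2; m]; [:: m.+1; m; m.+2]; [:: m.+2; m; m.+1]].
Proof.
move=> sw; have us : uniq s by rewrite (perm_uniq sw) /= !inE; lia.
have ms := perm_mem sw; have := perm_size sw.
case: s us ms {sw} => [|a [|b [|c []]]] //= us ms _.
move: us; have := ms a; have := ms b; have := ms c; rewrite !inE !eqxx !orbT /= => /esym hc /esym hb /esym ha.
case/or3P: ha => /eqP ->; case/or3P: hb => /eqP ->; case/or3P: hc => /eqP ->;
  by rewrite /= ?inE ?eqxx ?orbT ?andbF ?eqseq_cons ?eqxx ?orbT.
Qed.

(** Common form of the two nontrivial clauses of d_i: an exchange of p and p+1, with the third
    window letter t as a witness standing between them. By [exchange_lt], order arguments then
    reduce to excluding the single pair p, p+1, which is what t is used for. *)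
Lemma dual_substP m w : perm_eq [seq z <- w | z \in window m.+1] (window m.+1) ->
  dual_subst m.+1 w =1 id \/
  exists p t, [/\ dual_subst m.+1 w =1 exchange p, p = m /\ t = m.+2 \/ p = m.+1 /\ t = m
    & (index p w < index t w < index p.+1 w) || (index p.+1 w < index t w < index p w)].
Proof.
move=> pw; rewrite dual_subst_filter.
have iw a b : a \in window m.+1 -> b \in window m.+1 ->
  (index a w < index b w) = (index a [seq z <- w | z \in window m.+1] < index b [seq z <- w | z \in window m.+1]).
  by move=> aw bw; rewrite index_filter_lt.
have [e1 e2 e3 e4 [e5 e6]] := dual_subst_windowE m.
have mw: (m \in window m.+1) * (m.+1 \in window m.+1) * (m.+2 \in window m.+1).
  by rewrite /window !inE !eqxx !orbT.
have := perm_window pw; rewrite !inE => /or4P[|||/or3P[]] /eqP e; move: iw; rewrite e => iw; try by left.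
- right; exists m, m.+2; split=> //; first by left.
  by rewrite !iw ?mw //; have [|->->->//] := @index3 m m.+2 m.+1; rewrite /= !inE; lia.
- right; exists m, m.+2; split=> //; first by left.
  by rewrite !iw ?mw //; have [|->->->//] := @index3 m.+1 m.+2 m; rewrite /= !inE; lia.
- right; exists m.+1, m; split=> //; first by right.
  by rewrite !iw ?mw //; have [|->->->//] := @index3 m.+1 m m.+2; rewrite /= !inE; lia.
- right; exists m.+1, m; split=> //; first by right.
  by rewrite !iw ?mw //; have [|->->->//] := @index3 m.+2 m m.+1; rewrite /= !inE; lia.
Qed.

Lemma index_strictly_between (u v : seq nat) (a b t : nat) s :
  let w := u ++ a :: v ++ b :: s in uniq w ->
  (index a w < index t w < index b w) || (index b w < index t w < index a w) -> t \in v.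
Proof.
move=> w uw; have nb : index b w = (size u + (size v).+1)%N.
  have e : w = (u ++ a :: v) ++ b :: s by rewrite /w -catA.
  move: uw; rewrite -/w e => /[dup] uw; rewrite cat_uniq => /and3P[_ /hasPn nin _].
  rewrite index_cat ifN; last by apply: nin; rewrite mem_head.
  by rewrite /= eqxx addn0 size_cat.
have na : index a w = size u.
  move: uw; rewrite cat_uniq => /and3P[_ /hasPn nin _].
  rewrite index_cat ifN; last by apply: nin; rewrite mem_head.
  by rewrite /= eqxx addn0.
rewrite na nb /w index_cat; case: ifP => [tu|_].
  by move: tu; rewrite -index_mem; move: (index t u) (size u) (size v) => a1 a2 a3 *; exfalso; lia.
rewrite /=; case: eqP => [_|_].
  by move: (size u) (size v) => a1 a2 *; exfalso; lia.
rewrite index_cat; case: ifP => // _.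
by move: (index t _) (size u) (size v) => a1 a2 a3 *; exfalso; lia.
Qed.

Lemma filter_window_mid i A M B : uniq (A ++ M ++ B) -> {subset window i <= M} ->
  [seq z <- A ++ M ++ B | z \in window i] = [seq z <- M | z \in window i].
Proof.
rewrite !cat_uniq has_cat negb_or => /and3P[_ /andP[/hasPn nA _] /and3P[_ /hasPn nB _]] sub.
rewrite !filter_cat (filter_window_nil (s := A)); last by move=> z /sub/nA.
by rewrite (filter_window_nil (s := B)) ?cats0 // => z /sub zM; apply/negP=> /nB; rewrite /= zM.
Qed.

Lemma map_dual_out i w s : (forall z, z \in window i -> z \notin s) ->
  map (dual_subst i w) s = s.
Proof.
move=> out; apply: map_id_in => z zs; apply: dual_subst_out.
by apply/negP=> /out; rewrite zs.
Qed.

Lemma sorted_ltn_cat (s1 s2 : seq nat) :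
  sorted ltn (s1 ++ s2) = [&& sorted ltn s1, sorted ltn s2 & allrel ltn s1 s2].
Proof. by rewrite !(sorted_pairwise ltn_trans) pairwise_cat andbC -andbA [X in _ = X]andbCA; case: allrel => //=; rewrite ?andbF ?andbT // andbC. Qed.

Lemma exchange_lt p a b : a < b -> ~ (a = p /\ b = p.+1) -> exchange p a < exchange p b.
Proof.
rewrite !exchangeE => ab n; case: (a =P p) => [ap|ap].
  by case: (b =P p) => [|_]; [lia | rewrite ifN; [lia | apply/eqP=> bp; case: n]].
by case: (a =P p.+1) => [ap'|_]; (case: (b =P p) => [|_]; [lia|]); case: (b =P p.+1) => [|_]; lia.
Qed.

(* [f] and [f'] differ only when the window consists of [x], the bumped letter
   [y] and a neighbour of [y] in the row; the bumped position then moves by one. *)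
Lemma bump_dual m A r1 y r2 x B :
  let W := A ++ (r1 ++ y :: r2) ++ x :: B in
  let W' := A ++ y :: (r1 ++ x :: r2) ++ B in
  let f := dual_subst m.+1 W in let f' := dual_subst m.+1 W' in
  uniq W -> {subset window m.+1 <= W} ->
  sorted ltn (r1 ++ y :: r2) -> all (ltn^~ x) r1 -> x < y ->
  {in A ++ B, f =1 f'} /\
  exists s1 v s2, [/\ map f (r1 ++ y :: r2) = s1 ++ v :: s2, all (ltn^~ (f x)) s1,
                      f x < v, v = f' y & s1 ++ f x :: s2 = map f' (r1 ++ x :: r2)].
Proof.
move=> W W' f f' uW subW; rewrite sorted_ltn_cat => /and3P[sr1 sr2 /allrelP r12] /allP r1x xy.
have r2y z : z \in r2 -> y < z by move: sr2; rewrite /= (path_sortedE ltn_trans) => /andP[/allP yr2 _] /yr2.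
have eW : W = A ++ (r1 ++ y :: r2 ++ [:: x]) ++ B by rewrite /W -!catA /= -!catA.
have eW' : W' = A ++ (y :: r1 ++ x :: r2) ++ B by rewrite /W' -!catA /= -!catA.
have pWW' : perm_eq W W'.
  rewrite eW eW' perm_cat2l perm_cat2r -cat1s perm_catCA perm_cons perm_cat2l.
  by rewrite -[x :: r2]cat1s perm_catC.
have uW' : uniq W' by rewrite -(perm_uniq pWW').
have inM z : z \in r1 ++ y :: r2 ++ [:: x] = [|| z \in r1, z == y, z \in r2 | z == x].
  by rewrite mem_cat inE mem_cat inE.
have inM' z : z \in y :: r1 ++ x :: r2 = [|| z \in r1, z == y, z \in r2 | z == x].
  by rewrite inE mem_cat inE; case: (z \in r1); case: (z == y); case: (z \in r2); case: (z == x).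
have win z : z \in window m.+1 = [|| z == m, z == m.+1 | z == m.+2].
  by rewrite !inE.
have midout : {subset window m.+1 <= r1 ++ y :: r2 ++ [:: x]} -> {in A ++ B, f =1 f'}.
  move=> sub z zAB; rewrite /f /f' !dual_subst_out //; apply/negP=> /sub zM.
    move: uW'; rewrite eW' uniq_catCA cat_uniq => /and3P[_ /hasPn /(_ z zAB)].
    by rewrite /= inM' -inM zM.
  move: uW; rewrite eW uniq_catCA cat_uniq => /and3P[_ /hasPn /(_ z zAB)].
  by rewrite /= zM.
(* First exceptional case. By sortedness m+2 is the right neighbour of y, so the window reads m+1,
   m+2, m before the bump and m+1, m, m+2 after it. The substituted letter m+1 bumps m+2, one place
   to the right of the original bump. *)
have [/and3P[/eqP xm /eqP ym m2r2]|N1] := boolP [&& x == m, y == m.+1 & m.+2 \in r2].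
  have [r3 e3] : exists r3, r2 = m.+2 :: r3.
    case: r2 {inM inM' eW eW' W W' f f' uW subW pWW' uW' midout r12} sr2 m2r2 r2y => //= z r3.
    rewrite inE => /andP[yz sr] /orP[/eqP->|zr3] r2y; first by exists r3.
    have := r2y z (mem_head _ _); move: sr; rewrite (path_sortedE ltn_trans) => /andP[/allP/(_ _ zr3) /= ? _]; lia.
  subst r2 x y.
  have o1 z : z \in window m.+1 -> z \notin r1.
    by rewrite win => zw; apply/negP=> /r1x /= zr; lia.
  have o3 z : z \in window m.+1 -> z \notin r3.
    rewrite win => zw; apply/negP=> /= zr.
    move: sr2; rewrite /= => /andP[_]; rewrite (path_sortedE ltn_trans) => /andP[/allP/(_ _ zr) /= ? _]; lia.
  have sub : {subset window m.+1 <= r1 ++ m.+1 :: (m.+2 :: r3) ++ [:: m]}.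
    by move=> z; rewrite win inM inE => /or3P[] /eqP->; rewrite eqxx ?orbT.
  have sub' : {subset window m.+1 <= m.+1 :: r1 ++ m :: (m.+2 :: r3)}.
    by move=> z /sub; rewrite inM inM'.
  split; first exact: midout.
  have [e1 e2 e3 e4 [e5 e6]] := dual_subst_windowE m.
  have mw: (m \in window m.+1) * (m.+1 \in window m.+1) * (m.+2 \in window m.+1).
    by rewrite !win !eqxx !orbT.
  have ef : f =1 exchange m.
    move=> z; rewrite /f dual_subst_filter eW filter_window_mid -?eW //.
    rewrite filter_cat /= filter_cat (filter_window_nil o1) (filter_window_nil o3) /= !mw.
    exact: e4.
  have ef' : f' =1 exchange m.+1.
    move=> z; rewrite /f' dual_subst_filter eW' filter_window_mid -?eW' //.
    rewrite /= filter_cat /= (filter_window_nil o1) (filter_window_nil o3) /= !mw.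
    exact: e5.
  exists (rcons r1 m), m.+2, r3; split.
  - rewrite map_cat /= map_dual_out // map_dual_out // !ef !exchangeE !eqxx cat_rcons.
    by rewrite !ifN //; lia.
  - rewrite ef exchangeE eqxx all_rcons /= ltnSn; apply/allP=> z /r1x /=; lia.
  - by rewrite ef exchangeE eqxx.
  - by rewrite ef' exchangeE eqxx.
  - rewrite map_cat /= map_dual_out // map_dual_out // ef !ef' !exchangeE !eqxx cat_rcons.
    by rewrite !ifN //; lia.
(* Second exceptional case. Now m is the left neighbour of y, and the window reads m, m+2, m+1
   before the bump and m+2, m, m+1 after it. The substituted letter m bumps m+1, one place to the
   left. *)
have [/and3P[mr1 /eqP xm /eqP ym]|N2] := boolP [&& m \in r1, x == m.+1 & y == m.+2].
  have [r3 e3] : exists r3, r1 = rcons r3 m.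
    case/lastP: r1 {inM inM' eW eW' W W' f f' uW subW pWW' uW' midout r12 N1} sr1 mr1 r1x => //= r3 z.
    rewrite mem_rcons inE => sr /orP[/eqP->|zr3] r1x; first by exists r3.
    have := r1x z; rewrite mem_rcons mem_head => /(_ isT) /= zx.
    move: sr; rewrite -cats1 sorted_ltn_cat => /and3P[_ _ /allrelP /(_ m z zr3 (mem_head _ _))] /=; lia.
  subst r1 x y.
  have o1 z : z \in window m.+1 -> z \notin r2.
    by rewrite win => zw; apply/negP=> /r2y /= zr; lia.
  have o3 z : z \in window m.+1 -> z \notin r3.
    rewrite win => zw; apply/negP=> /= zr.
    move: sr1; rewrite -cats1 sorted_ltn_cat => /and3P[_ _ /allrelP /(_ z m zr (mem_head _ _))] /=; lia.
  have sub : {subset window m.+1 <= rcons r3 m ++ m.+2 :: r2 ++ [:: m.+1]}.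
    by move=> z; rewrite win inM mem_rcons inE => /or3P[] /eqP->; rewrite eqxx ?orbT.
  have sub' : {subset window m.+1 <= m.+2 :: rcons r3 m ++ m.+1 :: r2}.
    by move=> z /sub; rewrite inM inM'.
  split; first exact: midout.
  have [e1 e2 e3 e4 [e5 e6]] := dual_subst_windowE m.
  have mw: (m \in window m.+1) * (m.+1 \in window m.+1) * (m.+2 \in window m.+1).
    by rewrite !win !eqxx !orbT.
  have ef : f =1 exchange m.
    move=> z; rewrite /f dual_subst_filter eW filter_window_mid -?eW //.
    rewrite filter_cat filter_rcons /= filter_cat (filter_window_nil o1) (filter_window_nil o3) /= !mw.
    exact: e3.
  have ef' : f' =1 exchange m.+1.
    move=> z; rewrite /f' dual_subst_filter eW' filter_window_mid -?eW' //.
    rewrite /= filter_cat filter_rcons /= (filter_window_nil o1) (filter_window_nil o3) /= !mw.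
    exact: e6.
  exists r3, m.+1, (m.+2 :: r2); split.
  - rewrite map_cat map_rcons /= map_dual_out // map_dual_out // !ef !exchangeE !eqxx cat_rcons.
    by rewrite !ifN //; lia.
  - rewrite ef exchangeE eqxx ifN; last lia. apply/allP=> z zr /=.
    move: sr1; rewrite -cats1 sorted_ltn_cat => /and3P[_ _ /allrelP /(_ z m zr (mem_head _ _))] //.
  - rewrite ef exchangeE eqxx ifN //; lia.
  - rewrite ef' exchangeE eqxx ifN //; lia.
  - rewrite map_cat map_rcons /= map_dual_out // map_dual_out // !ef !ef' !exchangeE !eqxx cat_rcons.
    by rewrite !ifN //; lia.
(* The bump moves y left across [r1], whose letters are below x, and x left across [r2], whose
   letters are above y. If two window letters cross, the third letter of the bump lies strictly
   between them, so the window is exactly one of the two exceptional cases. *)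
have eff' : f = f'.
  apply: eq_dual_subst; rewrite eW eW' filter_cat [RHS]filter_cat; congr (_ ++ _).
  rewrite filter_cat [RHS]filter_cat; congr (_ ++ _).
  set g := filter (mem (window m.+1)).
  have g1 : g (r1 ++ [:: y]) = g (y :: r1).
    rewrite -[y :: r1]cat1s /g !filter_cat /=; case: ifP => yw; last by rewrite cats0.
    rewrite filter_window_nil // => z zw; apply/negP=> zr1.
    have /= zx := r1x z zr1; rewrite win in zw; rewrite win in yw.
    have [zm xm ym] : [/\ z = m, x = m.+1 & y = m.+2] by split; lia.
    by case/negP: N2; rewrite -zm zr1 zm xm ym !eqxx.
  have g2 : g (x :: r2) = g (r2 ++ [:: x]).
    rewrite -[x :: r2]cat1s /g !filter_cat /=; case: ifP => yw; last by rewrite cats0.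
    rewrite filter_window_nil // => z zw; apply/negP=> zr2.
    have /= yz := r2y z zr2; rewrite win in zw; rewrite win in yw.
    have [zm xm ym] : [/\ z = m.+2, x = m & y = m.+1] by split; lia.
    by case/negP: N1; rewrite -zm zr2 xm ym !eqxx.
  have gc s1 s2 : g (s1 ++ s2) = g s1 ++ g s2 by exact: filter_cat.
  have -> : r1 ++ y :: r2 ++ [:: x] = (r1 ++ [:: y]) ++ (r2 ++ [:: x]) by rewrite -catA.
  by rewrite -[LHS]/(g _) -[RHS]/(g ((y :: r1) ++ (x :: r2))) gc [RHS]gc g1 g2.
have pw : perm_eq [seq z <- W | z \in window m.+1] (window m.+1).
  apply: uniq_perm; first exact: filter_uniq.
    by rewrite /= !inE; lia.
  by move=> z; rewrite mem_filter; case: (boolP (z \in window _)) => //= /subW.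
(* With a single substitution left, the bump position is unchanged as soon as f preserves the
   comparisons of x with [r1] and with y. A failure would put p and p+1 at the compared places, and
   the witness t between them leads back to an exceptional case. *)
suff [fr1x fxy] : all (ltn^~ (f x)) (map f r1) /\ f x < f y.
  split; first by rewrite eff'.
  by exists (map f r1), (f y), (map f r2); rewrite -eff' !map_cat.
have [fid|[p [t [ef pt tb]]]] := dual_substP pw.
  split; last by rewrite /f !fid.
  by apply/allP=> _ /mapP[z zr ->]; rewrite /f !fid; apply: r1x.
split; rewrite /f; last first.
  rewrite !ef; apply: exchange_lt => // -[xp yp].
  have := @index_strictly_between (A ++ r1) r2 y x t B.
  have -> : (A ++ r1) ++ y :: r2 ++ x :: B = W by rewrite /W -!catA.
  move: tb; rewrite -yp -xp orbC => tb /(_ uW tb) tr2.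
  have yt := r2y t tr2.
  have [pm tm] : p = m /\ t = m.+2 by lia.
  by case/negP: N1; rewrite -tm tr2 yp xp pm !eqxx.
apply/allP=> _ /mapP[e er ->] /=; rewrite !ef; apply: exchange_lt; first exact: r1x e er.
move=> [ep xp]; have [a [b eab]] : exists a b, r1 = a ++ e :: b.
  by case/splitPr: er => a b; exists a, b.
have eW2 : W = (A ++ a) ++ e :: (b ++ y :: r2) ++ x :: B.
  by rewrite /W eab -!(catA, cat_cons).
have := @index_strictly_between (A ++ a) (b ++ y :: r2) e x t B.
rewrite -eW2 ep xp => /(_ uW tb); rewrite mem_cat inE => tin.
have tx : x < t.
  case/or3P: tin => [tb'|/eqP -> //|/r2y]; last exact: ltn_trans.
  have tr1 : t \in r1 by rewrite eab mem_cat inE tb' !orbT.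
  have et : e < t.
    move: sr1; rewrite eab sorted_ltn_cat => /and3P[_ /=]; rewrite (path_sortedE ltn_trans).
    by move=> /andP[/allP /(_ t tb')].
  have /= tx := r1x t tr1; exfalso; move: et tx; rewrite ep xp; clear; lia.
have [pm tm] : p = m /\ t = m.+2 by move: pt tx xp; clear; lia.
have yt : y = t.
  case/or3P: tin => [tb'|/eqP -> //|/r2y yt].
    have tr1 : t \in r1 by rewrite eab mem_cat inE tb' !orbT.
    by have /= := r1x t tr1; move: tx; clear; lia.
  by move: yt xy; rewrite tm xp pm; clear; lia.
by case/negP: N2; rewrite -pm -ep er xp ep pm yt tm !eqxx.
Qed.

(** If x = p+1 and p lies in the row, the witness t stands between them in the word, hence further
    right in the increasing row than p and below x: no integer is left for it. *)
Lemma append_dual m A r x B :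
  let W := A ++ r ++ x :: B in let f := dual_subst m.+1 W in
  uniq W -> {subset window m.+1 <= W} -> sorted ltn r -> all (ltn^~ x) r ->
  all (ltn^~ (f x)) (map f r).
Proof.
move=> W f uW subW sr /allP rx.
have pw : perm_eq [seq z <- W | z \in window m.+1] (window m.+1).
  apply: uniq_perm; first exact: filter_uniq.
    by rewrite /= !inE; lia.
  by move=> z; rewrite mem_filter; case: (boolP (z \in window _)) => //= /subW.
have [fid|[p [t [ef pt tb]]]] := dual_substP pw.
  by apply/allP=> _ /mapP[z zr ->]; rewrite /f !fid; apply: rx.
apply/allP=> _ /mapP[e er ->] /=; rewrite /f !ef !exchangeE.
have [[ep xp]|n] : (e = p /\ x = p.+1) \/ ~ (e = p /\ x = p.+1) by lia.
  have [a [b eab]] : exists a b, r = a ++ e :: b.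
    by case/splitPr: er => a b; exists a, b.
  have eW2 : W = (A ++ a) ++ e :: b ++ x :: B by rewrite /W eab -!(catA, cat_cons).
  have := @index_strictly_between (A ++ a) b e x t B.
  rewrite -eW2 ep xp => /(_ uW tb) tb'.
  have tr : t \in r by rewrite eab mem_cat inE tb' !orbT.
  have /= := rx t tr; move: sr; rewrite eab sorted_ltn_cat => /and3P[_ /=].
  rewrite (path_sortedE ltn_trans) => /andP[/allP /(_ t tb') /=]; lia.
by have /= := rx e er; do ?case: eqP; lia.
Qed.

Lemma all_leq_ltn x r : x \notin r -> all (leq^~ x) r -> all (ltn^~ x) r.
Proof.
move=> xr /allP rx; apply/allP=> z zr; have /= zx := rx z zr.
rewrite /= ltn_neqAle zx andbT.
by apply: contraNneq xr => <-.
Qed.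

Lemma all_ltn_leq x r : all (ltn^~ x) r -> all (leq^~ x) r.
Proof. by move=> /allP rx; apply/allP=> z /rx /ltnW. Qed.

Lemma row_insert_append row T x : all (leq^~ x) row ->
  row_insert (row :: T) x = rcons row x :: T.
Proof.
by move=> /allP rx /=; rewrite ifN // -has_find; apply/hasPn=> z /rx; rewrite -leqNgt.
Qed.

Lemma set_nth_cat (s1 s2 : seq nat) x y : set_nth 0 (s1 ++ y :: s2) (size s1) x = s1 ++ x :: s2.
Proof. by elim: s1 => //= z s1 ->. Qed.

Lemma row_insert_bump r1 y r2 T x : all (leq^~ x) r1 -> x < y ->
  row_insert ((r1 ++ y :: r2) :: T) x = (r1 ++ x :: r2) :: row_insert T y.
Proof.
move=> /allP rx xy /=.
have -> : find (ltn x) (r1 ++ y :: r2) = size r1.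
  rewrite find_cat ifN /= ?xy ?addn0 //; apply/hasPn=> z /rx; by rewrite -leqNgt.
by rewrite size_cat /= addnS ltnS leq_addr nth_cat ltnn subnn set_nth_cat.
Qed.

Lemma row_split row x : all (leq^~ x) row \/
  exists r1 y r2, [/\ row = r1 ++ y :: r2, all (leq^~ x) r1 & x < y].
Proof.
elim: row => [|z row IHrow]; first by left.
have [lt|gt] := ltnP x z; first by right; exists [::], z, row.
case: IHrow => [a|[r1 [y [r2 [-> a xy]]]]]; first by left; rewrite /= gt.
by right; exists (z :: r1), y, r2; rewrite /= gt.
Qed.

Lemma row_word_cons row T : row_word (row :: T) = row_word T ++ row.
Proof. by rewrite /row_word rev_cons flatten_rcons. Qed.

Lemma perm_bump (s r1 r2 : seq nat) x y :
  perm_eq (y :: s ++ r1 ++ x :: r2) (x :: s ++ r1 ++ y :: r2).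
Proof. by apply/permP=> p; rewrite /= !count_cat /= !addnA; lia. Qed.

Lemma perm_row_insert T x : perm_eq (row_word (row_insert T x)) (x :: row_word T).
Proof.
elim: T x => [|row T IHT] x //; rewrite [in X in perm_eq _ X]row_word_cons.
case: (row_split row x) => [a|[r1 [y [r2 [-> a xy]]]]].
  by rewrite row_insert_append // row_word_cons -cats1 catA -[x :: _]cat1s perm_catC.
rewrite row_insert_bump // row_word_cons; apply: perm_trans (perm_bump _ _ _ _ _).
by rewrite -cat_cons perm_cat2r.
Qed.

Lemma sorted_row_bump (r1 r2 : seq nat) x y : sorted ltn (r1 ++ y :: r2) ->
  all (ltn^~ x) r1 -> x < y -> sorted ltn (r1 ++ x :: r2).
Proof.
rewrite !sorted_ltn_cat => /and3P[-> /= s2 /allrelP a] /allP rx xy /=.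
apply/andP; split.
  move: s2; rewrite !(path_sortedE ltn_trans) => /andP[/allP yr ->].
  by rewrite andbT; apply/allP=> z /yr; apply: ltn_trans.
apply/allrelP=> u v ur; rewrite inE => /orP[/eqP ->|vr]; first exact: rx.
by apply: a; rewrite // inE vr orbT.
Qed.

Lemma sorted_row_append (row : seq nat) x : sorted ltn row -> all (ltn^~ x) row ->
  sorted ltn (rcons row x).
Proof.
move=> s /allP rx; rewrite -cats1 sorted_ltn_cat s /=; apply/allrelP=> u v /rx ur.
by rewrite inE => /eqP ->.
Qed.

Lemma uniq_bump (s r1 r2 : seq nat) x y : uniq (x :: s ++ r1 ++ y :: r2) ->
  x \notin r1 /\ uniq (y :: s).
Proof.
rewrite -(perm_uniq (perm_bump s r1 r2 x y)) -cat_cons cat_uniq => /and3P[-> _].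
rewrite cat_uniq /= negb_or => /and3P[_ /andP[-> _] _]; split=> //.
Qed.

Lemma row_insert_rows T x : uniq (x :: row_word T) -> all (sorted ltn) T ->
  all (sorted ltn) (row_insert T x).
Proof.
elim: T x => // row T IHT x; rewrite row_word_cons => u /= /andP[sr sT].
case: (row_split row x) => [a|[r1 [y [r2 [e a xy]]]]].
  have /= -> := row_insert_append T a; rewrite /= sT sorted_row_append ?all_leq_ltn //.
  by move: u; rewrite /= mem_cat negb_or => /andP[/andP[]].
subst row; have /= -> := row_insert_bump r2 T a xy; have [xr1 u'] := uniq_bump u.
by rewrite /= (sorted_row_bump sr) ?all_leq_ltn //=; apply: IHT.
Qed.

Lemma perm_insertion w : perm_eq (row_word (insertion w)) w.
Proof.
elim/last_ind: w => // w x IHw; rewrite /insertion foldl_rcons.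
by rewrite (perm_trans (perm_row_insert _ _)) // perm_sym perm_rcons perm_cons perm_sym.
Qed.

Lemma insertion_rows w : uniq w -> all (sorted ltn) (insertion w).
Proof.
elim/last_ind: w => // w x IHw; rewrite rcons_uniq => /andP[xw uw].
rewrite /insertion foldl_rcons; apply: row_insert_rows; last exact: IHw.
by rewrite /= (perm_mem (perm_insertion w)) xw (perm_uniq (perm_insertion w)).
Qed.

Lemma perm_bump_mid (s r1 r2 B : seq nat) x y :
  perm_eq (s ++ y :: (r1 ++ x :: r2) ++ B) (s ++ (r1 ++ y :: r2) ++ x :: B).
Proof. by apply/permP=> p; rewrite ?count_cat /= ?count_cat /= ?count_cat /=; lia. Qed.

Lemma uniq_bump_mid (s r1 r2 B : seq nat) x y :
  uniq (s ++ (r1 ++ y :: r2) ++ x :: B) -> x \notin r1.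
Proof.
have p : perm_eq (s ++ (r1 ++ y :: r2) ++ x :: B) (r1 ++ x :: s ++ y :: r2 ++ B).
  by apply/permP=> p; rewrite ?count_cat /= ?count_cat /= ?count_cat /=; lia.
by rewrite (perm_uniq p) cat_uniq /= negb_or => /and3P[_ /andP[]].
Qed.

(** The substitution depends on the whole current word, that is, the tableau followed by the letters
    B still to be inserted. The agreement on B lets the next insertion start from the right letters.
    When y is bumped, the induction passes to the rows above and the changed bottom row joins B,
    since higher rows are read first. *)
Lemma row_insert_dual m T x B :
  let f := dual_subst m.+1 (row_word T ++ x :: B) in
  let f' := dual_subst m.+1 (row_word (row_insert T x) ++ B) in
  uniq (row_word T ++ x :: B) -> {subset window m.+1 <= row_word T ++ x :: B} ->
  all (sorted ltn) T ->
  {in B, f =1 f'} /\ row_insert (map (map f) T) (f x) = map (map f') (row_insert T x).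
Proof.
elim: T x B => [|row T IHT] x B; first by [].
rewrite [row_word (row :: T)]row_word_cons -catA => f f' uW subW /= /andP[sr sT].
case: (row_split row x) => [a|[r1 [y [r2 [e a xy]]]]].
  have eW : row_word (row_insert (row :: T) x) ++ B = row_word T ++ row ++ x :: B.
    by rewrite row_insert_append // row_word_cons -cats1 -!catA.
  have xr : x \notin row.
    move: uW; rewrite cat_uniq => /and3P[_ _]; rewrite cat_uniq /= negb_or => /and3P[_ /andP[//]].
  have fa := append_dual uW subW sr (all_leq_ltn xr a).
  rewrite /f' eW; split=> //; have /= -> := row_insert_append (map (map f) T) (all_ltn_leq fa).
  by have /= -> := row_insert_append T a; rewrite /= map_rcons.
subst row; have eW : row_word (row_insert ((r1 ++ y :: r2) :: T) x) ++ B =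
    row_word (row_insert T y) ++ (r1 ++ x :: r2) ++ B.
  by rewrite row_insert_bump // row_word_cons -catA.
have xr := uniq_bump_mid uW.
have := bump_dual uW subW sr (all_leq_ltn xr a) xy.
set f1 := dual_subst _ (row_word T ++ y :: _) => -[ff1 [s1 [v [s2 [e1 a1 xv ev e2]]]]].
have pW := perm_bump_mid (row_word T) r1 r2 B x y.
have [] := IHT y ((r1 ++ x :: r2) ++ B) => //.
- by rewrite (perm_uniq pW).
- by move=> z /subW; rewrite (perm_mem pW).
rewrite -/f1 -eW -/f' => f1f' eT.
split=> [z zB|].
  by rewrite /f ff1 ?mem_cat ?zB ?orbT // f1f' // mem_cat zB orbT.
have /= -> := row_insert_bump r2 T a xy; rewrite [map]lock /= -lock -/f e1.
have /= -> := row_insert_bump s2 (map (map f) T) (all_ltn_leq a1) xv.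
rewrite /= e2; congr (_ :: _).
  by apply/eq_in_map => z zr; apply: f1f'; rewrite mem_cat zr.
rewrite -eT ev; congr (row_insert _ _); apply/eq_in_map => r rT.
apply/eq_in_map => z zr; apply: ff1; rewrite mem_cat; apply/orP; left.
by apply/flattenP; exists r; rewrite // mem_rev.
Qed.

Lemma foldl_row_insert_dual m w T :
  let f := dual_subst m.+1 (row_word T ++ w) in
  let f' := dual_subst m.+1 (row_word (foldl row_insert T w)) in
  uniq (row_word T ++ w) -> {subset window m.+1 <= row_word T ++ w} ->
  all (sorted ltn) T ->
  foldl row_insert (map (map f) T) (map f w) = map (map f') (foldl row_insert T w).
Proof.
elim: w T => [|x w IHw] T f f' uW subW sT; first by rewrite /f /f' cats0.
have [e1 e2] := row_insert_dual uW subW sT.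
have pW : perm_eq (row_word (row_insert T x) ++ w) (row_word T ++ x :: w).
  by rewrite perm_sym -cat1s perm_catCA catA perm_cat2r perm_sym perm_row_insert.
rewrite /= -/f e2 -IHw.
- congr foldl; apply/eq_in_map; exact: e1.
- by rewrite (perm_uniq pW).
- by move=> z /subW; rewrite (perm_mem pW).
- apply: row_insert_rows => //.
  by move: uW; rewrite -cat1s uniq_catCA catA cat_uniq => /andP[].
Qed.

Lemma insertion_dual_word i w : uniq w -> {subset window i <= w} -> 0 < i ->
  insertion (dual_word i w) = dual_tab row_word i (insertion w).
Proof.
by case: i => // m uw subw _; apply: (@foldl_row_insert_dual m w [::]).
Qed.

(** * Inverse descents under row insertion *)

Lemma eq_index_lt (s s' : seq nat) p :
  [seq z <- s | z \in [:: p; p.+1]] = [seq z <- s' | z \in [:: p; p.+1]] ->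
  (index p.+1 s < index p s) = (index p.+1 s' < index p s').
Proof.
move=> e; rewrite -(@index_filter_lt (mem [:: p; p.+1]) s) ?inE ?eqxx ?orbT // e.
by rewrite (@index_filter_lt (mem [:: p; p.+1]) s') ?inE ?eqxx ?orbT.
Qed.

(** In a bump y crosses letters smaller than x, and x crosses letters larger than y. The crossing
    values have a third value strictly between them, so p and p+1 never cross. *)
Lemma row_insert_descent T x B p : uniq (row_word T ++ x :: B) -> all (sorted ltn) T ->
  (index p.+1 (row_word (row_insert T x) ++ B) < index p (row_word (row_insert T x) ++ B)) =
  (index p.+1 (row_word T ++ x :: B) < index p (row_word T ++ x :: B)).
Proof.
move=> uW sT; apply: eq_index_lt; elim: T x B uW sT => [|row T IHT] x B // uW /= /andP[sr sT].
case: (row_split row x) => [a|[r1 [y [r2 [e a xy]]]]].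
  by have /= -> := row_insert_append T a; rewrite !row_word_cons -cats1 -!catA.
subst row; have /= -> := row_insert_bump r2 T a xy; rewrite !row_word_cons.
have pW := perm_bump_mid (row_word T) r1 r2 B x y.
have xr : x \notin r1 by move: (uW); rewrite row_word_cons -catA => /uniq_bump_mid.
have /allP r1x := all_leq_ltn xr a.
have r2y z : z \in r2 -> y < z.
  by move: sr; rewrite sorted_ltn_cat /= (path_sortedE ltn_trans) => /and3P[_ /andP[/allP yr2 _] _] /yr2.
rewrite -catA IHT //; last by rewrite (perm_uniq pW) catA -row_word_cons.
set g := fun z => z \in [:: p; p.+1].
have gc s1 s2 : filter g (s1 ++ s2) = filter g s1 ++ filter g s2 by exact: filter_cat.
have g0 s : (forall z, g z -> z \notin s) -> filter g s = [::].
  move=> out; apply/eqP; rewrite -size_eq0 size_filter -leqn0 leqNgt -has_count.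
  by apply/hasPn=> z zs; apply/negP=> /out; rewrite zs.
have g1 : filter g (r1 ++ [:: y]) = filter g (y :: r1).
  rewrite -[y :: r1]cat1s !gc /=; case: ifP => gy; last by rewrite cats0.
  rewrite g0 // => z gz; apply/negP=> zr1; have /= := r1x z zr1.
  by move: gy gz xy; rewrite /g !inE; clear; lia.
have g2 : filter g (x :: r2) = filter g (r2 ++ [:: x]).
  rewrite -[x :: r2]cat1s !gc /=; case: ifP => gy; last by rewrite cats0.
  rewrite g0 // => z gz; apply/negP=> zr2; have /= := r2y z zr2.
  by move: gy gz xy; rewrite /g !inE; clear; lia.
have -> : y :: (r1 ++ x :: r2) ++ B = (y :: r1) ++ (x :: r2) ++ B by rewrite -catA.
have -> : (row_word T ++ r1 ++ y :: r2) ++ x :: B = row_word T ++ (r1 ++ [:: y]) ++ (r2 ++ [:: x]) ++ B.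
  by rewrite -!catA.
by rewrite !(gc (row_word T)) (gc (y :: r1)) (gc (x :: r2)) (gc (r1 ++ _)) (gc (r2 ++ _)) g1 g2.
Qed.

Lemma inv_descents_insertion w : uniq w -> inv_descents (row_word (insertion w)) = inv_descents w.
Proof.
move=> uw; rewrite /inv_descents (perm_size (perm_insertion w)); apply: eq_filter => p.
suff foldE T v : uniq (row_word T ++ v) -> all (sorted ltn) T ->
  let W := row_word (foldl row_insert T v) in
  (index p.+1 W < index p W) = (index p.+1 (row_word T ++ v) < index p (row_word T ++ v)).
  exact: (foldE [::] w).
elim: v T => [|x v IHv] T; first by rewrite cats0.
move=> uW sT /=; rewrite -row_insert_descent // IHv //.
  have pW : perm_eq (row_word (row_insert T x) ++ v) (row_word T ++ x :: v).
    by rewrite perm_sym -cat1s perm_catCA catA perm_cat2r perm_sym perm_row_insert.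
  by rewrite (perm_uniq pW).
apply: row_insert_rows => //.
by move: uW; rewrite -cat1s uniq_catCA catA cat_uniq => /andP[].
Qed.

Lemma sorted_index_lt (T : eqType) (R : rel T) s : transitive R -> irreflexive R ->
  sorted R s -> {in s &, forall x y, (index x s < index y s) = R x y}.
Proof.
move=> trR irR sR x y xs ys; apply/idP/idP; first exact: sorted_ltn_index.
move=> Rxy; rewrite ltnNge leq_eqVlt; apply/negP=> /orP[/eqP/(index_inj x ys xs) yx|].
  by rewrite yx irR in Rxy.
by move=> /(sorted_ltn_index trR sR y x ys xs) /(trR _ _ _ Rxy); rewrite irR.
Qed.

(** Rows at any distance are compared, because a column of a composition diagram may skip rows. *)
Lemma sorted_col_upP (R : rel nat) T c : transitive R ->
  reflect (forall r r', r < r' -> c < size (nth [::] T r) -> c < size (nth [::] T r') ->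
             R (entry T r c) (entry T r' c))
          (sorted R (col_up T c)).
Proof.
move=> trR; have szT r : c < size (nth [::] T r) -> r < size T.
  by case: (ltnP r (size T)) => // /(nth_default [::]) ->.
have lenE r : row_len (shape T) r = size (nth [::] T r).
  rewrite /row_len /shape; case: (ltnP r (size T)) => rT; first by rewrite (nth_map [::]).
  by rewrite !nth_default ?size_map.
rewrite /col_up sorted_map; set s := filter _ _.
have ms r : (r \in s) = (c < size (nth [::] T r)).
  rewrite mem_filter lenE mem_iota add0n /=; apply/andP/idP => [[]|rc] //; split=> //; exact: szT.
have ss : sorted ltn s by apply: (sorted_filter ltn_trans); apply: iota_ltn_sorted.
apply: (iffP idP) => [sR r r' rr' rc r'c | H].
  have := @sorted_ltn_index _ (relpre (fun r => entry T r c) R) _ s sR r r'.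
  rewrite !ms; apply=> //; first by move=> ? ? ?; apply: trR.
  by rewrite (sorted_index_lt ltn_trans ltnn) ?ms.
apply: (sub_in_sorted (P := mem s)) ss; last exact/allP.
by move=> r r' /= rs r's rr'; apply: H => //; rewrite -ms.
Qed.

(** * Insertion tableaux are standard *)

(** The condition on a row r1 lying above r0 in a standard Young tableau. Being transitive, it has
    to be checked on neighbouring rows only. *)
Definition dominates (r0 r1 : seq nat) : bool :=
  (size r1 <= size r0) && all (fun c => nth 0 r0 c < nth 0 r1 c) (iota 0 (size r1)).

Lemma dominatesP r0 r1 : reflect
  (size r1 <= size r0 /\ forall c, c < size r1 -> nth 0 r0 c < nth 0 r1 c) (dominates r0 r1).
Proof.
apply: (iffP andP) => -[-> H]; split=> //.
  by move=> c c1; apply: (allP H); rewrite mem_iota.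
by apply/allP=> c; rewrite mem_iota; apply: H.
Qed.

Lemma dominates_trans : transitive dominates.
Proof.
move=> r1 r0 r2 /dominatesP[s01 d01] /dominatesP[s12 d12]; apply/dominatesP; split.
  exact: leq_trans s01.
by move=> c c2; apply: ltn_trans (d12 c c2); apply: d01; apply: leq_trans s12.
Qed.

Definition bump_row (row : seq nat) (x : nat) : seq nat := set_nth 0 row (find (ltn x) row) x.

Lemma row_insert_head T x : row_insert T x = bump_row (head [::] T) x ::
  (let row := head [::] T in let k := find (ltn x) row in
   if k < size row then row_insert (behead T) (nth 0 row k) else behead T).
Proof.
case: T => //= row T; case: ifP => // kr; congr (_ :: _); rewrite /bump_row.
have -> : find (ltn x) row = size row.
  by apply/eqP; rewrite eqn_leq find_size leqNgt kr.
by elim: row {kr} => //= y row ->.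
Qed.

(** Bumping paths move weakly left: the entry above the bumped y exceeds y, so y enters the next row
    no further right than the column it left, above x or above an entry at most x. *)
Lemma dominates_bump row row1 x : sorted ltn row -> dominates row row1 ->
  find (ltn x) row < size row ->
  dominates (bump_row row x) (bump_row row1 (nth 0 row (find (ltn x) row))).
Proof.
move=> srow /dominatesP[s01 d01]; set k := find _ row => kr; set y := nth 0 row k.
have xy : x < y by apply: (@nth_find _ 0 (ltn x)); rewrite has_find.
have k1k : find (ltn y) row1 <= k.
  rewrite leqNgt; apply/negP=> kk1; have /= := before_find 0 kk1.
  by rewrite d01 // (leq_trans kk1) ?find_size.
set k1 := find (ltn y) row1 in k1k *; have k1r : k1 <= size row1 by apply: find_size.
apply/dominatesP; rewrite /bump_row !size_set_nth -/k -/k1; split.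
  by move: s01 kr k1k; clear; lia.
move=> c c1; rewrite !nth_set_nth /=.
have le c' : c' <= k -> c' != k -> nth 0 row c' <= x.
  move=> ck nck; have ck' : c' < k by rewrite ltn_neqAle nck.
  by have /= := before_find 0 ck'; rewrite ltnNge => /negbFE.
case: (c =P k1) => [ck1|ck1].
  by case: eqP => // ck; apply: leq_ltn_trans xy; apply: le; [rewrite ck1|apply/eqP].
have c1' : c < size row1 by move: c1 ck1 k1r; clear; lia.
by case: eqP => [ck|_]; [apply: ltn_trans xy _; rewrite /y -ck|]; apply: d01.
Qed.

Lemma row_insert_dominates T x : all (sorted ltn) T -> sorted dominates T ->
  sorted dominates (row_insert T x).
Proof.
elim: T x => // row T IHT x /andP[srow sT] dT; rewrite row_insert_head /=.
have dT' : sorted dominates T by apply: path_sorted dT.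
case: ifP => kr.
  have := IHT (nth 0 row (find (ltn x) row)) sT dT'; rewrite row_insert_head /= => ->.
  rewrite andbT dominates_bump //; case: (T) dT => [|row1 T1] /=; last by case/andP.
  by move=> _; apply/dominatesP.
move: dT; case: (T) => //= row1 T1 /andP[/dominatesP[s01 d01] ->]; rewrite andbT.
have ks : find (ltn x) row = size row.
  by apply/eqP; rewrite eqn_leq find_size leqNgt kr.
apply/dominatesP; rewrite /bump_row size_set_nth ks; split; first by rewrite leq_max s01 orbT.
by move=> c c1; rewrite nth_set_nth /= ifN ?d01 // neq_ltn (leq_trans c1).
Qed.

Lemma row_insert_nil_free T x : [::] \notin T -> [::] \notin row_insert T x.
Proof.
elim: T x => // row T IHT x; rewrite inE negb_or => /andP[r0 T0].
rewrite row_insert_head /= inE negb_or eq_sym -size_eq0 size_set_nth -lt0n leq_max /=.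
by case: ifP => _ //; apply: IHT.
Qed.

Lemma insertion_dominates w : uniq w -> sorted dominates (insertion w).
Proof.
elim/last_ind: w => // w x IHw; rewrite rcons_uniq => /andP[xw uw].
rewrite /insertion foldl_rcons; apply: row_insert_dominates; last exact: IHw.
exact: insertion_rows.
Qed.

Lemma insertion_nil_free w : [::] \notin insertion w.
Proof.
by elim/last_ind: w => // w x IHw; rewrite /insertion foldl_rcons row_insert_nil_free.
Qed.

Lemma perm_row_word T : perm_eq (row_word T) (flatten T).
Proof. by apply/permP=> p; rewrite !count_flatten map_rev sumn_rev. Qed.

Lemma mem_fillings sh T :
  (T \in fillings sh) = (shape T == sh) && perm_eq (flatten T) (iota 1 (sumn sh)).
Proof.
apply/mapP/andP => [[w]|[/eqP <- p]].
  rewrite mem_permutations => pw ->.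
  have sw : size w = sumn sh by rewrite (perm_size pw) size_iota.
  by rewrite reshapeKl ?sw // reshapeKr ?sw.
by exists (flatten T); rewrite ?flattenK // mem_permutations.
Qed.

Lemma insertion_SYT n w : perm_eq w (iota 1 n) -> SYTn n (insertion w).
Proof.
move=> pw; have uw : uniq w by rewrite (perm_uniq pw) iota_uniq.
have dT := insertion_dominates uw; have sT := insertion_rows uw; have nT := insertion_nil_free w.
have pT : perm_eq (flatten (insertion w)) (iota 1 n).
  by rewrite (perm_trans _ (perm_trans (perm_insertion w) pw)) // perm_sym perm_row_word.
set T := insertion w in dT sT nT pT *.
have szT : sumn (shape T) = n by rewrite -size_flatten (perm_size pT) size_iota.
rewrite /SYTn szT eqxx /=; apply/andP; split.
  rewrite /is_part /is_comp; apply/andP; split.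
    by apply: contra nT => /mapP[r rT /esym/eqP]; rewrite size_eq0 => /eqP <-.
  by rewrite sorted_map; apply: sub_sorted dT => r0 r1 /andP[].
rewrite mem_filter sT mem_fillings eqxx szT pT !andbT /=; apply/allP=> c _.
apply/(sorted_col_upP _ _ ltn_trans) => r r' rr' cr cr'.
have szr : r' < size T.
  by case: (ltnP r' (size T)) cr' => // /(nth_default [::]) ->.
have /dominatesP[_] := sorted_ltn_nth dominates_trans [::] dT r r' (ltn_trans rr' szr) szr rr'.
exact.
Qed.

(** * Injectivity of insertion on words with decreasing columns *)

Fixpoint new_row (T : tableau) (x : nat) : nat :=
  if T is row :: T' then
    let k := find (ltn x) row in
    if k < size row then (new_row T' (nth 0 row k)).+1 else 0
  else 0.

(** Row bumping: the path of the smaller letter stays weakly left of the first path, and in every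
    row it sends up a smaller letter than the first path did. It therefore still bumps in the row
    where the first path ended. *)
Lemma new_row_lt T x x' : x' < x -> new_row T x < new_row (row_insert T x) x'.
Proof.
elim: T x x' => [|row T IHT] x x' lt /=; first by rewrite lt.
set k := find (ltn x) row; case: ifP => kr /=.
  have xy : x < nth 0 row k by apply: (@nth_find _ 0 (ltn x)); rewrite has_find.
  have k'k : find (ltn x') (set_nth 0 row k x) <= k.
    rewrite leqNgt; apply/negP=> /(before_find 0) /=.
    by rewrite nth_set_nth /= eqxx lt.
  have sz : size (set_nth 0 row k x) = size row by rewrite size_set_nth; apply/maxn_idPr.
  rewrite sz (leq_ltn_trans k'k kr) ltnS; apply: IHT.
  rewrite nth_set_nth /=; case: eqP => // /eqP k'n.
  apply: leq_ltn_trans xy; have k'lt : find (ltn x') (set_nth 0 row k x) < k by rewrite ltn_neqAle k'n.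
  by have /= := before_find 0 k'lt; rewrite ltnNge => /negbFE.
have h : has (ltn x') (rcons row x) by rewrite has_rcons /= lt.
by rewrite -has_find h.
Qed.

(** The chain consists of the letters that the bumping path places in the successive rows, read from
    the top row down and ending with x. *)
Lemma row_insert_chain T x : exists s,
  [/\ subseq s (row_word (row_insert T x)), sorted gtn s, all (leq x) s & size s = (new_row T x).+1].
Proof.
elim: T x => [|row T IHT] x; first by exists [:: x]; rewrite /= eqxx leqnn.
rewrite /=; set k := find (ltn x) row; case: ifP => kr; last first.
  exists [:: x]; rewrite /= leqnn; split=> //.
  by rewrite row_word_cons sub1seq mem_cat mem_rcons mem_head orbT.
have xy : x < nth 0 row k by apply: (@nth_find _ 0 (ltn x)); rewrite has_find.
have [s [ss gs /allP as_ sz]] := IHT (nth 0 row k).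
exists (rcons s x); split.
- rewrite row_word_cons -cats1; apply: cat_subseq => //.
  rewrite sub1seq.
  by apply/(nthP 0); exists k; rewrite ?nth_set_nth /= ?eqxx // size_set_nth leq_max ltnSn.
- rewrite -cats1 (sorted_pairwise (rev_trans ltn_trans)) pairwise_cat -(sorted_pairwise (rev_trans ltn_trans)) gs /= andbT.
  by apply/allrelP=> u v us; rewrite inE => /eqP -> /=; apply: leq_trans xy (as_ u us).
- rewrite all_rcons leqnn; apply/allP=> u us; exact: leq_trans (ltnW xy) (as_ u us).
- by rewrite size_rcons sz.
Qed.

Lemma subseq_cat_split (T : eqType) (s a b : seq T) : subseq s (a ++ b) ->
  exists s1 s2, [/\ s = s1 ++ s2, subseq s1 a & subseq s2 b].
Proof.
elim: a s => [|x a IHa] [|y s] //=; try by exists [::], [::]; rewrite ?sub0seq.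
  by move=> h; exists [::], (y :: s); rewrite h.
case: eqP => [<-|yx] /IHa [s1 [s2 [e h1 h2]]].
  by exists (y :: s1), s2; rewrite e /= eqxx.
exists s1, s2; split=> //; exact: subseq_trans h1 (subseq_cons a x).
Qed.

Lemma sorted_gtn_cat (s1 s2 : seq nat) :
  sorted gtn (s1 ++ s2) = [&& sorted gtn s1, sorted gtn s2 & allrel gtn s1 s2].
Proof.
rewrite !(sorted_pairwise (rev_trans ltn_trans)) pairwise_cat.
by case: allrel; rewrite /= ?andbT ?andbF.
Qed.

(** One half of the invariance of decreasing subsequences, with a lower bound on the letters. Since
    rows increase, a decreasing sequence uses at most one letter of the new row; it is obstructed
    only if it uses y followed by some z' of that row. Then z' is at most x, and the pair y, z' is
    replaced by y, x, which does occur before the bump. *)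
Lemma row_insert_pullback T x B t s : uniq (row_word T ++ x :: B) -> all (sorted ltn) T ->
  subseq s (row_word (row_insert T x) ++ B) -> sorted gtn s -> all (leq t) s ->
  exists s', [/\ subseq s' (row_word T ++ x :: B), sorted gtn s', all (leq t) s' & size s' = size s].
Proof.
elim: T x B s => [|row T IHT] x B s uW /= sT; first by move=> *; exists s.
case/andP: sT => srow sT; case: (row_split row x) => [a|[r1 [y [r2 [e a xy]]]]].
  by have /= -> := row_insert_append T a; rewrite !row_word_cons -cats1 -!catA; exists s.
subst row; have /= -> := row_insert_bump r2 T a xy; rewrite !row_word_cons -catA => ss gs ts.
have pW := perm_bump_mid (row_word T) r1 r2 B x y.
have uW' : uniq (row_word T ++ y :: (r1 ++ x :: r2) ++ B) by rewrite (perm_uniq pW) catA -row_word_cons.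
have [s' [ss' gs' ts' <-]] := IHT y ((r1 ++ x :: r2) ++ B) s uW' sT ss gs ts.
move: ss' gs' ts'; clear s ss gs ts => ss gs ts; move: s' ss gs ts => s ss gs ts.
have xr : x \notin r1 by move: (uW); rewrite row_word_cons -catA => /uniq_bump_mid.
have a' := all_leq_ltn xr a.
have srow' := sorted_row_bump srow a' xy.
have [sA [s1 [es sAT ss1]]] := subseq_cat_split ss.
have [sM [sB [es1 sMr sBB]]] : exists sM sB, [/\ s1 = sM ++ sB, subseq sM (y :: (r1 ++ x :: r2)) & subseq sB B].
  exact: (@subseq_cat_split _ s1 (y :: (r1 ++ x :: r2)) B).
move: gs ts; rewrite es es1 !sorted_gtn_cat !all_cat allrel_catr.
move=> /and3P[gA /and3P[gM gB /allrelP gMB] /andP[/allrelP gAM gAB]] /and3P[tA tM tB].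
suff [sM' [sM'r gM' tM' szM [gM'B gAM']]] : exists sM', [/\ subseq sM' ((r1 ++ y :: r2) ++ [:: x]),
    sorted gtn sM', all (leq t) sM', size sM' = size sM & allrel gtn sM' sB /\ allrel gtn sA sM'].
  exists (sA ++ sM' ++ sB); split.
  - rewrite -catA; apply: cat_subseq => //; rewrite -[x :: B]cat1s catA; exact: cat_subseq.
  - by rewrite !sorted_gtn_cat allrel_catr gA gM' gB gM'B gAM' gAB.
  - by rewrite !all_cat tA tM' tB.
  - by rewrite !size_cat szM.
case: sM {es es1 ss1} sMr gM gMB gAM tM => [|z [|z' sM]] sMr gM gMB gAM tM.
- by exists [::]; rewrite sub0seq; split=> //; split; apply/allrelP.
- exists [:: z]; split=> //; last by split; apply/allrelP.
  rewrite sub1seq; move: sMr; rewrite sub1seq !(mem_cat, inE).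
  by case: (z == x); case: (z == y); case: (z \in r1); case: (z \in r2).
have nil_ r u v s' : sorted ltn r -> sorted gtn [:: u, v & s'] -> subseq [:: u, v & s'] r -> False.
  move=> sr /= /andP[vu _] /(subseq_sorted ltn_trans) /(_ sr) /= /andP[uv _].
  by move: (ltn_trans vu uv); rewrite ltnn.
move: sMr => /=; case: eqP => [zy|_]; last by move/(nil_ _ _ _ _ srow' gM).
subst z => sub; have sM0 : sM = [::].
  by case: sM gM sub {gMB gAM tM} => // v sM /= /andP[_ gM] /(nil_ _ _ _ _ srow' gM).
subst sM; move: sub; rewrite sub1seq mem_cat inE => z'in.
have z'y : z' < y by move: gM; rewrite /= andbT.
have z'x : z' <= x.
  case/or3P: z'in => [/(allP a) //|/eqP -> //|z'r2].
  move: srow; rewrite sorted_ltn_cat /= (path_sortedE ltn_trans) => /and3P[_ /andP[/allP /(_ z' z'r2) /= yz' _] _].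
  by move: z'y; rewrite ltnNge (ltnW yz').
exists [:: y; x]; split=> //=.
- rewrite -[[:: y; x]]/([:: y] ++ [:: x]); apply: cat_subseq; rewrite ?sub1seq ?mem_head //.
  by rewrite mem_cat mem_head orbT.
- by rewrite andbT; exact: xy.
- by move: tM => /= /and3P[-> tz' _]; rewrite (leq_trans tz').
split; apply/allrelP=> u v.
  rewrite !inE => /orP[/eqP -> vB|/eqP -> vB] /=.
    by apply: (gMB y v); rewrite ?inE ?eqxx.
  by apply: leq_trans z'x; apply: (gMB z' v); rewrite ?inE ?eqxx ?orbT.
move=> uA; rewrite !inE => /orP[/eqP ->|/eqP ->] /=.
  by apply: (gAM u y); rewrite ?inE ?eqxx.
by apply: ltn_trans xy _; apply: (gAM u y); rewrite ?inE ?eqxx.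
Qed.

Lemma insertion_pullback w t s : uniq w ->
  subseq s (row_word (insertion w)) -> sorted gtn s -> all (leq t) s ->
  exists s', [/\ subseq s' w, sorted gtn s', all (leq t) s' & size s' = size s].
Proof.
suff gen T v : uniq (row_word T ++ v) -> all (sorted ltn) T -> forall s,
  subseq s (row_word (foldl row_insert T v)) -> sorted gtn s -> all (leq t) s ->
  exists s', [/\ subseq s' (row_word T ++ v), sorted gtn s', all (leq t) s' & size s' = size s].
  by move=> uw ss gs ts; apply: (gen [::] w).
elim: v T {s} => [|x v IHv] T uW sT s ss gs ts; first by rewrite cats0; exists s.
have pW : perm_eq (row_word (row_insert T x) ++ v) (row_word T ++ x :: v).
  by rewrite perm_sym -cat1s perm_catCA catA perm_cat2r perm_sym perm_row_insert.
have [||s1 [ss1 gs1 ts1 <-]] := IHv (row_insert T x) _ _ s ss gs ts.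
- by rewrite (perm_uniq pW).
- apply: row_insert_rows => //.
  by move: uW; rewrite -cat1s uniq_catCA catA cat_uniq => /andP[].
by have [s2 [ss2 gs2 ts2 <-]] := row_insert_pullback uW sT ss1 gs1 ts1; exists s2.
Qed.

(** The decrease along rows in a form that only counts, so that it survives sorting each column. *)
Fixpoint dominated_cols (cs : seq (seq nat)) : Prop :=
  if cs is c :: cs' then
    (forall t, count (leq t) (head [::] cs') <= count (leq t) c) /\ dominated_cols cs'
  else True.

Definition cols_word (cs : seq (seq nat)) : seq nat := flatten (rev cs).

Lemma cols_word_cons c cs : cols_word (c :: cs) = cols_word cs ++ c.
Proof. by rewrite /cols_word rev_cons flatten_rcons. Qed.

(** Let x be the last letter of the chain before it reaches the first column. By induction and
    domination, the part up to x is no longer than the number of entries at least x in the first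
    column; the rest of the chain uses entries of that column in [t, x). The two sets of entries are
    disjoint. *)
Lemma chain_leq_count cs s t : dominated_cols cs -> subseq s (cols_word cs) ->
  sorted gtn s -> all (leq t) s -> size s <= count (leq t) (head [::] cs).
Proof.
elim: cs s t => [|c cs IHcs] s t /=; first by case: s.
case=> dc dcs; rewrite cols_word_cons => /subseq_cat_split[s1 [s2 [-> ss1 ss2]]].
rewrite sorted_gtn_cat all_cat size_cat => /and3P[gs1 gs2 /allrelP g12] /andP[ts1 ts2].
have cle (p : pred nat) : all p s2 -> size s2 <= count p c.
  by rewrite all_count => /eqP <-; apply: leq_count_subseq.
case/lastP: s1 ss1 gs1 g12 ts1 => [|s1 x] ss1 gs1 g12 ts1; first exact: cle.
have as1 : all (leq x) (rcons s1 x).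
  move: gs1; rewrite all_rcons leqnn -cats1 sorted_gtn_cat => /and3P[_ _ /allrelP g].
  by apply/allP=> z zs; apply/ltnW/(g z x); rewrite ?mem_head.
have h1 := leq_trans (IHcs _ _ dcs ss1 gs1 as1) (dc x).
have h2 : size s2 <= count (fun z => t <= z < x) c.
  by apply: cle; apply/allP=> z zs; rewrite (allP ts2) //=; apply: (g12 x z); rewrite ?mem_rcons ?mem_head.
apply: leq_trans (leq_add h1 h2) _.
have tx : t <= x by apply: (allP ts1); rewrite mem_rcons mem_head.
rewrite -count_predUI; have -> : count (predI (leq x) (fun z => t <= z < x)) c = 0.
  by apply/eqP; rewrite -leqn0 leqNgt -has_count; apply/hasPn=> z _ /=; rewrite ltnNge; case: leqP; rewrite ?andbF.
rewrite addn0; apply: sub_count => z /orP[/(leq_trans tx) //|/andP[]//].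
Qed.

Lemma count_leq_sorted (c : seq nat) r : sorted gtn c -> r < size c ->
  count (leq (nth 0 c r)) c = r.+1.
Proof.
move=> gc rc; rewrite -{2}(cat_take_drop r c) (drop_nth 0 rc) count_cat /= leqnn.
move: gc; rewrite -{1}(cat_take_drop r c) (drop_nth 0 rc) sorted_gtn_cat.
move=> /and3P[_ /= g /allrelP g1].
have -> : count (leq (nth 0 c r)) (take r c) = r.
  rewrite -[RHS](size_takel (ltnW rc)); apply/eqP; rewrite -all_count; apply/allP=> z zt.
  by apply/ltnW/(g1 z (nth 0 c r)); rewrite ?mem_head.
have -> : count (leq (nth 0 c r)) (drop r.+1 c) = 0.
  apply/eqP; rewrite -leqn0 leqNgt -has_count; apply/hasPn=> z zd; rewrite -ltnNge.
  by move: g; rewrite (path_sortedE (rev_trans ltn_trans)) => /andP[/allP /(_ z zd)].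
by rewrite addn0 addn1.
Qed.

(** The row is at least r because each letter of the column is smaller than the one before, so the
    new cells climb. It is at most r because the chain along the bumping path pulls back to a
    decreasing subsequence of letters at least the inserted one, of which the first column has
    exactly r+1. *)
Lemma new_row_column c cs r : uniq (cols_word (c :: cs)) -> sorted gtn c ->
  dominated_cols (c :: cs) -> r < size c ->
  new_row (insertion (cols_word cs ++ take r c)) (nth 0 c r) = r.
Proof.
move=> uw gc dcs rc; apply/eqP; rewrite eqn_leq; apply/andP; split.
  have [s [ss gs ts sz]] := row_insert_chain (insertion (cols_word cs ++ take r c)) (nth 0 c r).
  have e : row_insert (insertion (cols_word cs ++ take r c)) (nth 0 c r) = insertion (cols_word cs ++ take r.+1 c).
    by rewrite (take_nth 0 rc) -rcons_cat /insertion foldl_rcons.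
  rewrite e in ss; have sub : subseq (cols_word cs ++ take r.+1 c) (cols_word (c :: cs)).
    by rewrite cols_word_cons; apply: cat_subseq => //; apply: take_subseq.
  have [s' [ss' gs' ts' sz']] := insertion_pullback (subseq_uniq sub uw) ss gs ts.
  rewrite -ltnS -sz -sz' -(count_leq_sorted gc rc).
  exact: (chain_leq_count dcs (subseq_trans ss' sub)).
elim: r rc => // r IHr rc; rewrite (take_nth 0 (ltnW rc)) -rcons_cat /insertion foldl_rcons.
apply: leq_ltn_trans (IHr (ltnW rc)) _; apply: new_row_lt.
by apply: (sorted_ltn_nth (rev_trans ltn_trans) 0 gc); rewrite ?inE // ltnW.
Qed.

(** Reverse row insertion: the row of the new cell tells whether the bottom row was extended or
    bumped, and in the second case the rows above return the bumped letter by induction. *)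
Lemma row_insert_inj T1 T2 x1 x2 :
  all (sorted ltn) T1 -> all (sorted ltn) T2 -> [::] \notin T1 -> [::] \notin T2 ->
  uniq (x1 :: row_word T1) -> uniq (x2 :: row_word T2) ->
  row_insert T1 x1 = row_insert T2 x2 -> new_row T1 x1 = new_row T2 x2 -> T1 = T2 /\ x1 = x2.
Proof.
elim: T1 T2 x1 x2 => [|row1 T1 IHT] [|row2 T2] x1 x2.
- by move=> _ _ _ _ _ _ /= [->].
- rewrite /= inE negb_or => _ _ _ /andP[n0 _] _ _; case: ifP => // kr [] e.
  by case: (row2) n0 e {kr} => [|a [|b s]].
- rewrite /= inE negb_or => _ _ /andP[n0 _] _ _ _; case: ifP => // kr [] e.
  by case: (row1) n0 e {kr} => [|a [|b s]].
rewrite !inE !negb_or => /= /andP[s1 sT1] /andP[s2 sT2] /andP[_ n1] /andP[_ n2].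
rewrite !row_word_cons => u1 u2 /[dup] eI.
case: (row_split row1 x1) => [a1|[r1 [y1 [q1 [e1 a1 xy1]]]]].
  case: (row_split row2 x2) => [a2|[r2 [y2 [q2 [e2 a2 xy2]]]]].
    by have /= -> := row_insert_append T1 a1; have /= -> := row_insert_append T2 a2 => -[/rcons_inj[-> ->] ->].
  move=> _; rewrite ifN; last by rewrite -has_find; apply/hasPn=> z /(allP a1); rewrite -leqNgt.
  by rewrite ifT // -has_find e2 has_cat /= xy2 orbT.
case: (row_split row2 x2) => [a2|[r2 [y2 [q2 [e2 a2 xy2]]]]].
  move=> _; rewrite ifT; last by rewrite -has_find e1 has_cat /= xy1 orbT.
  by rewrite ifN // -has_find; apply/hasPn=> z /(allP a2); rewrite -leqNgt.
subst row1 row2; have /= -> := row_insert_bump q1 T1 a1 xy1; have /= -> := row_insert_bump q2 T2 a2 xy2.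
have fnd (r q : seq nat) x y : all (leq^~ x) r -> x < y -> find (ltn x) (r ++ y :: q) = size r.
  move=> a xy; rewrite find_cat ifN /= ?xy ?addn0 //; apply/hasPn=> z /(allP a).
  by rewrite -leqNgt.
rewrite !fnd // !size_cat /= !addnS !ltnS !leq_addr !nth_cat !ltnn !subnn /= => -[eR eT] [eN].
have [xr1 u1'] := uniq_bump u1; have [xr2 u2'] := uniq_bump u2.
have [eT12 ey] := IHT T2 y1 y2 sT1 sT2 n1 n2 u1' u2' eT eN; subst T2 y2.
(* Once the bumped letter is known, the inserted one is recovered as the last entry of the new row
   below it. *)
have low (r q : seq nat) x : sorted ltn (r ++ y1 :: q) -> all (ltn^~ x) r -> x < y1 ->
   [seq z <- r ++ x :: q | z < y1] = rcons r x /\ [seq z <- r ++ x :: q | ~~ (z < y1)] = q.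
  move=> srt /allP rx xy; have qy z : z \in q -> ~~ (z < y1).
    move: srt; rewrite sorted_ltn_cat /= (path_sortedE ltn_trans) => /and3P[_ /andP[/allP yq _] _] /yq.
    by rewrite -leqNgt; apply: ltnW.
  have ry z : z \in r -> z < y1 by move/rx => /= zx; apply: ltn_trans xy.
  rewrite !filter_cat /= xy -cats1; split.
    rewrite (eq_in_filter (a2 := predT)) ?filter_predT; last by move=> z /ry ->.
    by rewrite (eq_in_filter (s := q) (a2 := pred0)) ?filter_pred0 // => z /qy/negPf ->.
  rewrite (eq_in_filter (s := r) (a2 := pred0)) ?filter_pred0; last by move=> z /ry ->.
  by rewrite (eq_in_filter (a2 := predT)) ?filter_predT // => z /qy ->.
have [l1 h1] := low _ _ _ s1 (all_leq_ltn xr1 a1) xy1.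
have [l2 h2] := low _ _ _ s2 (all_leq_ltn xr2 a2) xy2.
move: l1 h1; rewrite eR l2 h2 => /rcons_inj[-> ->] ->; split=> //.
Qed.

(** The last letter inserted ends in the row given by its place in its column, which is the same for
    both words as the column lengths agree. Reverse insertion therefore peels off equal letters. *)
Lemma insertion_cols_inj cs1 cs2 :
  shape cs1 = shape cs2 -> all (sorted gtn) cs1 -> all (sorted gtn) cs2 ->
  dominated_cols cs1 -> dominated_cols cs2 ->
  uniq (cols_word cs1) -> uniq (cols_word cs2) ->
  insertion (cols_word cs1) = insertion (cols_word cs2) -> cs1 = cs2.
Proof.
elim: cs1 cs2 => [|c1 cs1 IHcs] [|c2 cs2] // [esz esh] /andP[g1 gs1] /andP[g2 gs2] d1 d2 u1 u2 eI.
suff [eT ec] : insertion (cols_word cs1) = insertion (cols_word cs2) /\ c1 = c2.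
  rewrite ec (IHcs cs2) //; [exact: d1.2|exact: d2.2|move: u1|move: u2];
    by rewrite cols_word_cons cat_uniq => /andP[].
have pre r : r <= size c1 ->
    insertion (cols_word cs1 ++ take r c1) = insertion (cols_word cs2 ++ take r c2) ->
    insertion (cols_word cs1) = insertion (cols_word cs2) /\ take r c1 = take r c2.
  elim: r => [|r IHr]; first by rewrite !take0 !cats0.
  move=> rc1; have rc2 : r < size c2 by rewrite -esz.
  have n1 := new_row_column u1 g1 d1 rc1; have n2 := new_row_column u2 g2 d2 rc2.
  have uq cs c : uniq (cols_word (c :: cs)) -> r < size c ->
     uniq (cols_word cs ++ take r c) /\ uniq (nth 0 c r :: row_word (insertion (cols_word cs ++ take r c))).
    move=> u rc; have sub : subseq (cols_word cs ++ take r.+1 c) (cols_word (c :: cs)).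
      by rewrite cols_word_cons; apply: cat_subseq => //; apply: take_subseq.
    have := subseq_uniq sub u; rewrite (take_nth 0 rc) -rcons_cat => u'.
    split; first by move: u'; rewrite rcons_uniq => /andP[].
    rewrite -(perm_uniq (s1 := rcons (cols_word cs ++ take r c) (nth 0 c r))) //.
    by rewrite perm_rcons perm_cons perm_sym perm_insertion.
  have [v1 w1] := uq cs1 c1 u1 rc1; have [v2 w2] := uq cs2 c2 u2 rc2.
  rewrite (take_nth 0 rc1) (take_nth 0 rc2) -!rcons_cat /insertion !foldl_rcons -/(insertion _) -/(insertion _) => e.
  have en : new_row (insertion (cols_word cs1 ++ take r c1)) (nth 0 c1 r) =
            new_row (insertion (cols_word cs2 ++ take r c2)) (nth 0 c2 r) by rewrite n1 n2.
  have [eT ex] := row_insert_inj (insertion_rows v1) (insertion_rows v2)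
    (insertion_nil_free _) (insertion_nil_free _) w1 w2 e en.
  by have [e1 ->] := IHr (ltnW rc1) eT; rewrite ex; split; first exact: e1.
have t2 : take (size c1) c2 = c2 by rewrite esz take_size.
by move: (pre (size c1) (leqnn _)); rewrite t2 take_size -!cols_word_cons => /(_ eI).
Qed.

(** * Moves on lists of runs *)

Section SlideMoves.

Variables (T : eqType) (lt : rel T).
Hypothesis lt_trans : transitive lt.

(* The third inequality prevents the successor of the entry of [z] from being a
   descent, so that the move is not blocked in the restricted equivalence. *)
Definition slide (v v' : seq T) : Prop := exists A x y z u B,
  [/\ v = A ++ [:: x; y; z; u] ++ B, v' = A ++ [:: x; z; y; u] ++ B,
      lt z x, lt x y & lt z u].

Definition slides : seq T -> seq T -> Prop := clos_refl_sym_trans (seq T) slide.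

Lemma slides_ctx A B v v' : slides v v' -> slides (A ++ v ++ B) (A ++ v' ++ B).
Proof.
elim=> {v v'} [v v' [C [x [y [z [u [D [-> -> zx xy zu]]]]]]]|v|v v' _ IH|v v' v'' _ IH1 _ IH2].
- apply: rst_step; exists (A ++ C), x, y, z, u, (D ++ B); split=> //; by rewrite -!catA.
- exact: rst_refl.
- exact: rst_sym.
- exact: rst_trans IH1 IH2.
Qed.

(** The letter t passes those of P one at a time: the letter y being passed has its predecessor as
    x, and the letter passed just before as u. The letter p plays x in the last move, so t stops
    right behind it. *)
Lemma slides_left p P t u B : lt t p -> sorted lt (p :: P) -> lt t u ->
  slides (p :: P ++ t :: u :: B) (p :: t :: P ++ u :: B).
Proof.
elim/last_ind: P u B => [|P y IHP] u B tp; first by move=> *; apply: rst_refl.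
rewrite -rcons_cons -cats1 => sP tu.
have tall z : z \in (p :: P) ++ [:: y] -> lt t z.
  move: sP; rewrite /= (path_sortedE lt_trans) => /andP[/allP aP _].
  by rewrite inE => /orP[/eqP -> //|/aP]; apply: lt_trans.
have [sP' xy] : sorted lt (p :: P) /\ lt (last p P) y.
  by move: sP; rewrite /= cat_path /= andbT => /andP[].
have ty : lt t y by apply: tall; rewrite mem_cat mem_head orbT.
have e1 : p :: rcons P y ++ t :: u :: B = belast p P ++ [:: last p P; y; t; u] ++ B.
  by rewrite cat_rcons -cat_cons lastI cat_rcons.
have e2 : p :: P ++ t :: y :: u :: B = belast p P ++ [:: last p P; t; y; u] ++ B.
  by rewrite -cat_cons lastI cat_rcons.
have e3 : p :: t :: rcons P y ++ u :: B = p :: t :: P ++ y :: u :: B by rewrite cat_rcons.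
rewrite e1 e3; apply: rst_trans (IHP y (u :: B) tp sP' ty); rewrite e2.
apply: rst_step; exists (belast p P), (last p P), y, t, u, B; split=> //.
by apply: tall; rewrite mem_cat mem_last.
Qed.

Fixpoint interleave (s1 s2 : seq T) : seq T :=
  if s1 is t :: s1' then (if s2 is p :: s2' then p :: t :: interleave s1' s2' else s1) else s2.

(** The bound on the length of t gives each of its letters a letter of P to stop behind; R being
    nonempty gives the last one a successor u. The normal form depends on P and R only through their
    concatenation, whence [slides_exchange]. *)
Lemma slides_interleave t P R : size t <= size P -> R != [::] -> sorted lt (t ++ P ++ R) ->
  slides (P ++ t ++ R) (interleave t (P ++ R)).
Proof.
elim: t P => [|a t IHt] [|p P] //; try by move=> *; apply: rst_refl.
rewrite /= ltnS => tP R0; rewrite (path_sortedE lt_trans) => /andP[/allP aall srt].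
have ap : lt a p by apply: aall; rewrite mem_cat inE eqxx orbT.
have sP : sorted lt (p :: P).
  move: srt; rewrite (sorted_pairwise lt_trans) pairwise_cat -cat_cons pairwise_cat.
  by move=> /and3P[_ _ /and3P[_]]; rewrite -(sorted_pairwise lt_trans).
have st : sorted lt (t ++ P ++ R).
  move: srt; rewrite !(sorted_pairwise lt_trans) !pairwise_cat allrel_consr.
  by rewrite /= pairwise_cat => /and3P[/andP[_ ->] -> /andP[_ ->]].
have [u [S eS]] : exists u S, t ++ R = u :: S.
  have : t ++ R != [::] by rewrite -size_eq0 size_cat addn_eq0 negb_and !size_eq0 R0 orbT.
  by case: (t ++ R) => // u S _; exists u, S.
have au : lt a u.
  have : u \in t ++ R by rewrite eS mem_head.
  by rewrite mem_cat => ut; apply: aall; rewrite !(mem_cat, inE); case/orP: ut => ->; rewrite ?orbT.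
rewrite eS; apply: rst_trans (slides_left S ap sP au) _; rewrite -eS.
by have := slides_ctx [:: p; a] [::] (IHt P tP R0 st); rewrite !cats0.
Qed.

Lemma slides_exchange t P R P' R' : P ++ R = P' ++ R' -> size t <= size P -> size t <= size P' ->
  R != [::] -> R' != [::] -> sorted lt (t ++ P ++ R) -> slides (P ++ t ++ R) (P' ++ t ++ R').
Proof.
move=> e tP tP' R0 R0' st; apply: rst_trans (slides_interleave tP R0 st) _; rewrite e.
by apply: rst_sym; apply: slides_interleave => //; rewrite -e.
Qed.

(* The successive runs i, ..., j of a tableau: [take q L] is run i, the [rho] of
   the pairs [(rho, M)] of [s], from last to first, are the runs strictly between
   i and j, and run j consists of [t], the [M] and the end of [L]. *)
Definition split_runs (t : seq T) (s : seq (seq T * seq T)) (L : seq T) (q : nat) (B : seq T) :=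
  take q L ++ flatten (rev (map fst s)) ++ t ++ flatten (map snd s) ++ drop q L ++ B.

Fixpoint strip_sizes (t : seq T) (s : seq (seq T * seq T)) (q : nat) : bool :=
  if s is p :: s' then (size t <= size p.1) && strip_sizes (p.1 ++ p.2) s' q else size t <= q.

(** The intermediate runs are removed one by one by a move that can be made for every cut q alike.
    [strip_sizes] records the length condition of each exchange in turn, where rho ++ M takes over
    the role of t. *)
Lemma slides_split_runs t s L B q q' :
  sorted lt (t ++ flatten [seq p.1 ++ p.2 | p <- s] ++ L) ->
  strip_sizes t s q -> strip_sizes t s q' -> q + (size s).+1 <= size L -> q' + (size s).+1 <= size L ->
  slides (split_runs t s L q B) (split_runs t s L q' B).
Proof.
elim: s t L B q q' => [|[rho M] s IHs] t L B q q' /= srt.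
  rewrite !addn1 /split_runs /= => tq tq' qL qL'.
  have d0 k : k < size L -> drop k L != [::] by move=> kL; rewrite -size_eq0 size_drop; lia.
  have := @slides_exchange t (take q L) (drop q L) (take q' L) (drop q' L).
  rewrite !cat_take_drop !size_takel ?(ltnW qL) ?(ltnW qL') // => /(_ _ tq tq' (d0 _ qL) (d0 _ qL') srt) h.
  by have := slides_ctx [::] B (h erefl); rewrite /= -!catA.
move=> /andP[tr tsq] /andP[_ tsq'] qL qL'.
case/lastP: L srt qL qL' => [|L z] srt; first by rewrite addnS.
rewrite size_rcons !addnS !ltnS => qL qL'.
(* Here t jumps from behind rho to just before the last letter z of the pool, so rho and M become
   adjacent. Each such jump uses up one letter of L, and the base case needs one more: this is the
   summand [(size s).+1] in the bounds on q. *)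
have step k : k <= size L -> slides (split_runs t ((rho, M) :: s) (rcons L z) k B)
                (split_runs (rho ++ M) s L k (t ++ z :: B)).
  move=> kL; set R1 := M ++ flatten (map snd s) ++ drop k L.
  have h : slides (rho ++ t ++ rcons R1 z) ((rho ++ R1) ++ t ++ [:: z]).
    apply: slides_exchange => //.
    - by rewrite -cats1 catA.
    - by rewrite size_cat (leq_trans tr) ?leq_addr.
    - by case: (R1).
    apply: (subseq_sorted lt_trans) srt; rewrite cat_subseq // -!catA cat_subseq //.
    rewrite /R1 -cats1 -!catA cat_subseq // -cats1; apply: cat_subseq.
      elim: (s) => //= p s' IH; rewrite -catA; apply: subseq_trans (suffix_subseq p.1 _); exact: cat_subseq.
    by apply: cat_subseq => //; apply: drop_subseq.
  have := slides_ctx (take k L ++ flatten (rev (map fst s))) B h.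
  by rewrite /split_runs /R1 /= rev_cons flatten_rcons drop_rcons // -!cats1 takel_cat // -!catA.
apply: rst_trans (step q _) _; first by lia.
apply: rst_trans (IHs (rho ++ M) L _ q q' _ tsq tsq' _ _) (rst_sym _ _ _ _ (step q' _)) => //; try lia.
apply: (subseq_sorted lt_trans) srt; rewrite -cats1 -!catA.
apply: subseq_trans (suffix_subseq t _); rewrite !cat_subseq // prefix_subseq //.
Qed.

End SlideMoves.

(** * Tableaux as lists of cells *)

Definition reads_before (a b : cell) : bool := (b.1 < a.1) || (a.1 == b.1) && (a.2 < b.2).

Lemma reads_before_trans : transitive reads_before.
Proof. by move=> [b1 b2] [a1 a2] [c1 c2]; rewrite /reads_before /=; lia. Qed.

Lemma reads_before_irr : irreflexive reads_before.
Proof. by move=> [a1 a2]; rewrite /reads_before /=; lia. Qed.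

Lemma mem_rcells sh x : (x \in rcells sh) = (x.2 < row_len sh x.1).
Proof.
case: x => r c; apply/allpairsPdep/idP => [[r' [c' [_ +]]] [-> ->]|/= cr].
  by rewrite mem_iota.
exists r, c; rewrite mem_rev !mem_iota /=; split=> //.
by move: cr; rewrite /row_len; case: (ltnP r (size sh)) => // /(nth_default 0) ->.
Qed.

(** With [gtn] on rows this is the reading order, with [ltn] the bottom-up order in which [flatten]
    lists the entries. *)
Definition cell_rel (R : rel nat) (a b : cell) : bool := R a.1 b.1 || (a.1 == b.1) && (a.2 < b.2).

Lemma cell_rel_trans R : transitive R -> transitive (cell_rel R).
Proof.
move=> trR [b1 b2] [a1 a2] [c1 c2]; rewrite /cell_rel /= => /orP[ab|/andP[/eqP -> ab]].
  by case/orP=> [bc|/andP[/eqP <- _]]; rewrite ?ab // (trR _ _ _ ab bc).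
case/orP=> [-> //|/andP[/eqP <- bc]]; by rewrite eqxx (ltn_trans ab bc) orbT.
Qed.

Lemma sorted_cells R (f : nat -> nat) rs : transitive R -> sorted R rs ->
  sorted (cell_rel R) [seq (r, c) | r <- rs, c <- iota 0 (f r)].
Proof.
move=> trR; elim: rs => //= r s IHs sr; have trc := cell_rel_trans trR.
rewrite (sorted_pairwise trc) pairwise_cat -!(sorted_pairwise trc).
rewrite IHs ?(path_sorted sr) // andbT; apply/andP; split.
  apply/allrelP=> [x y] /mapP[c _ ->] /allpairsPdep[r' [c' [r's _ ->]]].
  move: sr; rewrite (path_sortedE trR) => /andP[/allP /(_ r' r's) lt _].
  by rewrite /cell_rel /= lt.
rewrite sorted_map; apply: sub_sorted (iota_ltn_sorted 0 _) => c c' /= cc'.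
by rewrite /cell_rel /= eqxx cc' orbT.
Qed.

Lemma sorted_rcells sh : sorted reads_before (rcells sh).
Proof.
apply: (@sorted_cells gtn); first exact: (rev_trans ltn_trans).
by rewrite rev_sorted; apply: iota_ltn_sorted.
Qed.

Lemma uniq_rcells sh : uniq (rcells sh).
Proof. by apply: (sorted_uniq reads_before_trans reads_before_irr); apply: sorted_rcells. Qed.

Lemma row_word_cells T : row_word T = [seq entry T x.1 x.2 | x <- rcells (shape T)].
Proof.
have eT : rev T = [seq nth [::] T r | r <- rev (iota 0 (size T))].
  by rewrite map_rev map_nth_iota0 // take_size.
rewrite /row_word /rcells map_flatten -map_comp eT size_map; congr flatten.
apply/eq_in_map => r; rewrite mem_rev mem_iota /= => rT.
by rewrite -map_comp /row_len (nth_map [::]) // map_nth_iota0 // take_size.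
Qed.

(** Inverse to listing the cells by increasing entries. [of_runs] is this construction applied to
    the concatenated runs. *)
Definition ranking (sh : seq nat) (v : seq cell) : tableau :=
  [seq [seq (index (r, c) v).+1 | c <- iota 0 (row_len sh r)] | r <- iota 0 (size sh)].

Lemma shape_ranking sh v : shape (ranking sh v) = sh.
Proof.
apply: (@eq_from_nth _ 0); rewrite /shape /ranking !size_map size_iota // => r rs.
by rewrite (nth_map [::]) ?size_map ?size_iota // (nth_map 0) ?size_iota // size_map size_iota nth_iota.
Qed.

Lemma entry_ranking sh v r c : c < row_len sh r ->
  entry (ranking sh v) r c = (index (r, c) v).+1.
Proof.
move=> cr; have rs : r < size sh.
  by move: cr; rewrite /row_len; case: (ltnP r (size sh)) => // /(nth_default 0) ->.
rewrite /entry /ranking (nth_map 0) ?size_iota // (nth_map 0) ?size_iota ?nth_iota //.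
Qed.

Lemma row_word_ranking sh v : row_word (ranking sh v) = [seq (index x v).+1 | x <- rcells sh].
Proof.
rewrite row_word_cells shape_ranking; apply/eq_in_map => -[r c]; rewrite mem_rcells => cr.
exact: entry_ranking.
Qed.

Lemma map_index_uniq (T : eqType) (s : seq T) : uniq s -> [seq (index x s).+1 | x <- s] = iota 1 (size s).
Proof.
move=> us; apply: (@eq_from_nth _ 0); rewrite size_map ?size_iota // => i si.
by case: s us si => // x0 s us si; rewrite (nth_map x0) // index_uniq // nth_iota.
Qed.

Lemma perm_ranking sh v : perm_eq v (rcells sh) ->
  perm_eq (row_word (ranking sh v)) (iota 1 (size v)).
Proof.
move=> pv; rewrite row_word_ranking -map_index_uniq; last by rewrite (perm_uniq pv) uniq_rcells.
by rewrite perm_map // perm_sym.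
Qed.

Lemma index_ranking sh v : perm_eq v (rcells sh) ->
  {in v &, forall a b, (index (index a v).+1 (row_word (ranking sh v)) <
                        index (index b v).+1 (row_word (ranking sh v))) = reads_before a b}.
Proof.
move=> pv a b av bv; have uv : uniq v by rewrite (perm_uniq pv) uniq_rcells.
rewrite row_word_ranking; set W := map _ _; set R := relpre (fun k => nth a v k.-1) reads_before.
have sW : sorted R W.
  rewrite sorted_map; apply: (sub_in_sorted (P := mem v)) (sorted_rcells sh).
    by move=> x y xv yv; rewrite /R /= !nth_index.
  by apply/allP=> x; rewrite -(perm_mem pv).
rewrite (@sorted_index_lt _ R) //; last 2 first.
- by apply/mapP; exists a; rewrite -?(perm_mem pv).
- by apply/mapP; exists b; rewrite -?(perm_mem pv).
- by rewrite /R /= !nth_index.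
- by move=> x y z; apply: reads_before_trans.
- by move=> x; apply: reads_before_irr.
Qed.

Lemma index_slide A (x y z u : cell) B c : uniq (A ++ [:: x; y; z; u] ++ B) ->
  (index c (A ++ [:: x; z; y; u] ++ B)).+1 =
  exchange (size A).+2 (index c (A ++ [:: x; y; z; u] ++ B)).+1.
Proof.
rewrite cat_uniq => /and3P[_ _]; rewrite /= !inE !negb_or.
move=> /and3P[/and4P[xy xz _ _] /and3P[yz _ _] _].
rewrite !index_cat exchangeE !eqSS; case: ifP => [|_].
  by rewrite -index_mem; move: (index c A) (size A) => k n kn; rewrite !ltn_eqF // ?ltnS ltnW // leqW.
rewrite /=; case: (x =P c) => [_|_].
  by move: (size A) => n; rewrite addn0 !ltn_eqF // leqW.
case: (z =P c) => [zc|_].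
  by rewrite -zc (negPf yz); move: (size A) => n; rewrite addn2 addn1 gtn_eqF // eqxx.
case: (y =P c) => _; first by move: (size A) => n; rewrite addn1 addn2 eqxx.
move: (size A) (if u == c then _ else _) => n k; rewrite !addnS !eqSS.
by rewrite !gtn_eqF //; lia.
Qed.

(** With i the entry of y, the cells x, y, z, u carry i-1, i, i+1, i+2. The reading order z, x, y
    places i-1 between i+1 and i, so d_i exchanges i and i+1. Since z is read before u, i+1 is not a
    descent and d_i^R agrees with d_i. *)
Lemma ranking_slide sh A x y z u B :
  let v := A ++ [:: x; y; z; u] ++ B in perm_eq v (rcells sh) ->
  reads_before z x -> reads_before x y -> reads_before z u ->
  dual_R (size A).+2 (ranking sh v) = ranking sh (A ++ [:: x; z; y; u] ++ B).
Proof.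
move=> v pv zx xy zu; have uv : uniq v by rewrite (perm_uniq pv) uniq_rcells.
have idx k : k < 4 -> index (nth x [:: x; y; z; u] k) v = size A + k.
  move=> k4; have e : nth x [:: x; y; z; u] k = nth x v (size A + k).
    by rewrite /v nth_cat ifN -?leqNgt ?leq_addr // addKn nth_cat k4.
  by rewrite e index_uniq // size_cat ltn_add2l size_cat (leq_trans k4) // leq_addr.
have mem k : k < 4 -> nth x [:: x; y; z; u] k \in v.
  by move=> k4; rewrite !mem_cat (mem_nth x (s := [:: x; y; z; u]) k4) orbT.
have cmp k l : k < 4 -> l < 4 ->
    (index (size A + k).+1 (row_word (ranking sh v)) < index (size A + l).+1 (row_word (ranking sh v)))
    = reads_before (nth x [:: x; y; z; u] k) (nth x [:: x; y; z; u] l).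
  by move=> k4 l4; rewrite -!idx // index_ranking ?mem.
have df : dual_subst (size A).+2 (row_word (ranking sh v)) =1 exchange (size A).+2.
  move=> t; rewrite /dual_subst /between /=.
  have := cmp 2 0 isT isT; have := cmp 0 1 isT isT; rewrite addn0 addn1 addn2 /= zx xy => -> ->.
  by rewrite orbT.
rewrite /dual_R; have -> : ((size A).+3 \in ID (ranking sh v)) = false.
  apply/negbTE; rewrite mem_filter negb_and; apply/orP; left.
  have := cmp 3 2 isT isT; rewrite addn3 addn2 /= => ->.
  by apply/negP=> uz; have := reads_before_trans zu uz; rewrite reads_before_irr.
rewrite /= /dual_tab /ranking -map_comp; apply/eq_in_map => r _ /=; rewrite -map_comp.
by apply/eq_in_map => c _ /=; rewrite df -index_slide.
Qed.

(** Steps are allowed on every standard filling, so that the intermediate lists of cells need not be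
    tracked as Young tableaux. *)
Definition dual_R_step (n : nat) (T T' : tableau) : Prop :=
  perm_eq (row_word T) (iota 1 n) /\ exists2 i, 2 <= i <= n - 2 & T' = dual_R i T.

Definition dual_R_equiv (n : nat) : tableau -> tableau -> Prop :=
  clos_refl_sym_trans tableau (dual_R_step n).

Lemma slides_perm v v' : slides reads_before v v' -> perm_eq v v'.
Proof.
elim=> {v v'} [v v' [A [x [y [z [u [B [-> -> _ _ _]]]]]]]|v|v v' _|v v' v'' _ IH1 _ IH2] //.
- by rewrite perm_cat2l perm_cons; apply/permP=> p /=; rewrite addnCA.
- by rewrite perm_sym.
- exact: perm_trans IH1 IH2.
Qed.

Lemma slides_dual_R sh v v' : slides reads_before v v' -> perm_eq v (rcells sh) ->
  dual_R_equiv (size (rcells sh)) (ranking sh v) (ranking sh v').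
Proof.
elim=> {v v'} [v v' [A [x [y [z [u [B [-> -> zx xy zu]]]]]]] pv|v _|v v' s IH pv'|v v' v'' s1 IH1 s2 IH2 pv].
- apply: rst_step; split; first by rewrite -(perm_size pv) perm_ranking.
  exists (size A).+2; last by rewrite ranking_slide.
  by rewrite -(perm_size pv) !size_cat /= addnC !addSn !subSS subn0 !ltnS leq_addl.
- exact: rst_refl.
- by apply: rst_sym; apply: IH; rewrite (perm_trans (slides_perm s)).
- apply: rst_trans (IH1 pv) (IH2 _); rewrite (perm_trans _ pv) // perm_sym.
  exact: slides_perm.
Qed.

Lemma index_map_in (S1 S2 : eqType) (f : S1 -> S2) (s : seq S1) x :
  {in s &, injective f} -> x \in s -> index (f x) (map f s) = index x s.
Proof.
elim: s => //= a s IH inj; rewrite inE => /orP[/eqP ->|xs]; first by rewrite !eqxx.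
case: (a =P x) => [->|/eqP ax]; first by rewrite eqxx.
rewrite ifN; last by apply: contra ax => /eqP/inj -> //; rewrite inE ?eqxx ?xs ?orbT.
by rewrite IH // => u v us vs; apply: inj; rewrite inE ?us ?vs orbT.
Qed.

Lemma eq_tableau (T1 T2 : tableau) : shape T1 = shape T2 ->
  (forall r c, c < row_len (shape T1) r -> entry T1 r c = entry T2 r c) -> T1 = T2.
Proof.
move=> sh12 e12; have sz : size T1 = size T2 by rewrite -(size_map size T1) -(size_map size T2) -/(shape T1) sh12.
have len (T : tableau) r : r < size T -> row_len (shape T) r = size (nth [::] T r).
  by move=> rT; rewrite /row_len (nth_map [::]).
apply: (@eq_from_nth _ [::]) => // r rT; apply: (@eq_from_nth _ 0) => [|c cr].
  by rewrite -!len -?sz // sh12.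
by apply: e12; rewrite len.
Qed.

Definition cell_entry (T : tableau) (x : cell) : nat := entry T x.1 x.2.

Section FillingCells.

Variables (n : nat) (T : tableau).
Hypothesis Tperm : perm_eq (row_word T) (iota 1 n).
Local Notation sh := (shape T).
Local Notation e := (cell_entry T).

Lemma entry_bounds x : x \in rcells sh -> 0 < e x <= n.
Proof.
move=> xs; have : e x \in row_word T by rewrite row_word_cells; apply: (map_f e).
by rewrite (perm_mem Tperm) mem_iota add1n ltnS.
Qed.

Lemma entry_inj : {in rcells sh &, injective e}.
Proof.
have uW : uniq (row_word T) by rewrite (perm_uniq Tperm) iota_uniq.
move: uW; rewrite row_word_cells; elim: (rcells sh) => //= a s IH /andP[na us] x y.
rewrite !inE => /orP[/eqP ->|xs] /orP[/eqP ->|ys] exy //; last exact: IH.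
  by case/mapP: na; exists y.
by case/mapP: na; exists x.
Qed.

Lemma cell_of k : 0 < k <= n -> exists2 x, x \in rcells sh & e x = k.
Proof.
move=> kn; have : k \in row_word T by rewrite (perm_mem Tperm) mem_iota add1n ltnS.
by rewrite row_word_cells => /mapP[x xs ->]; exists x.
Qed.

Lemma index_entry x y : x \in rcells sh -> y \in rcells sh ->
  (index (e x) (row_word T) < index (e y) (row_word T)) = reads_before x y.
Proof.
move=> xs ys; rewrite row_word_cells.
rewrite -[map _ _]/(map e (rcells sh)) !(index_map_in entry_inj) // (sorted_index_lt reads_before_trans reads_before_irr) //; exact: sorted_rcells.
Qed.

End FillingCells.

(** * Runs of a standard Young tableau *)

Section Runs.

Variables (n : nat) (T : tableau).
Hypothesis TSYT : SYTn n T.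
Local Notation sh := (shape T).
Local Notation e := (cell_entry T).
Local Notation b := (run_end T).

Lemma syt_sum : sumn sh = n.
Proof. by case/and3P: TSYT => _ /eqP. Qed.

Lemma syt_perm : perm_eq (row_word T) (iota 1 n).
Proof.
case/and3P: TSYT => _ /eqP s; rewrite mem_filter mem_fillings eqxx s /= => /andP[_].
exact: perm_trans (perm_row_word T).
Qed.

Lemma syt_rows r c c' : c < c' -> c' < row_len sh r -> entry T r c < entry T r c'.
Proof.
case/and3P: TSYT => _ _; rewrite mem_filter => /andP[/andP[/allP sr _] _] cc'.
rewrite /row_len; case: (ltnP r (size sh)) => [|h]; last by rewrite nth_default.
rewrite size_map => rT; rewrite (nth_map [::]) // => c's.
exact: (sorted_ltn_nth ltn_trans 0 (sr _ (mem_nth [::] rT)) c c' (ltn_trans cc' c's) c's cc').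
Qed.

Lemma row_lenE r : row_len sh r = size (nth [::] T r).
Proof.
rewrite /row_len /shape; case: (ltnP r (size T)) => rT; first by rewrite (nth_map [::]).
by rewrite !nth_default ?size_map.
Qed.

Lemma syt_cols r r' c : r < r' -> c < row_len sh r' -> c < row_len sh r /\ entry T r c < entry T r' c.
Proof.
move=> rr' cr'; case/and3P: TSYT => /andP[_ sg] _.
rewrite mem_filter => /andP[/andP[_ /allP sc] _].
have cr : c < row_len sh r.
  have r's : r' < size sh.
    by move: cr'; rewrite /row_len; case: (ltnP r' (size sh)) => // /(nth_default 0) ->.
  apply: leq_trans cr' _; apply: (sorted_ltn_nth (rev_trans leq_trans) 0 sg r r') => //.
  by rewrite inE (ltn_trans rr').
split=> //; have /sc : c \in iota 0 (ncols T).
  rewrite mem_iota /= /ncols; apply: leq_trans cr _; rewrite /row_len.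
  by elim: (sh) r {rr'} => [|a s IH] [|r] //=; rewrite leq_max ?leqnn ?IH ?orbT.
by move/(sorted_col_upP _ _ ltn_trans); apply=> //; rewrite -row_lenE.
Qed.

(** The successor of an entry is read earlier exactly when it is in a higher row: in the same row it
    would have to stand to the left, against the increase of rows. *)
Lemma ID_cell x y : x \in rcells sh -> y \in rcells sh -> e y = (e x).+1 ->
  (e x \in ID T) = (x.1 < y.1).
Proof.
move=> xs ys exy; rewrite mem_filter mem_iota -exy (index_entry syt_perm) //.
have /andP[ex0 _] := entry_bounds syt_perm xs; have /andP[_ eyn] := entry_bounds syt_perm ys.
rewrite (perm_size syt_perm) size_iota ex0 add1n prednK ?(leq_trans _ eyn) //; last by rewrite exy.
rewrite /= andbT /reads_before.
case: (y.1 =P x.1) => [yx|]; last by rewrite orbF.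
rewrite yx ltnn /=; apply/negP=> yx2.
have : e y < e x by rewrite /cell_entry yx; apply: syt_rows => //; rewrite -mem_rcells -?surjective_pairing.
by rewrite exy ltnNge leqnSn.
Qed.

Lemma reads_before_row x y : x \in rcells sh -> y \in rcells sh ->
  y.1 <= x.1 -> e x < e y -> reads_before x y.
Proof.
move=> xs ys; rewrite leq_eqVlt /reads_before => /orP[/eqP yx lt|-> //].
rewrite yx ltnn eqxx /= ltnNge leq_eqVlt; apply/negP=> /orP[/eqP yx2|yx2].
  by move: lt; rewrite /cell_entry yx yx2 ltnn.
have : e y < e x by rewrite /cell_entry yx; apply: syt_rows => //; rewrite -mem_rcells -?surjective_pairing.
by rewrite ltnNge ltnW.
Qed.

Lemma sorted_run_ends : sorted ltn (0 :: run_ends T).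
Proof.
rewrite /= (path_sortedE ltn_trans) (sorted_filter ltn_trans) ?iota_ltn_sorted // andbT.
by apply/allP=> k; rewrite mem_filter mem_iota => /and3P[].
Qed.

Lemma run_end_lt r r' : r < r' -> r' <= nruns T -> b r < b r'.
Proof.
move=> rr' r'N; apply: (sorted_ltn_nth ltn_trans 0 sorted_run_ends) => //.
by rewrite inE ltnS (leq_trans (ltnW rr')).
Qed.

Lemma run_end_last : b (nruns T) = n.
Proof.
rewrite /run_end /nruns nth_last /= /run_ends syt_sum.
case: n => // m; rewrite -(addn1 m) iotaD filter_cat /= add1n addn1 eqxx orbT.
by rewrite last_cat.
Qed.

Lemma run_end_le r : r <= nruns T -> b r <= n.
Proof. by rewrite -run_end_last leq_eqVlt => /orP[/eqP -> //|/run_end_lt/(_ (leqnn _))/ltnW]. Qed.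

Lemma ID_run_end k : 0 < k <= n -> k \in ID T -> k \in run_ends T.
Proof. by move=> kn kID; rewrite mem_filter kID mem_iota syt_sum add1n ltnS. Qed.

Lemma run_inside r k : 0 < r <= nruns T -> b r.-1 < k < b r -> k \notin ID T.
Proof.
move=> /andP[r0 rN] /andP[k1 k2]; apply/negP=> /ID_run_end kends.
have : k \in 0 :: run_ends T.
  by rewrite inE kends ?orbT // (leq_ltn_trans _ k1) //= (leq_trans (ltnW k2)) ?run_end_le.
move/(nthP 0) => [j jN jk]; rewrite -jk in k1 k2.
have jr : r.-1 < j.
  rewrite ltnNge leq_eqVlt; apply/negP=> /orP[/eqP ej|lt]; first by rewrite ej ltnn in k1.
  have := run_end_lt lt (leq_trans (leq_pred r) rN).
  by move/(ltn_trans k1); rewrite ltnn.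
have rj : j < r.
  rewrite ltnNge leq_eqVlt; apply/negP=> /orP[/eqP ej|lt]; first by rewrite -ej ltnn in k2.
  have := run_end_lt lt jN.
  by move/(ltn_trans k2); rewrite ltnn.
by move: jr rj; rewrite -ltnS prednK // ltnNge => /negP.
Qed.

Lemma run_end_ID r : 0 < r < nruns T -> b r \in ID T.
Proof.
move=> /andP[r0 rN]; have : b r \in run_ends T.
  by rewrite /run_end -[r in nth _ _ r](prednK r0) /= mem_nth // -ltnS prednK // (ltn_trans rN).
rewrite mem_filter => /andP[/orP[//|/eqP bn] _].
by have := run_end_lt rN (leqnn _); rewrite run_end_last bn syt_sum ltnn.
Qed.

Lemma mem_run r x : (x \in run T r) = (x \in rcells sh) && (b r.-1 < e x <= b r).
Proof. by rewrite mem_filter andbC. Qed.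

(** Between two entries of a run no entry is a descent, so every successor lies weakly lower and is
    read later; the proof chains these comparisons. *)
Lemma run_reads r x y : 0 < r <= nruns T -> x \in run T r -> y \in run T r ->
  reads_before x y = (e x < e y).
Proof.
move=> rN; suff lt x1 y1 : x1 \in run T r -> y1 \in run T r -> e x1 < e y1 -> reads_before x1 y1.
  move=> xr yr; apply/idP/idP; last exact: lt.
  move=> xy; rewrite ltnNge leq_eqVlt; apply/negP=> /orP[/eqP exy|/(lt _ _ yr xr)/(reads_before_trans xy)].
    move: xr yr; rewrite !mem_run => /andP[xs _] /andP[ys _].
    by move: xy; rewrite (entry_inj syt_perm xs ys) ?reads_before_irr.
  by rewrite reads_before_irr.
move=> xr yr xy; have [d ed] : exists d, e y1 = (e x1 + d).+1.
  by exists (e y1 - (e x1).+1); rewrite -addSn subnKC.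
elim: d y1 yr ed {xy} => [|d IHd] z zr ez.
  rewrite addn0 in ez; move: xr zr; rewrite !mem_run => /andP[xs /andP[x1b x2b]] /andP[zs /andP[z1b z2b]].
  apply: reads_before_row; rewrite ?ez //; rewrite leqNgt -(ID_cell xs zs ez).
  by apply: (run_inside rN); rewrite x1b -ez.
move: (xr) (zr); rewrite !mem_run => /andP[xs /andP[x1b x2b]] /andP[zs /andP[z1b z2b]].
have /andP[_ zn] := entry_bounds syt_perm zs.
have [|u us eu] := @cell_of _ _ syt_perm (e x1 + d.+1).
  by rewrite addnS /= -addnS ltnW // -ez.
have ur : u \in run T r.
  rewrite mem_run us eu (leq_trans x1b) ?leq_addr //= (leq_trans _ z2b) // ez ltnW //.
have ezu : e z = (e u).+1 by rewrite ez eu.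
apply: reads_before_trans (IHd u ur _) _; first by rewrite eu addnS.
apply: reads_before_row => //; last by rewrite ezu.
rewrite leqNgt -(ID_cell us zs ezu); apply: (run_inside rN).
by move: ur; rewrite mem_run -ezu => /andP[_ /andP[-> _]].
Qed.

Lemma run_exists k x : k <= nruns T -> x \in rcells sh -> e x <= b k ->
  exists2 r, 0 < r <= k & x \in run T r.
Proof.
move=> + xs; elim: k => [|k IHk] kN xb.
  by have := entry_bounds syt_perm xs; rewrite ltnNge xb.
have [/(IHk (ltnW kN))[r /andP[r0 rk] xr]|lt] := leqP (e x) (b k).
  by exists r; rewrite // r0 ltnW.
by exists k.+1; rewrite ?leqnn // mem_run xs lt.
Qed.

Lemma sorted_run r : sorted reads_before (run T r).
Proof. exact/(sorted_filter reads_before_trans)/sorted_rcells. Qed.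

Lemma map_entry_run r : 0 < r <= nruns T -> map e (run T r) = iota (b r.-1).+1 (b r - b r.-1).
Proof.
move=> rN; have bl : b r.-1 <= b r.
  by case/andP: rN; case: (r) => // r' _ r'N; apply/ltnW/run_end_lt.
apply: (irr_sorted_eq ltn_trans ltnn); last move=> k.
- rewrite sorted_map; apply: (sub_in_sorted (P := mem (run T r))) (sorted_run r); last exact/allP.
  by move=> x y xr yr /=; rewrite (run_reads rN xr yr).
- exact: iota_ltn_sorted.
rewrite mem_iota addSn subnKC // ltnS; apply/mapP/idP => [[x]|kb].
  by rewrite mem_run => /andP[_ h] ->.
have [|x xs ex] := @cell_of _ _ syt_perm k; last by exists x; rewrite ?mem_run ?xs ?ex.
case/andP: kb => k1 k2; rewrite (leq_ltn_trans _ k1) //= (leq_trans k2) // run_end_le //.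
by case/andP: rN.
Qed.

Definition run_cells : seq cell := flatten [seq run T r | r <- iota 1 (nruns T)].

Lemma map_entry_run_cells : map e run_cells = iota 1 n.
Proof.
rewrite -run_end_last /run_cells.
suff : forall m, m <= nruns T -> map e (flatten [seq run T r | r <- iota 1 m]) = iota 1 (b m) by apply.
have iotaS m : iota 1 m.+1 = iota 1 m ++ [:: m.+1] by rewrite -[m.+1]addn1 iotaD add1n addn1.
elim=> // m IHm mN; rewrite iotaS map_cat flatten_cat map_cat IHm ?(ltnW mN) //= cats0.
have bm : b m <= b m.+1 by apply/ltnW/run_end_lt.
by rewrite map_entry_run //=; rewrite -[(b m).+1]add1n -iotaD subnKC.
Qed.

Lemma uniq_run_cells : uniq run_cells.
Proof. by apply: (@map_uniq _ _ e); rewrite map_entry_run_cells iota_uniq. Qed.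

Lemma perm_run_cells : perm_eq run_cells (rcells sh).
Proof.
apply: uniq_perm; [exact: uniq_run_cells | exact: uniq_rcells | move=> x].
have sub y : y \in run_cells -> y \in rcells sh.
  by case/flattenP=> _ /mapP[r _ ->]; rewrite mem_run => /andP[].
apply/idP/idP=> [/sub //|xs]; have : e x \in map e run_cells.
  by rewrite map_entry_run_cells mem_iota add1n ltnS (entry_bounds syt_perm).
by case/mapP=> y yc /(entry_inj syt_perm) -> //; apply: sub.
Qed.

Lemma ranking_run_cells : T = ranking sh run_cells.
Proof.
apply: eq_tableau; rewrite ?shape_ranking // => r c cr; rewrite entry_ranking //.
have rcs : (r, c) \in run_cells by rewrite (perm_mem perm_run_cells) mem_rcells.
rewrite -(@index_map_in _ _ e) //; last first.
  by move=> x y; rewrite !(perm_mem perm_run_cells); apply: (entry_inj syt_perm).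
have /andP[e0 en] : 0 < e (r, c) <= n by apply: (entry_bounds syt_perm); rewrite mem_rcells.
rewrite map_entry_run_cells -[X in index X _]prednK // -[(e (r, c)).-1.+1]add1n.
rewrite -(@nth_iota 0 1 n) ?index_uniq ?size_iota ?iota_uniq ?prednK //.
Qed.

End Runs.

(** * The maps slink and slink_* *)

Lemma ohead_filter_iota (p : pred nat) m k j : ohead [seq i <- iota m k | p i] = Some j ->
  [/\ m <= j < m + k, p j & forall i, m <= i < j -> ~~ p i].
Proof.
elim: k m => // k IHk m /=; case: ifP => [pm [<-]|pm /IHk[]].
  rewrite leqnn addnS ltnS leq_addr; split=> // i; by case/andP=> [/leq_ltn_trans lt /lt]; rewrite ltnn.
rewrite addSnnS => /andP[mj ->] pj H; rewrite (ltnW mj); split=> // i /andP[].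
by rewrite leq_eqVlt => /orP[/eqP <- _|mi ij]; [rewrite pm | apply: H; rewrite mi].
Qed.

Lemma eq_superstandard (U : tableau) :
  (U == superstandard (shape U)) = (flatten U == iota 1 (size (flatten U))).
Proof.
apply/eqP/eqP=> [eU|eU].
  rewrite {1}eU /superstandard reshapeKr ?size_flatten // size_iota leqnn //.
by rewrite /superstandard -size_flatten -eU flattenK.
Qed.

Lemma flatten_first_runs T k : flatten (first_runs T k) = [seq x <- flatten T | x <= run_end T k].
Proof.
rewrite filter_flatten /first_runs; elim: (map _ T) => //= s L <-; by case: s.
Qed.

Lemma flatten_cells T :
  flatten T = [seq cell_entry T x | x <- [seq (r, c) | r <- iota 0 (size T), c <- iota 0 (row_len (shape T) r)]].
Proof.
rewrite map_flatten -map_comp -{1}(take_size T) -(map_nth_iota0 [::] (leqnn _)); congr flatten.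
apply/eq_in_map => r; rewrite mem_iota /= => rT.
by rewrite -map_comp /row_len (nth_map [::]) // map_nth_iota0 // take_size.
Qed.

(** Meant for [first_runs]: the rows emptied by restricting to small entries are the topmost ones,
    so dropping them does not renumber the others. *)
Lemma nth_filter_nonempty (L : seq (seq nat)) r :
  (forall r, nth [::] L r.+1 != [::] -> nth [::] L r != [::]) ->
  nth [::] [seq s <- L | s != [::]] r = nth [::] L r.
Proof.
elim: L r => [|s L IHL] r H; first by rewrite nth_nil.
have H' r' : nth [::] L r'.+1 != [::] -> nth [::] L r' != [::] by apply: (H r'.+1).
rewrite /=; case: eqP => [s0|_]; last by case: r => //= r; apply: IHL.
have L0 r' : nth [::] L r' = [::].
  elim: r' => [|r' IH]; apply/eqP/negPn/negP; first by move/(H 0); rewrite /= s0.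
  by move/H'; rewrite IH.
rewrite IHL // L0; case: r => //= r; by rewrite L0.
Qed.

Lemma eq_cells s1 s2 : sorted reads_before s1 -> sorted reads_before s2 -> s1 =i s2 -> s1 = s2.
Proof. exact: (irr_sorted_eq reads_before_trans reads_before_irr). Qed.

Lemma rcells_peel sh (P : pred cell) k :
  [seq x <- rcells sh | P x && (x.1 < k.+1)] =
  [seq x <- rcells sh | P x && (x.1 == k)] ++ [seq x <- rcells sh | P x && (x.1 < k)].
Proof.
have sf (Q : pred cell) : sorted reads_before [seq x <- rcells sh | Q x].
  by apply: (sorted_filter reads_before_trans); apply: sorted_rcells.
apply: eq_cells => //.
  rewrite (sorted_pairwise reads_before_trans) pairwise_cat -!(sorted_pairwise reads_before_trans) !sf !andbT.
  apply/allrelP=> x y; rewrite !mem_filter => /andP[/andP[_ /eqP xk] _] /andP[/andP[_ yk] _].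
  by rewrite /reads_before xk yk.
move=> x; rewrite mem_cat !mem_filter -!andb_orl -andb_orr ltnS leq_eqVlt //.
Qed.

Lemma rcells_rows sh (P : pred cell) i d :
  [seq x <- rcells sh | P x && (x.1 < i + d)] =
  flatten [seq [seq x <- rcells sh | P x && (x.1 == r)] | r <- rev (iota i d)] ++
  [seq x <- rcells sh | P x && (x.1 < i)].
Proof.
elim: d => [|d IHd]; first by rewrite addn0.
by rewrite addnS rcells_peel IHd -[d.+1]addn1 iotaD rev_cat /= catA.
Qed.

(** * Geometry of the runs up to the first non-superstandard one *)

Section FirstBadRun.

Variables (n : nat) (T : tableau) (j : nat).
Hypothesis TSYT : SYTn n T.
Hypothesis Tbad : first_bad_run T = Some j.
Local Notation sh := (shape T).
Local Notation e := (cell_entry T).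
Local Notation b := (run_end T).

(** [flatten] reads the bottom row first, so the entries up to k come in increasing order exactly
    when larger ones never lie in lower rows. *)
Lemma row_monotoneP k :
  reflect {in rcells sh &, forall x y, e x < e y -> e y <= k -> x.1 <= y.1}
          (sorted ltn [seq z <- flatten T | z <= k]).
Proof.
rewrite flatten_cells filter_map sorted_map; set s := filter _ _.
have trl := cell_rel_trans ltn_trans.
have irl : irreflexive (cell_rel ltn) by move=> x; rewrite /cell_rel /= !ltnn andbF.
have ss : sorted (cell_rel ltn) s.
  by apply: (sorted_filter trl); apply: sorted_cells (iota_ltn_sorted _ _); apply: ltn_trans.
have ms x : (x \in s) = (x \in rcells sh) && (e x <= k).
  rewrite mem_filter /= andbC; congr (_ && _).
  rewrite mem_rcells; case: x => r c; apply/allpairsPdep/idP => [[r' [c' [_ +]]] [-> ->]|/= cr].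
    by rewrite mem_iota.
  exists r, c; rewrite !mem_iota /=; split=> //.
  by move: cr; rewrite /row_len; case: (ltnP r (size T)) => // h; rewrite nth_default // size_map.
apply: (iffP idP) => [se x y xs ys xy yk | H].
  have xk : e x <= k by apply: leq_trans (ltnW xy) yk.
  have xin : x \in s by rewrite ms xs.
  have yin : y \in s by rewrite ms ys.
  have := sorted_index_lt trl irl ss xin yin.
  rewrite (@sorted_index_lt _ (relpre e ltn)) //=; last 2 first.
  - by move=> ? ? ?; apply: ltn_trans.
  - by move=> ?; apply: ltnn.
  by rewrite xy /cell_rel => /esym /orP[/ltnW //|/andP[/eqP -> _]].
apply: (sub_in_sorted (P := mem s)) ss; last exact/allP.
move=> x y /=; rewrite !ms => /andP[xs xk] /andP[ys yk]; rewrite /cell_rel => /orP[xy|/andP[/eqP xy1 xy2]].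
  rewrite ltnNge leq_eqVlt; apply/negP=> /orP[/eqP/(entry_inj (syt_perm TSYT) ys xs) yx|/(H _ _ ys xs)/(_ xk)].
    by rewrite yx /= ltnn in xy.
  by rewrite leqNgt => /negP; apply.
by rewrite /cell_entry xy1; apply: (syt_rows TSYT) => //; move: ys; rewrite mem_rcells.
Qed.

Lemma not_superstandardE k : k <= nruns T ->
  not_superstandard T k = ~~ sorted ltn [seq z <- flatten T | z <= b k].
Proof.
move=> kN; rewrite /not_superstandard eq_superstandard flatten_first_runs; congr (~~ _).
apply/eqP/idP=> [->|s]; first exact: iota_ltn_sorted.
have -> : [seq z <- flatten T | z <= b k] = iota 1 (b k).
  apply: (irr_sorted_eq ltn_trans ltnn) => //; first exact: iota_ltn_sorted.
  move=> z; rewrite mem_filter -(perm_mem (perm_row_word T)) (perm_mem (syt_perm TSYT)) !mem_iota !add1n !ltnS.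
  have := run_end_le TSYT kN; case: (leqP z (b k)) => zb kn; rewrite ?andbF ?andbT //.
  by rewrite (leq_trans zb kn) andbT.
by rewrite size_iota.
Qed.

Lemma first_bad_runP : [/\ 0 < j <= nruns T, not_superstandard T j &
  forall k, 0 < k < j -> ~~ not_superstandard T k].
Proof. by have [+ nj H] := ohead_filter_iota Tbad; rewrite add1n ltnS; split. Qed.

Lemma good_monotone k x y : 0 < k < j -> x \in rcells sh -> y \in rcells sh ->
  e x < e y -> e y <= b k -> x.1 <= y.1.
Proof.
move=> kj xs ys; have [/andP[j0 jN] _ /(_ k kj)] := first_bad_runP.
rewrite not_superstandardE ?negbK; first by move/row_monotoneP; apply.
by case/andP: kj => _ /ltnW/leq_trans; apply.
Qed.

Lemma cell_below x : x \in rcells sh -> 0 < x.1 ->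
  (x.1.-1, x.2) \in rcells sh /\ e (x.1.-1, x.2) < e x.
Proof.
case: x => [[//|r] c]; rewrite !mem_rcells /= => cr _.
exact: (syt_cols TSYT (ltnSn r) cr).
Qed.

(** Induction on the entry. Inside a run the next cell is read later, so weakly lower, and weakly
    higher by monotonicity. At the start of a run the preceding entry is a descent, so the row goes
    up; it goes up by one only, because the cell below has an entry at most the preceding one. *)
Lemma good_run_row r x : 0 < r < j -> x \in run T r -> x.1 = r.-1.
Proof.
have [/andP[j0 jN] _ _] := first_bad_runP.
elim: (e x) {-2}x (erefl (e x)) r => [|k IHk] {}x ex r /andP[r0 rj]; rewrite mem_run => /andP[xs xr].
  by have := entry_bounds (syt_perm TSYT) xs; rewrite ex.
have rN : r <= nruns T by apply: leq_trans (ltnW rj) jN.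
case: (posnP k) => [k0|k0].
  have x1 : x.1 = 0.
    apply/eqP; rewrite -leqn0 leqNgt; apply/negP=> /(cell_below xs)[zs].
    by rewrite ex k0 ltnS leqNgt; case/andP: (entry_bounds (syt_perm TSYT) zs) => ->.
  rewrite x1; case: r r0 rj xr rN => [//|[//|r]] _ _ /andP[+ _] rN.
  rewrite ex k0 ltnS leqn0 => /eqP b0.
  by have := run_end_lt (ltn0Sn r) (ltnW rN); rewrite b0.
have [|y ys ey] := cell_of (syt_perm TSYT) (k := k).
  by rewrite k0 -ltnS -ex ltnW // ltnS; case/andP: (entry_bounds (syt_perm TSYT) xs).
have exy : e x = (e y).+1 by rewrite ex ey.
have xb : e x <= b r by case/andP: xr.
have rj' : 0 < r < j by rewrite r0.
have [lt|] := ltnP (b r.-1) k.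
  have yr : y \in run T r by rewrite mem_run ys ey lt (leq_trans _ xb) // ex.
  have y1 := IHk y ey r rj' yr.
  have xr' : x \in run T r by rewrite mem_run xs.
  have le1 : y.1 <= x.1 by apply: (good_monotone rj') => //; rewrite exy.
  have : reads_before y x by rewrite (run_reads TSYT (r := r)) ?exy ?r0.
  rewrite /reads_before -y1 => /orP[lt'|/andP[/eqP -> //]].
  by rewrite ltnNge le1 in lt'.
rewrite leq_eqVlt => /orP[/eqP kb|]; last first.
  by case/andP: xr; rewrite ex ltnS => le _ /(leq_ltn_trans le); rewrite ltnn.
case: r r0 rj xr rN xb rj' kb => [//|[|r]] _ rj xr rN xb rj' /= kb.
  by move: k0; rewrite kb.
have yr : y \in run T r.+1.
  by rewrite mem_run ys ey kb leqnn andbT /=; apply: (run_end_lt) => //; apply: ltnW.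
have y1 : y.1 = r by apply: (IHk y ey r.+1 _ yr); rewrite /= (ltn_trans _ rj).
have yx : y.1 < x.1 by rewrite -(ID_cell TSYT ys xs exy) ey kb; apply: (run_end_ID TSYT).
have [zs zx] := cell_below xs (leq_ltn_trans (leq0n _) yx).
apply/eqP; rewrite eqn_leq -{2}y1 yx andbT -[x.1]prednK ?(leq_ltn_trans _ yx) // ltnS -y1.
move: zx; rewrite exy ltnS leq_eqVlt => /orP[/eqP/(entry_inj (syt_perm TSYT) zs ys) <- //|zy].
by apply: (good_monotone (k := r.+2) (x := (x.1.-1, x.2)) rj') => //; rewrite (leq_trans _ xb) // exy.
Qed.

(** The cell below has a smaller entry. It cannot lie in run j together with x, since it is read
    after x; so it lies in a good run, whose index is determined by its row. *)
Lemma strip_below x : x \in rcells sh -> 0 < x.1 -> e x <= b j ->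
  (x.1.-1, x.2) \in run T x.1 /\ x.1 < j.
Proof.
have [/andP[j0 jN] _ _] := first_bad_runP.
move=> xs x0 xb; have [zs zx] := cell_below xs x0.
suff [r rj zr] : exists2 r, 0 < r < j & (x.1.-1, x.2) \in run T r.
  have /= := good_run_row rj zr; case/andP: rj => r0 rj e1.
  have e2 : r = x.1 by rewrite -(prednK r0) -(prednK x0) e1.
  by move: zr rj; rewrite e2.
have [r /andP[r0 rj] xr] := run_exists TSYT jN xs xb.
move: rj; rewrite leq_eqVlt => /orP[/eqP ej|rj].
  subst r; have [lt|le] := ltnP (b j.-1) (e (x.1.-1, x.2)).
    have zr : (x.1.-1, x.2) \in run T j by rewrite mem_run zs lt (leq_trans (ltnW zx)).
    move: zx; rewrite -(run_reads TSYT (r := j)) ?j0 // /reads_before /=.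
    by case/orP=> [|/andP[/eqP]]; [rewrite ltnNge leq_pred | move=> e1; move: x0; rewrite -e1; case: (x.1) e1 => //= m /n_Sn].
  have [r /andP[r0' rj] zr] := run_exists TSYT (leq_trans (leq_pred j) jN) zs le.
  by exists r => //; rewrite r0' -(prednK j0) ltnS.
have zb : e (x.1.-1, x.2) <= b r.
  by apply: leq_trans (ltnW zx) _; move: xr; rewrite mem_run => /and3P[].
have [r' /andP[r0' rj'] zr] := run_exists TSYT (leq_trans (ltnW rj) jN) zs zb.
by exists r' => //; rewrite r0' (leq_ltn_trans rj').
Qed.

(** Were all of run j in row j, the first j runs would fill their rows in order and be
    superstandard. *)
Lemma bad_run_low : exists2 x, x \in run T j & x.1 < j.-1.
Proof.
have [/andP[j0 jN] + _] := first_bad_runP.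
rewrite not_superstandardE // => H.
have [/hasP[x xj xlt]|/hasPn high] := boolP (has (fun x => x.1 < j.-1) (run T j)); first by exists x.
have rowE r x : 0 < r <= j -> x \in run T r -> x.1 = r.-1.
  case/andP=> r0; rewrite leq_eqVlt => /orP[/eqP ->|rj] xr; last by apply: good_run_row; rewrite ?r0.
  apply/eqP; rewrite eqn_leq [X in _ && X]leqNgt high // andbT.
  case: (posnP x.1) => [-> //|x0]; rewrite -ltnS prednK //.
  by move: xr; rewrite mem_run => /and3P[xs _ xb]; case: (strip_below xs x0 xb).
case/negP: H; apply/row_monotoneP => x y xs ys xy yb.
have xb := leq_trans (ltnW xy) yb.
have [r /andP[r0 rj] xr] := run_exists TSYT jN xs xb.
have [r' /andP[r0' rj'] yr] := run_exists TSYT jN ys yb.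
rewrite (rowE r x) ?r0 // (rowE r' y) ?r0' //.
rewrite -ltnS !prednK // leqNgt; apply/negP=> rr.
have : b r' <= b r.-1.
  have : r' <= r.-1 by rewrite -ltnS prednK.
  rewrite leq_eqVlt => /orP[/eqP -> //|lt]; apply/ltnW/(run_end_lt) => //.
  by apply: leq_trans (leq_trans (leq_pred r) rj) jN.
move: xr yr; rewrite !mem_run => /and3P[_ b1 _] /and3P[_ _ b2] /(leq_trans b2)/leq_trans/(_ (ltnW b1)).
by rewrite leqNgt xy.
Qed.

Lemma first_bad_gt1 : 1 < j.
Proof.
have [/andP[j0 _] _ _] := first_bad_runP; have [x _] := bad_run_low.
by case: j j0 => [|[|]].
Qed.

Definition first_runs_row (r : nat) : seq cell :=
  [seq x <- rcells sh | (e x <= b j) && (x.1 == r)].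

Lemma mem_first_runs_row r x :
  (x \in first_runs_row r) = [&& x \in rcells sh, e x <= b j & x.1 == r].
Proof. by rewrite mem_filter andbC. Qed.

Lemma mem_run_row k r x : (x \in [seq y <- run T k | y.1 == r]) = (x.1 == r) && (x \in run T k).
Proof. exact: mem_filter. Qed.

Lemma sorted_filter_rcells (P : pred cell) : sorted reads_before [seq x <- rcells sh | P x].
Proof. by apply: (sorted_filter reads_before_trans); apply: sorted_rcells. Qed.

(** Moving each cell one row down is an injection into the run that starts the row below. *)
Lemma size_first_runs_rowS r : size (first_runs_row r.+1) <= size (run T r.+1).
Proof.
rewrite -(size_map (fun x : cell => (x.1.-1, x.2))); apply: uniq_leq_size.
  rewrite map_inj_in_uniq; first by rewrite filter_uniq ?uniq_rcells.
  move=> [x1 x2] [y1 y2]; rewrite !mem_first_runs_row /= => /and3P[_ _ /eqP ->] /and3P[_ _ /eqP ->].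
  by case=> ->.
move=> _ /mapP[x + ->]; rewrite mem_first_runs_row => /and3P[xs xb /eqP xr].
by have := strip_below xs _ xb; rewrite xr => -[].
Qed.

Lemma run_row_lt r x : 0 < r <= j -> x \in run T r -> x.1 < j.
Proof.
move=> rj; rewrite mem_run => /and3P[xs _ xb]; case: (posnP x.1) => [->|x0].
  exact: ltn_trans first_bad_gt1.
have xbj : e x <= b j.
  apply: leq_trans xb _; case/andP: rj => r0; rewrite leq_eqVlt => /orP[/eqP -> //|rj].
  by apply/ltnW/(run_end_lt) => //; have [/andP[]] := first_bad_runP.
by case: (strip_below xs x0 xbj).
Qed.

Lemma first_runs_rowE r : r < j.-1 ->
  first_runs_row r = run T r.+1 ++ [seq x <- run T j | x.1 == r].
Proof.
have [/andP[j0 jN] _ _] := first_bad_runP.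
move=> rj; have rj' : 0 < r.+1 < j by rewrite /= -(prednK j0) ltnS.
have rb : b r.+1 <= b j.-1.
  move: rj; rewrite -[r < _]/(r.+1 <= _) leq_eqVlt => /orP[/eqP -> //|lt].
  by apply/ltnW/(run_end_lt) => //; apply: leq_trans (leq_pred j) jN.
apply: eq_cells; first exact: sorted_filter_rcells.
  rewrite (sorted_pairwise reads_before_trans) pairwise_cat -!(sorted_pairwise reads_before_trans).
  rewrite sorted_run (sorted_filter reads_before_trans _ (sorted_run T j)) !andbT.
  apply/allrelP=> x y xr; rewrite mem_run_row => /andP[/eqP yr yj].
  have xr1 := good_run_row rj' xr.
  move: xr yj; rewrite !mem_run => /and3P[xs _ xb] /and3P[ys yb _].
  by apply: (reads_before_row TSYT) => //; rewrite ?yr ?xr1 // (leq_ltn_trans xb) // (leq_ltn_trans rb).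
move=> x; rewrite mem_cat mem_first_runs_row mem_run_row; apply/idP/idP.
  case/and3P=> xs xb /eqP xr; have [k /andP[k0 kj] xk] := run_exists TSYT jN xs xb.
  move: kj; rewrite leq_eqVlt => /orP[/eqP kj|kj]; first by subst k; rewrite xk xr eqxx orbT.
  have e1 : r.+1 = k by rewrite -xr (good_run_row (r := k)) ?k0 ?prednK.
  by rewrite e1 xk.
have bj : b j.-1 < b j by apply: run_end_lt => //; rewrite prednK.
case/orP=> [xr|/andP[/eqP xr]]; last by rewrite mem_run xr eqxx => /and3P[-> _ ->].
rewrite (good_run_row rj' xr) eqxx; move: xr; rewrite mem_run => /and3P[-> _ xb].
by rewrite (leq_trans xb) // (leq_trans rb) // ltnW.
Qed.

Lemma first_runs_row_top : first_runs_row j.-1 = [seq x <- run T j | x.1 == j.-1].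
Proof.
have [/andP[j0 jN] _ _] := first_bad_runP.
apply: eq_cells; [exact: sorted_filter_rcells| exact: (sorted_filter reads_before_trans _ (sorted_run T j)) | move=> x].
rewrite mem_first_runs_row mem_run_row; apply/idP/idP=> [/and3P[xs xb /eqP xr]|/andP[->]]; last first.
  by rewrite mem_run => /and3P[-> _ ->].
rewrite xr eqxx; have [k /andP[k0 kj] xk] := run_exists TSYT jN xs xb.
move: kj; rewrite leq_eqVlt => /orP[/eqP kj|kj]; first by subst k.
have e1 : k.-1 = j.-1 by rewrite -xr (good_run_row (r := k)) ?k0.
by move: kj; rewrite -(prednK k0) -(prednK j0) e1 ltnn.
Qed.

Lemma row_len_first_runs r : row_len (shape (first_runs T j)) r = size (first_runs_row r).
Proof.
have nthf r' : nth [::] [seq [seq x <- row | x <= b j] | row <- T] r' = [seq x <- nth [::] T r' | x <= b j].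
  case: (ltnP r' (size T)) => h; first by rewrite (nth_map [::]).
  by rewrite !nth_default ?size_map.
have memf r' : (nth [::] [seq [seq x <- row | x <= b j] | row <- T] r' != [::]) =
    has (fun c => entry T r' c <= b j) (iota 0 (row_len sh r')).
  rewrite nthf -size_eq0 size_filter -lt0n -has_count row_lenE.
  by rewrite -[in LHS](take_size (nth [::] T r')) -(map_nth_iota0 0 (leqnn _)) has_map.
have -> : row_len (shape (first_runs T j)) r = size [seq x <- nth [::] T r | x <= b j].
  rewrite row_lenE /first_runs nth_filter_nonempty ?nthf // => r'.
  rewrite !memf => /hasP[c]; rewrite mem_iota /= => cr cb; have [cr' lt] := syt_cols TSYT (ltnSn r') cr.
  by apply/hasP; exists c; rewrite ?mem_iota // (leq_trans (ltnW lt)).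
rewrite -[in LHS](take_size (nth [::] T r)) -(map_nth_iota0 0 (leqnn _)) filter_map size_map.
rewrite -(size_map (pair r)); apply: perm_size; apply: uniq_perm.
- by rewrite map_inj_uniq ?filter_uniq ?iota_uniq // => c c' [].
- by rewrite filter_uniq ?uniq_rcells.
move=> [r' c]; rewrite mem_first_runs_row mem_rcells /= row_lenE; apply/mapP/idP.
  by case=> c'; rewrite mem_filter mem_iota /= => /andP[cb cs] [-> ->]; rewrite cs cb eqxx.
by case/and3P=> cs cb /eqP rr; subst r'; exists c; rewrite // mem_filter mem_iota /= cb.
Qed.

Definition high (r : nat) : seq cell := [seq x <- run T j | r <= x.1].

(** Induction from the top row down. The cells of run j above row r number at most the cells in row
    r+1 of the first j runs, hence at most those of run r+1, which shares row r with the remaining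
    cells of run j. *)
Lemma size_high_leq r : size (high r) <= size (first_runs_row r).
Proof.
have [/andP[j0 jN] _ _] := first_bad_runP.
have [rj|jr] := ltnP r j; last first.
  rewrite (_ : high r = [::]) //; apply/eqP; rewrite -size_eq0 size_filter -leqn0 leqNgt -has_count.
  by apply/hasPn=> x xj; rewrite -ltnNge (leq_trans (run_row_lt _ xj)) // j0 /=.
have [d ed] : exists d, j = (r + d).+1 by exists (j - r.+1); rewrite -addSn subnKC.
have high_split k : size (high k) = size [seq x <- run T j | x.1 == k] + size (high k.+1).
  rewrite !size_filter -count_predUI.
  have -> : count (predI (fun x : cell => x.1 == k) (fun x => k < x.1)) (run T j) = 0.
    apply/eqP; rewrite -leqn0 leqNgt -has_count; apply/hasPn=> x _ /=.
    by case: eqP => // ->; rewrite ltnn.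
  by rewrite addn0; apply: eq_count => x /=; rewrite leq_eqVlt eq_sym.
elim: d r rj ed => [|d IHd] r rj ed.
  rewrite high_split (_ : high r.+1 = [::]) ?addn0; last first.
    apply/eqP; rewrite -size_eq0 size_filter -leqn0 leqNgt -has_count.
    apply/hasPn=> x xj; rewrite -ltnNge; apply: leq_trans (run_row_lt _ xj) _; first by rewrite j0 /=.
    by rewrite ed addn0.
  by have -> : r = j.-1; [rewrite ed addn0 | rewrite first_runs_row_top].
have rj1 : r < j.-1 by rewrite ed /= -addn1 leq_add2l.
rewrite high_split first_runs_rowE // size_cat addnC leq_add2r.
apply: leq_trans (size_first_runs_rowS r); apply: IHd; last by rewrite addSnnS.
by rewrite -(prednK j0).
Qed.

End FirstBadRun.

(** * Relinking runs i and j by slides *)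

Section Relink.

Variables (n : nat) (T : tableau) (j : nat) (i : nat) (top : pred nat).
Hypothesis TSYT : SYTn n T.
Hypothesis Tbad : first_bad_run T = Some j.
Hypothesis ij : 0 < i < j.
Local Notation sh := (shape T).
Local Notation e := (cell_entry T).
Local Notation b := (run_end T).
Local Notation N := (nruns T).

(** The data of [split_runs]: L is the pool to be cut, t the part of run j in row j, and s lists
    from the top down the intermediate runs with the cells of run j in the same row. Rows are
    numbered from 0 here, so run r+1 lies in row r. *)
Let L : seq cell := [seq x <- rcells sh | (x \in run T i ++ run T j) && (x.1.+1 < i.+1)].
Let low : seq cell := [seq x <- run T j | x.1 < i].
Let t : seq cell := [seq x <- run T j | x.1 == j.-1].
Let s (k : nat) : seq (seq cell * seq cell) :=
  [seq (run T r.+1, [seq x <- run T j | x.1 == r]) | r <- rev (iota i k)].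

Lemma sorted_cells_cat (s1 s2 : seq cell) : sorted reads_before s1 -> sorted reads_before s2 ->
  (forall x y, x \in s1 -> y \in s2 -> reads_before x y) -> sorted reads_before (s1 ++ s2).
Proof.
move=> h1 h2 h; rewrite (sorted_pairwise reads_before_trans) pairwise_cat.
rewrite -!(sorted_pairwise reads_before_trans) h1 h2 !andbT; exact/allrelP.
Qed.

Lemma sorted_filter_run r (P : pred cell) : sorted reads_before [seq x <- run T r | P x].
Proof. exact: (sorted_filter reads_before_trans _ (sorted_run T r)). Qed.

Lemma iota_rev_last k : rev (iota i k.+1) = (i + k) :: rev (iota i k).
Proof. by rewrite -[k.+1]addn1 iotaD rev_cat. Qed.

Lemma relink_pool : L = run T i ++ low.
Proof.
have [/andP[j0 jN] _ _] := first_bad_runP Tbad.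
apply: eq_cells; first exact: sorted_filter_rcells.
  apply: sorted_cells_cat; [exact: sorted_run | exact: sorted_filter_run | move=> x y xi].
  rewrite /low mem_filter => /andP[yi yj]; have xr := good_run_row TSYT Tbad ij xi.
  move: xi yj; rewrite !mem_run => /and3P[xs _ xb] /and3P[ys yb _].
  apply: (reads_before_row TSYT) => //.
    by rewrite xr -ltnS prednK //; case/andP: ij.
  apply: leq_ltn_trans xb (leq_ltn_trans _ yb); case/andP: ij => _.
  have : i <= j.-1 by rewrite -ltnS prednK //; case/andP: ij.
  rewrite leq_eqVlt => /orP[/eqP <- //|lt] _; apply/ltnW/run_end_lt => //.
  exact: leq_trans (leq_pred j) jN.
move=> x; rewrite /L /low mem_filter ltnS !mem_cat (mem_filter (fun x : cell => x.1 < i)).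
apply/idP/idP; first by case/andP=> /andP[/orP[->|->] ->]; rewrite ?orbT.
case/orP=> [xi|/andP[-> xj]].
  rewrite (good_run_row TSYT Tbad ij) // xi -ltnS prednK; case/andP: ij => // i0 _.
  by rewrite leqnn; move: xi; rewrite mem_run => /andP[].
by rewrite xj orbT; move: xj; rewrite mem_run => /andP[].
Qed.

Lemma run_high_low : run T j = high T j i ++ low.
Proof.
apply: eq_cells; first exact: sorted_run.
  apply: sorted_cells_cat; [exact: sorted_filter_run | exact: sorted_filter_run | move=> x y].
  rewrite !mem_filter => /andP[xi _] /andP[yi _].
  by rewrite /reads_before (leq_trans yi xi).
by move=> x; rewrite mem_cat /high /low (mem_filter (fun x : cell => i <= x.1)) (mem_filter (fun x : cell => x.1 < i)); case: leqP; rewrite ?orbF.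
Qed.

Lemma high_strips : high T j i = t ++ flatten (map snd (s (j.-1 - i))).
Proof.
have [/andP[j0 jN] _ _] := first_bad_runP Tbad; have /andP[i0 ij'] := ij.
have ed : j - i = (j.-1 - i).+1 by rewrite -{1}(prednK j0) subSn // -ltnS prednK.
have := rcells_rows sh (fun x => (x \in run T j) && (i <= x.1)) i (j - i).
have -> : [seq x <- rcells sh | [&& x \in run T j & i <= x.1] && (x.1 < i + (j - i))] = high T j i.
  apply: eq_cells; [exact: sorted_filter_rcells | exact: sorted_filter_run | move=> x].
  rewrite mem_filter /high (mem_filter (fun x : cell => i <= x.1)) subnKC ?(ltnW ij') //.
  case: (boolP (x \in run T j)) => [xj|_]; last by rewrite andbF.
  have xs : x \in rcells sh by move: xj; rewrite mem_run => /andP[].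
  have xlt : x.1 < j by apply: (run_row_lt TSYT Tbad) xj; rewrite j0 /=.
  by rewrite xs xlt !andbT.
move=> ->; rewrite ed iota_rev_last /= -catA (_ : i + (j.-1 - i) = j.-1); last first.
  by rewrite subnKC // -ltnS prednK.
congr (_ ++ _).
  apply: eq_cells; [exact: sorted_filter_rcells | exact: sorted_filter_run | move=> x].
  rewrite mem_filter mem_run_row; case: eqP => [->|_]; last by rewrite !andbF.
  rewrite (_ : i <= j.-1); last by rewrite -ltnS prednK.
  case: (boolP (x \in run T j)) => [xj|_]; last by rewrite !andbF.
  by move: xj; rewrite mem_run => /andP[->].
rewrite [X in _ ++ X](_ : _ = [::]) ?cats0; last first.
  apply/eqP; rewrite -size_eq0 size_filter -leqn0 leqNgt -has_count.
  by apply/hasPn=> x _; case: leqP; rewrite ?andbF.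
rewrite -map_comp; congr flatten; apply/eq_in_map => r; rewrite mem_rev mem_iota => /andP[ir _].
apply: eq_cells; [exact: sorted_filter_rcells | exact: sorted_filter_run | move=> x].
rewrite mem_filter mem_run_row; case: eqP => [->|_]; last by rewrite !andbF.
rewrite ir; case: (boolP (x \in run T j)) => [xj|_]; last by rewrite !andbF.
by move: xj; rewrite mem_run => /andP[->].
Qed.

(** Stacked from the top down, these lists are all the rows with index at least i of the first j
    runs, followed by the pool. The whole is thus one filter of [rcells]. *)
Lemma sorted_relink :
  sorted reads_before (t ++ flatten [seq p.1 ++ p.2 | p <- s (j.-1 - i)] ++ L).
Proof.
have [/andP[j0 jN] _ _] := first_bad_runP Tbad; have /andP[i0 ij'] := ij.
have ed : j - i = (j.-1 - i).+1 by rewrite -{1}(prednK j0) subSn // -ltnS prednK.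
pose P (x : cell) := (e x <= b j) && ((i <= x.1) || (x \in run T i ++ run T j)).
have ij1 : i <= j.-1 by rewrite -ltnS prednK.
have := rcells_rows sh P i (j - i); rewrite ed iota_rev_last /= subnKC // -!catA.
have rowE r : i <= r -> [seq x <- rcells sh | P x && (x.1 == r)] = first_runs_row T j r.
  move=> ir; apply: eq_filter => x; rewrite /P; case: eqP => [->|_]; last by rewrite !andbF.
  by rewrite ir !andbT.
rewrite rowE // (first_runs_row_top TSYT Tbad) -/t.
have -> : [seq x <- rcells sh | P x && (x.1 < i)] = L.
  apply: eq_filter => x; rewrite /P ltnS; case: leqP => _; rewrite ?andbF // !andbT /= andbC.
  case: (boolP (x \in _)) => //=; rewrite mem_cat !mem_run => /orP[] /and3P[_ _ xb] //.
  by rewrite (leq_trans xb) // ltnW // run_end_lt.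
have -> : [seq [seq x <- rcells sh | P x && (x.1 == r)] | r <- rev (iota i (j.-1 - i))] =
          [seq p.1 ++ p.2 | p <- s (j.-1 - i)].
  rewrite /s -map_comp; apply/eq_in_map => r; rewrite mem_rev mem_iota => /andP[ir rj].
  rewrite rowE // (first_runs_rowE TSYT Tbad) //; apply: leq_trans rj _.
  by rewrite subnKC // -ltnS prednK.
move=> <-; exact: sorted_filter_rcells.
Qed.

Lemma strip_sizes_relink q k : i + k <= j.-1 -> size (first_runs_row T j i) <= q ->
  strip_sizes (first_runs_row T j (i + k)) (s k) q.
Proof.
elim: k => [|k IHk] kj iq; first by rewrite addn0.
have lt : i + k < j.-1 by rewrite -addnS.
rewrite /s iota_rev_last /= addnS (size_first_runs_rowS TSYT Tbad) /=.
by rewrite -(first_runs_rowE TSYT Tbad) // IHk // ltnW.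
Qed.

Let A : seq cell := flatten [seq run T r | r <- iota 1 i.-1].
Let B : seq cell := flatten [seq run T r | r <- iota j.+1 (N - j)].

Lemma iota_runs : iota 1 N = iota 1 i.-1 ++ i :: iota i.+1 (j.-1 - i) ++ j :: iota j.+1 (N - j).
Proof.
have [/andP[j0 jN] _ _] := first_bad_runP Tbad; have /andP[i0 ij'] := ij.
have e1 : j :: iota j.+1 (N - j) = iota j (N - j).+1 by [].
have e2 : iota i.+1 (j.-1 - i) ++ iota j (N - j).+1 = iota i.+1 (N - i).
  have -> : N - i = (j.-1 - i) + (N - j).+1 by move: j0 jN i0 ij'; clear; lia.
  by rewrite iotaD; congr (_ ++ iota _ _); move: j0 ij'; clear; lia.
rewrite e1 e2 -[i :: _]/(iota i (N - i).+1).
have -> : N = i.-1 + (N - i).+1 by move: j0 jN i0 ij'; clear; lia.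
rewrite iotaD add1n prednK //; congr (_ ++ iota _ _.+1); move: j0 jN i0 ij'; clear; lia.
Qed.

Lemma run_between : flatten [seq run T r | r <- iota i.+1 (j.-1 - i)] =
  flatten (rev (map fst (s (j.-1 - i)))).
Proof.
by rewrite -map_comp -map_rev revK -(add1n i) iotaDl -map_comp.
Qed.

Lemma run_cells_split : run_cells T = A ++ split_runs t (s (j.-1 - i)) L (size (run T i)) B.
Proof.
rewrite /run_cells iota_runs !(map_cat, flatten_cat) /= !(map_cat, flatten_cat) /= run_between -/A -/B.
rewrite /split_runs relink_pool take_size_cat // drop_size_cat // run_high_low high_strips.
by rewrite -!catA.
Qed.

(** Covers both maps: on rows up to j, the condition of being row j and the condition of being at
    least row i+1 agree when i = j-1. *)
Hypothesis topE : forall r, r <= j -> top r = (i < r).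

(** Compared with [run_cells_split], only the place q where the pool is cut has changed, so T and
    its image are two instances of [slides_split_runs]. *)
Lemma relink_split q : relink T i j i.+1 q top =
  ranking sh (A ++ split_runs t (s (j.-1 - i)) L q B).
Proof.
have [/andP[j0 jN] _ _] := first_bad_runP Tbad; have /andP[i0 ij'] := ij.
rewrite /relink /of_runs /ranking -/L; set new_j := drop q L ++ _; set order := flatten _.
suff -> : order = A ++ split_runs t (s (j.-1 - i)) L q B by [].
have sub : subseq L (rcells sh) by apply: filter_subseq.
have filtered r : [seq x <- rcells sh | x \in run T r] = run T r.
  apply: eq_cells; [exact: sorted_filter_rcells | exact: sorted_run | move=> x].
  by rewrite mem_filter; case: (boolP (x \in run T r)); rewrite // mem_run => /andP[].
have new_iE : [seq x <- rcells sh | x \in take q L] = take q L.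
  apply/esym/subseq_uniqP; first exact: uniq_rcells.
  exact: subseq_trans (take_subseq _ _) sub.
have new_jE : [seq x <- rcells sh | x \in new_j] = high T j i ++ drop q L.
  apply: eq_cells; first exact: sorted_filter_rcells.
    apply: sorted_cells_cat; first exact: sorted_filter_run.
      by apply: drop_sorted; apply: sorted_filter_rcells.
    move=> x y; rewrite mem_filter => /andP[xi _] /mem_drop; rewrite mem_filter => /andP[/andP[_ yi] _].
    by rewrite /reads_before (leq_trans _ xi).
  move=> x; rewrite mem_filter /new_j !mem_cat orbC andb_orl.
  congr (_ || _).
    rewrite /high (mem_filter (fun x : cell => i <= x.1)) (mem_filter (fun x : cell => top x.1.+1)).
    case: (boolP (x \in run T j)) => [xj|_]; last by rewrite !andbF.
    rewrite topE ?(run_row_lt TSYT Tbad (r := j)) ?j0 //= andbT ltnS.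
    by move: xj; rewrite mem_run => /andP[->]; rewrite andbT.
  case: (boolP (x \in drop q L)) => // /mem_drop; rewrite mem_filter => /andP[_ ->] //.
have mapE u : {in u, forall r, r != i /\ r != j} ->
    flatten [seq [seq x <- rcells sh | x \in v] | v <-
      [seq if r == i then take q L else if r == j then new_j else run T r | r <- u]] =
    flatten [seq run T r | r <- u].
  move=> ur; rewrite -map_comp; congr flatten; apply/eq_in_map => r /ur[ri rj] /=.
  by rewrite (negPf ri) (negPf rj) filtered.
rewrite /order iota_runs !(map_cat, flatten_cat) /= !(map_cat, flatten_cat) /= !mapE.
- rewrite eqxx gtn_eqF // eqxx new_iE new_jE run_between high_strips /split_runs -/A -/B.
  by rewrite -!catA.
- by move=> r; rewrite mem_iota => /andP[jr _]; split; rewrite gtn_eqF // (ltn_trans ij').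
- move=> r; rewrite mem_iota => /andP[ir rj]; split; first by rewrite gtn_eqF.
  by rewrite ltn_eqF //; apply: leq_trans rj _; rewrite addSn subnKC ?prednK // -ltnS prednK.
- move=> r; rewrite mem_iota add1n prednK // => /andP[_ ri]; split; first by rewrite ltn_eqF.
  by rewrite ltn_eqF // (ltn_trans ri).
Qed.

Lemma run_sizeE r : 0 < r <= N -> run_size T r = size (run T r).
Proof. by move=> rN; rewrite -(size_map e) (map_entry_run TSYT rN) size_iota. Qed.

Lemma relink_dual_R :
  row_len (shape (first_runs T j)) i + j <= run_size T j + i ->
  dual_R_equiv n T (relink T i j i.+1 (run_size T j + i - j) top).
Proof.
have [/andP[j0 jN] _ _] := first_bad_runP Tbad; have /andP[i0 ij'] := ij.
rewrite (row_len_first_runs j TSYT) relink_split run_sizeE ?j0 // => cond.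
have nE : n = size (rcells sh).
  by rewrite -(perm_size (perm_run_cells TSYT)) -(size_map e) (map_entry_run_cells TSYT) size_iota.
have cells := perm_run_cells TSYT; rewrite {1}(ranking_run_cells TSYT) {1}nE.
rewrite run_cells_split in cells *.
have ctx v v' : slides reads_before v v' -> slides reads_before (A ++ v) (A ++ v').
  by move=> h; have := slides_ctx A [::] h; rewrite !cats0.
apply: slides_dual_R cells; apply: ctx.
have hl : size (high T j i) + size low = size (run T j) by rewrite [in RHS]run_high_low size_cat.
have hi := size_high_leq TSYT Tbad i.
have ri : size (first_runs_row T j i) <= size (run T i).
  by have := size_first_runs_rowS TSYT Tbad i.-1; rewrite prednK.
have sL : size L = size (run T i) + size low by rewrite relink_pool size_cat.
have ss : size (s (j.-1 - i)) = j.-1 - i by rewrite size_map size_rev size_iota.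
have strip q : size (first_runs_row T j i) <= q -> strip_sizes t (s (j.-1 - i)) q.
  rewrite /t -(first_runs_row_top TSYT Tbad); have := @strip_sizes_relink q (j.-1 - i).
  by rewrite subnKC; [apply | rewrite -ltnS prednK].
(* The inequality defining i bounds row i by the new q. It also leaves at least j-i cells of run j
   in the pool, because the higher cells of that run number at most row i; this is the room needed
   for q = |run i|. For the new q, the room follows from row i being no longer than run i. *)
apply: (slides_split_runs reads_before_trans); rewrite ?ss ?sL.
- exact: sorted_relink.
- exact: strip.
- by apply: strip; move: cond ij'; clear; lia.
- by move: cond hl hi ri ij' j0; clear; lia.
- by move: cond hl hi ri ij' j0; clear; lia.
Qed.

End Relink.

(** This is the inequality for i = j-1. It says that run j has more cells than its part in row j,
    which is the meaning of being bad. *)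
Lemma bad_run_cond n T j : SYTn n T -> first_bad_run T = Some j ->
  row_len (shape (first_runs T j)) j.-1 + j <= run_size T j + j.-1.
Proof.
move=> TSYT Tbad; have [jN _ _] := first_bad_runP Tbad.
rewrite (row_len_first_runs j TSYT) (run_sizeE TSYT jN) (first_runs_row_top TSYT Tbad).
case/andP: jN => j0 _; rewrite -[X in _ + X <= _](prednK j0) addnS -addSn leq_add2r.
have [x xj xlow] := bad_run_low TSYT Tbad.
rewrite size_filter ltn_neqAle count_size andbT -all_count; apply/allPn; exists x => //.
by rewrite /= ltn_eqF.
Qed.

Lemma slink_dual_R n T : SYTn n T -> dual_R_equiv n T (slink T).
Proof.
move=> TSYT; rewrite /slink; case Tbad: (first_bad_run T) => [j|]; last exact: rst_refl.
have j1 := first_bad_gt1 TSYT Tbad; have cond := bad_run_cond TSYT Tbad.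
have ij : 0 < j.-1 < j by move: j1; case: (j) => [|[|m]] //= _; rewrite leqnn.
have topE r : r <= j -> pred1 j r = (j.-1 < r) by move=> rj /=; move: rj j1; clear; lia.
have := relink_dual_R TSYT Tbad ij topE cond; rewrite prednK ?(ltnW j1) //.
by rewrite (_ : run_size T j + j.-1 - j = run_size T j - 1) //; move: j1; clear; lia.
Qed.

Lemma slink_star_dual_R n T : SYTn n T -> dual_R_equiv n T (slink_star T).
Proof.
move=> TSYT; rewrite /slink_star; case Tbad: (first_bad_run T) => [j|]; last exact: rst_refl.
have j1 := first_bad_gt1 TSYT Tbad; have cond := bad_run_cond TSYT Tbad.
(* Since j-1 passes the test, the minimal i is at most j-1 and runs i and j are distinct. *)
set s := filter _ _; have js : j.-1 \in s.
  by rewrite mem_filter cond mem_iota; move: j1; clear; lia.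
have ss : sorted ltn s by apply: (sorted_filter ltn_trans); apply: iota_ltn_sorted.
have is_ : head j s \in s by case: (s) js => //= a s' _; rewrite mem_head.
have ij : head j s <= j.-1.
  case: (s) js ss => //= a s'; rewrite inE (path_sortedE ltn_trans) => /orP[/eqP -> //|js /andP[/allP as_ _]].
  exact/ltnW/as_.
move: is_; rewrite mem_filter mem_iota => /andP[icond /andP[i0 _]].
apply: (relink_dual_R TSYT Tbad) icond => //; rewrite i0 /=; move: ij j1; clear; lia.
Qed.

Lemma syt_step_dual_R (k : 'I_3) n T T' : SYTn n T -> syt_step k n T T' -> dual_R_equiv n T T'.
Proof.
move=> TSYT; case: k => -[|[|[|//]]] k3 /=; rewrite /syt_step /=.
- by move=> ->; apply: slink_star_dual_R.
- by move=> ->; apply: slink_dual_R.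
by move=> h; apply: rst_step; split=> //; apply: syt_perm TSYT.
Qed.

Lemma syt_equiv_dual_R (k : 'I_3) n T T' : syt_equiv k n T T' -> dual_R_equiv n T T'.
Proof.
elim=> {T T'} [T T' [TSYT]|T|T T' _ IH|T T' T'' _ IH1 _ IH2].
- exact: syt_step_dual_R.
- exact: rst_refl.
- exact: rst_sym.
- exact: rst_trans IH1 IH2.
Qed.

(** * Lifting restricted dual equivalence *)

Lemma exchange_inv p : involutive (exchange p).
Proof.
move=> z; rewrite !exchangeE; case: (z =P p) => [->|zp]; first by rewrite gtn_eqF // eqxx.
by case: (z =P p.+1) => [->|zp1]; [rewrite eqxx | rewrite (introF eqP zp) (introF eqP zp1)].
Qed.

Lemma perm_window_filter n i w : perm_eq w (iota 1 n) -> 2 <= i <= n.-1 ->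
  perm_eq [seq z <- w | z \in window i] (window i).
Proof.
move=> pw iN; apply: uniq_perm.
- by rewrite filter_uniq // (perm_uniq pw) iota_uniq.
- by rewrite /window /= !inE; move: iN; clear; lia.
move=> z; rewrite mem_filter (perm_mem pw) mem_iota !inE; move: iN; clear; lia.
Qed.

Lemma dual_substE n i w : perm_eq w (iota 1 n) -> 2 <= i <= n.-1 ->
  dual_subst i w =1 id \/ exists p t, [/\ dual_subst i w =1 exchange p,
    p = i.-1 /\ t = i.+1 \/ p = i /\ t = i.-1
    & (index p w < index t w < index p.+1 w) || (index p.+1 w < index t w < index p w)].
Proof. by case: i => [|m] // pw iN; apply/dual_substP/(perm_window_filter pw). Qed.

Lemma dual_subst_inv n i w : perm_eq w (iota 1 n) -> 2 <= i <= n.-1 ->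
  involutive (dual_subst i w).
Proof.
move=> pw iN z; have [f|[p [t [f _ _]]]] := dual_substE pw iN; first by rewrite !f.
by rewrite !f exchange_inv.
Qed.

Lemma dual_subst_window i w z : (dual_subst i w z \in window i) = (z \in window i).
Proof.
have sw (a b : nat) : a \in window i -> b \in window i -> (swap_val a b z \in window i) = (z \in window i).
  by move=> aw bw; rewrite /swap_val /=; case: (z =P a) => [->|_]; rewrite ?aw ?bw //;
     case: (z =P b) => [->|_]; rewrite ?aw ?bw.
by rewrite /dual_subst; do 2?[case: ifP => _]; rewrite // sw // !inE eqxx ?orbT.
Qed.

Lemma perm_dual_word n i w : perm_eq w (iota 1 n) -> 2 <= i <= n.-1 ->
  perm_eq (dual_word i w) (iota 1 n).
Proof.
move=> pw iN; have finv := dual_subst_inv pw iN; apply: uniq_perm; rewrite ?iota_uniq //.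
  by rewrite map_inj_uniq ?(perm_uniq pw) ?iota_uniq //; apply: inv_inj.
have inn z : z \in w -> dual_subst i w z \in w.
  move=> zw; case: (boolP (z \in window i)) => [zin|/dual_subst_out -> //].
  have := dual_subst_window i w z; rewrite zin (perm_mem pw) mem_iota !inE; move: iN; clear; lia.
move=> z; rewrite -(perm_mem pw); apply/mapP/idP => [[y yw ->]|zw]; first exact: inn.
by exists (dual_subst i w z); rewrite ?finv ?inn.
Qed.

(** The four nontrivial orders of the window form two pairs; in each pair one exchange carries
    either order to the other and is the substitution prescribed for both. *)
Lemma dual_subst_dual_word n i w : perm_eq w (iota 1 n) -> 2 <= i <= n.-1 ->
  dual_subst i (dual_word i w) =1 dual_subst i w.
Proof.
case: i => [|m] // pw iN z; have pf := perm_window_filter pw iN.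
rewrite dual_subst_filter filter_map.
have -> : [seq x <- w | preim (dual_subst m.+1 w) (fun z => z \in window m.+1) x] =
          [seq x <- w | x \in window m.+1].
  by apply: eq_filter => x /=; rewrite dual_subst_window.
rewrite [in RHS]dual_subst_filter [dual_subst m.+1 w in X in map X _]lock.
have -> : map (locked (dual_subst m.+1 w)) [seq x <- w | x \in window m.+1] =
          map (dual_subst m.+1 [seq x <- w | x \in window m.+1]) [seq x <- w | x \in window m.+1].
  by rewrite -lock -dual_subst_filter.
have [e1 e2 e3 e4 [e5 e6]] := dual_subst_windowE m.
have neqE k : ((k == k.+1) = false) * ((k == k.+2) = false) * ((k.+1 == k) = false) *
    ((k.+2 == k) = false) * ((k == k) = true).
  by do !split; clear; lia.
have := perm_window pf; rewrite !inE => /or4P[|||/or3P[]] /eqP ->.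
- by rewrite (eq_map e1) map_id.
- by rewrite (eq_map e2) map_id.
- by rewrite (eq_map e3) /= !exchangeE !neqE e4 e3.
- by rewrite (eq_map e4) /= !exchangeE !neqE e4 e3.
- by rewrite (eq_map e5) /= !exchangeE !neqE e6 e5.
- by rewrite (eq_map e6) /= !exchangeE !neqE e6 e5.
Qed.

Lemma row_word_map (f : nat -> nat) T : row_word (map (map f) T) = map f (row_word T).
Proof. by rewrite /row_word -map_rev map_flatten. Qed.

Lemma dual_tab_inv n i T : perm_eq (row_word T) (iota 1 n) -> 2 <= i <= n.-1 ->
  dual_tab row_word i (dual_tab row_word i T) = T.
Proof.
move=> pT iN; rewrite {1}/dual_tab row_word_map -map_comp -[RHS]map_id; apply: eq_map => r /=.
rewrite -map_comp -[RHS]map_id; apply: eq_map => z /=.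
by rewrite (dual_subst_dual_word pT iN) (dual_subst_inv pT iN).
Qed.

(** The test that makes d_i^R trivial is symmetric in T and d_i(T). *)
Lemma dual_R_inv n i T : perm_eq (row_word T) (iota 1 n) -> 2 <= i <= n - 2 ->
  dual_R i (dual_R i T) = T.
Proof.
move=> pT iN; have iN' : 2 <= i <= n.-1 by move: iN; clear; lia.
have dd := dual_tab_inv pT iN'.
rewrite {2}/dual_R; case: ifP => c; rewrite /dual_R ?c //.
by rewrite dd andbC c.
Qed.

Lemma insertion_dual_R n i w : perm_eq w (iota 1 n) -> 2 <= i <= n - 2 ->
  dual_R i (insertion w) =
  insertion (if (i.+1 \in inv_descents w) && (i.+1 \in inv_descents (dual_word i w)) then w else dual_word i w).
Proof.
move=> pw iN; have iN' : 2 <= i <= n.-1 by move: iN; clear; lia.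
have uw : uniq w by rewrite (perm_uniq pw) iota_uniq.
have ud : uniq (dual_word i w) by rewrite (perm_uniq (perm_dual_word pw iN')) iota_uniq.
have eI : insertion (dual_word i w) = dual_tab row_word i (insertion w).
  apply: insertion_dual_word => //; last by case/andP: iN => /ltnW.
  by move=> z; rewrite (perm_mem pw) mem_iota !inE; move: iN; clear; lia.
rewrite /dual_R -eI /ID !inv_descents_insertion //; by case: ifP.
Qed.

(* [F] is SRT(lambda) or SRCT(alpha), and [E] the quasi-dual equivalence or the
   trivial relation. *)
Section Transport.

Variables (n : nat) (F : tableau -> Prop) (word : tableau -> seq nat) (E : tableau -> tableau -> Prop).
Hypothesis word_perm : forall S, F S -> perm_eq (word S) (iota 1 n).
Hypothesis E_refl : forall S, E S S.
Hypothesis E_trans : forall S1 S2 S3, E S1 S2 -> E S2 S3 -> E S1 S3.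
Hypothesis word_move : forall S i, F S -> 2 <= i <= n - 2 ->
  (i.+1 \in inv_descents (word S)) && (i.+1 \in inv_descents (dual_word i (word S))) \/
  exists S', [/\ F S', E S S' & word S' = dual_word i (word S)].

Lemma dual_R_lift S i : F S -> 2 <= i <= n - 2 ->
  exists S', [/\ F S', E S S' & insertion (word S') = dual_R i (insertion (word S))].
Proof.
move=> FS iN; rewrite (insertion_dual_R (word_perm FS) iN).
case: ifP => c; first by exists S.
have [|[S' [FS' ES' eS']]] := word_move FS iN; first by rewrite c.
by exists S'; rewrite -eS'.
Qed.

(** Both directions are proved at once so that the symmetry rule goes through the induction; for one
    generator, the backward direction is [dual_R_inv]. *)
Lemma dual_R_equiv_lift T T' : dual_R_equiv n T T' ->
  (forall S, F S -> insertion (word S) = T ->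
     exists S', [/\ F S', E S S' & insertion (word S') = T']) /\
  (forall S, F S -> insertion (word S) = T' ->
     exists S', [/\ F S', E S S' & insertion (word S') = T]).
Proof.
elim=> {T T'} [T T' [pT [i iN ->]]|T|T T' _ [IH1 IH2]|T T' T'' _ [IH1 IH2] _ [IH3 IH4]].
- split=> S FS eS; have [S' [FS' ES' eS']] := dual_R_lift FS iN; exists S'; split=> //.
    by rewrite eS' eS.
  by rewrite eS' eS (dual_R_inv pT).
- by split=> S FS eS; exists S.
- by split.
split=> S FS eS.
  have [S1 [F1 E1 e1]] := IH1 S FS eS; have [S2 [F2 E2 e2]] := IH3 S1 F1 e1.
  by exists S2; split=> //; apply: E_trans E2.
have [S1 [F1 E1 e1]] := IH4 S FS eS; have [S2 [F2 E2 e2]] := IH2 S1 F1 e1.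
by exists S2; split=> //; apply: E_trans E2.
Qed.

End Transport.

(** * Column words *)

Definition value_column (T : tableau) (v : nat) : nat :=
  (nth (0, 0) (rcells (shape T)) (index v (row_word T))).2.

(** Sorting changes nothing for a reverse tableau. For a composition tableau it forgets the rows,
    and thereby gives both families the same kind of word. *)
Definition desc_cols (T : tableau) : seq (seq nat) :=
  [seq sort geq (col_up T c) | c <- iota 0 (ncols T)].

Definition column_word (T : tableau) : seq nat := cols_word (desc_cols T).

(** The order of values in [column_word], expressed through their columns k alone: right columns
    first, larger values first inside a column. *)
Definition column_before (k : nat -> nat) (u v : nat) : bool :=
  (k v < k u) || (k u == k v) && (v < u).

Lemma column_before_trans k : transitive (column_before k).
Proof.
move=> v u z; rewrite /column_before => /orP[uv|/andP[/eqP uv vu]].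
  case/orP=> [vz|/andP[/eqP vz _]]; first by rewrite (ltn_trans vz uv).
  by rewrite -vz uv.
case/orP=> [vz|/andP[/eqP vz zv]]; first by rewrite uv vz.
by rewrite uv vz eqxx (ltn_trans zv vu) orbT.
Qed.

Lemma column_before_irr k : irreflexive (column_before k).
Proof. by move=> u; rewrite /column_before !ltnn andbF. Qed.

Lemma geq_trans : transitive geq. Proof. exact: rev_trans leq_trans. Qed.

Lemma geq_total : total geq. Proof. by move=> a b; apply: leq_total. Qed.

Lemma lt_ncols T x : x \in rcells (shape T) -> x.2 < ncols T.
Proof.
rewrite mem_rcells /ncols /row_len; move=> h; apply: leq_trans h _.
by elim: (shape T) x.1 => [|a s IH] [|r] //=; rewrite leq_max ?leqnn ?IH ?orbT.
Qed.

Lemma mem_col_upE T c v : reflect (exists2 x, x \in rcells (shape T) & x.2 = c /\ cell_entry T x = v)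
  (v \in col_up T c).
Proof.
apply: (iffP mapP) => [[r]|[[r c'] xs [/= <- <-]]].
  by rewrite mem_filter => /andP[cr _] ->; exists (r, c); rewrite ?mem_rcells.
exists r => //; rewrite mem_filter mem_iota /=; move: xs; rewrite mem_rcells /= => cr; rewrite cr /=.
by move: cr; rewrite /row_len; case: (ltnP r (size T)) => // h; rewrite nth_default // size_map.
Qed.

Section ColumnWord.

Variables (n : nat) (T : tableau).
Hypothesis Tperm : perm_eq (row_word T) (iota 1 n).
Local Notation e := (cell_entry T).
Local Notation sh := (shape T).

Lemma value_column_entry x : x \in rcells sh -> value_column T (e x) = x.2.
Proof.
move=> xs; rewrite /value_column row_word_cells (index_map_in (entry_inj Tperm) xs).
by rewrite nth_index.
Qed.

Lemma mem_col_up c v : (v \in col_up T c) = (0 < v <= n) && (value_column T v == c).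
Proof.
apply/mem_col_upE/andP => [[x xs [<- <-]]|[/(cell_of Tperm)[x xs <-] /eqP xc]].
  by rewrite (value_column_entry xs) (entry_bounds Tperm xs).
by exists x => //; rewrite -xc value_column_entry.
Qed.

Lemma uniq_col_up c : uniq (col_up T c).
Proof.
rewrite map_inj_in_uniq ?filter_uniq ?iota_uniq // => r r'.
rewrite !mem_filter => /andP[cr _] /andP[cr' _] /(@entry_inj _ _ Tperm (r, c) (r', c)).
by rewrite !mem_rcells => /(_ cr cr') [].
Qed.

Lemma sorted_desc_col c : sorted gtn (sort geq (col_up T c)).
Proof. by rewrite gtn_sorted_uniq_geq sort_uniq uniq_col_up sort_sorted //; exact: geq_total. Qed.

Lemma mem_column_word v : (v \in column_word T) = (0 < v <= n).
Proof.
apply/flattenP/idP => [[s]|vn].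
  by rewrite mem_rev => /mapP[c _ ->]; rewrite mem_sort mem_col_up => /andP[].
exists (sort geq (col_up T (value_column T v))); last by rewrite mem_sort mem_col_up vn eqxx.
rewrite mem_rev; apply: map_f; rewrite mem_iota /=.
by have [x xs <-] := cell_of Tperm vn; rewrite value_column_entry ?lt_ncols.
Qed.

Lemma sorted_column_word : sorted (column_before (value_column T)) (column_word T).
Proof.
rewrite /column_word /cols_word /desc_cols -map_rev.
have : sorted gtn (rev (iota 0 (ncols T))) by rewrite rev_sorted; apply: iota_ltn_sorted.
elim: (rev _) => //= c cs IHcs sc; have trc := @column_before_trans (value_column T).
rewrite (sorted_pairwise trc) pairwise_cat -!(sorted_pairwise trc) IHcs ?(path_sorted sc) // andbT.
apply/andP; split.
  apply/allrelP=> u v; rewrite mem_sort mem_col_up => /andP[_ /eqP uc] /flattenP[s /mapP[c' c's ->]].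
  rewrite mem_sort mem_col_up => /andP[_ /eqP vc]; rewrite /column_before uc vc.
  by move: sc; rewrite (path_sortedE (rev_trans ltn_trans)) => /andP[/allP /(_ c' c's) /= ->].
apply: (sub_in_sorted (P := mem (col_up T c))) (sorted_desc_col c); last first.
  by apply/allP=> v; rewrite mem_sort.
move=> u v; rewrite /= !mem_col_up => /andP[_ /eqP uc] /andP[_ /eqP vc] uv.
by rewrite /column_before uc vc eqxx uv orbT.
Qed.

Lemma uniq_column_word : uniq (column_word T).
Proof.
apply: (sorted_uniq (@column_before_trans (value_column T)) (@column_before_irr _)).
exact: sorted_column_word.
Qed.

Lemma perm_column_word : perm_eq (column_word T) (iota 1 n).
Proof.
apply: uniq_perm; rewrite ?uniq_column_word ?iota_uniq // => v.
by rewrite mem_column_word mem_iota add1n ltnS.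
Qed.

Lemma column_word_unique w : perm_eq w (iota 1 n) ->
  sorted (column_before (value_column T)) w -> column_word T = w.
Proof.
move=> pw sw; apply: (irr_sorted_eq (@column_before_trans (value_column T)) (@column_before_irr _)) => //.
  exact: sorted_column_word.
by move=> v; rewrite (perm_mem pw) mem_iota add1n ltnS mem_column_word.
Qed.

Lemma index_column_word u v : 0 < u <= n -> 0 < v <= n ->
  (index u (column_word T) < index v (column_word T)) = column_before (value_column T) u v.
Proof.
move=> un vn; apply: (sorted_index_lt (@column_before_trans _) (@column_before_irr _) sorted_column_word);
by rewrite mem_column_word.
Qed.

Lemma column_witness p t : 0 < p -> p < n -> 0 < t <= n ->
  (index p (column_word T) < index t (column_word T) < index p.+1 (column_word T)) ||
  (index p.+1 (column_word T) < index t (column_word T) < index p (column_word T)) ->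
  let k := value_column T in
  (column_before k p t && column_before k t p.+1) || (column_before k p.+1 t && column_before k t p).
Proof. by move=> p0 pn tn; rewrite !index_column_word ?p0 ?(ltnW pn). Qed.

(** In a common column p+1 and p would be adjacent in the word, leaving no place for t. *)
Lemma witness_columns p t : 0 < p -> p < n -> 0 < t <= n ->
  (index p (column_word T) < index t (column_word T) < index p.+1 (column_word T)) ||
  (index p.+1 (column_word T) < index t (column_word T) < index p (column_word T)) ->
  value_column T p <> value_column T p.+1.
Proof.
move=> p0 pn tn /(column_witness p0 pn tn) /=; rewrite /column_before => h ep; move: h; rewrite ep.
by move: (value_column T p.+1) (value_column T t) => a b; clear; lia.
Qed.

(** Only the column of each value has to move as d_i prescribes, so T' may rearrange entries within
    a column. Inside a column the order survives the exchange because p and p+1 are in different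
    columns. *)
Lemma column_word_dual i T' : 2 <= i <= n.-1 -> perm_eq (row_word T') (iota 1 n) ->
  (forall v, 0 < v <= n -> value_column T' (dual_subst i (column_word T) v) = value_column T v) -> 
  (forall w, perm_eq w (iota 1 n) -> sorted (column_before (value_column T')) w -> column_word T' = w) ->
  column_word T' = dual_word i (column_word T).
Proof.
move=> iN pT' colE; apply; first exact: perm_dual_word perm_column_word iN.
rewrite sorted_map; apply: (sub_in_sorted (P := mem (column_word T))) sorted_column_word; last exact/allP.
move=> u v; rewrite /= !mem_column_word => un vn; rewrite /column_before !colE //.
case/orP=> [-> //|/andP[/eqP uv vu]]; rewrite uv eqxx ltnn /=.
have [f|[p [t [f pt tb]]]] := dual_substE perm_column_word iN; first by rewrite !f.
rewrite !f; apply: exchange_lt => // -[vp up].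
have tn : 0 < t <= n by move: pt iN; clear; lia.
have [p0 pn] : 0 < p /\ p < n by move: vn un; rewrite vp up; clear; lia.
by apply: (witness_columns p0 pn tn tb); rewrite -up -vp uv.
Qed.

Lemma column0_descents i : 2 <= i <= n - 2 -> value_column T i.+1 = 0 ->
  dual_subst i (column_word T) i.+1 = i.+1 ->
  (i.+1 \in inv_descents (column_word T)) && (i.+1 \in inv_descents (dual_word i (column_word T))).
Proof.
move=> iN c0 fi; have iN' : 2 <= i <= n.-1 by move: iN; clear; lia.
set w := column_word T; set f := dual_subst i w.
have finv : involutive f by apply: dual_subst_inv perm_column_word iN'.
have fi2 : f i.+2 = i.+2.
  by apply: dual_subst_out; rewrite !inE; move: iN; clear; lia.
have lt : index i.+2 w < index i.+1 w.
  rewrite index_column_word; try by move: iN; clear; lia.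
  rewrite /column_before c0 ltnSn andbT eq_sym; case: (value_column _ _) => //.
have lt' : index i.+2 (dual_word i w) < index i.+1 (dual_word i w).
  have := lt; rewrite -(index_map (inv_inj finv) w i.+2) -(index_map (inv_inj finv) w i.+1).
  by rewrite fi2 [f i.+1]fi.
rewrite !mem_filter lt lt' /=.
rewrite !mem_iota size_map (perm_size perm_column_word) size_iota; move: iN; clear; lia.
Qed.

(** An entry at least t has its left neighbour at least t as well; counting rows turns this into the
    inequality between columns. *)
Lemma dominated_desc_cols : all (sorted gtn) T -> dominated_cols (desc_cols T).
Proof.
move=> /allP sT; rewrite /desc_cols; elim: (ncols T) 0 => //= N IHN c; split=> // t.
case: N {IHN} => //= N; rewrite !(permP (permEl (perm_sort _ _))) /col_up !count_map !count_filter.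
apply: sub_count => r /= /andP[te cr].
have cr' : c < row_len sh r by apply: ltnW.
rewrite cr' andbT (leq_trans te) // ltnW //.
have rT : r < size T.
  by move: cr; rewrite /row_len; case: (ltnP r (size T)) => // h; rewrite nth_default // size_map.
rewrite row_lenE in cr cr'.
exact: (sorted_ltn_nth (rev_trans ltn_trans) 0 (sT _ (mem_nth [::] rT)) c c.+1 cr' cr (ltnSn c)).
Qed.

End ColumnWord.

Lemma insertion_column_word_inj n T1 T2 :
  perm_eq (row_word T1) (iota 1 n) -> perm_eq (row_word T2) (iota 1 n) ->
  all (sorted gtn) T1 -> all (sorted gtn) T2 -> shape T1 = shape T2 ->
  insertion (column_word T1) = insertion (column_word T2) ->
  forall c, sort geq (col_up T1 c) = sort geq (col_up T2 c).
Proof.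
move=> p1 p2 s1 s2 sh12 eI c.
have sz : size T1 = size T2 by rewrite -(size_map size T1) -(size_map size T2) -/(shape T1) sh12.
have nc : ncols T1 = ncols T2 by rewrite /ncols sh12.
have eC : desc_cols T1 = desc_cols T2.
  apply: insertion_cols_inj eI.
  - rewrite /shape -!map_comp nc; apply: eq_map => c' /=.
    by rewrite !size_sort !size_map sz sh12.
  - by apply/allP=> _ /mapP[c' _ ->]; apply: sorted_desc_col p1 _.
  - by apply/allP=> _ /mapP[c' _ ->]; apply: sorted_desc_col p2 _.
  - exact: dominated_desc_cols.
  - exact: dominated_desc_cols.
  - exact: uniq_column_word p1.
  - exact: uniq_column_word p2.
have [cN|cN] := ltnP c (ncols T1).
  have := congr1 (fun s => nth [::] s c) eC.
  by rewrite /desc_cols !(nth_map 0) ?size_iota ?nth_iota -?nc.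
suff nil T : ncols T <= c -> col_up T c = [::] by rewrite !nil // -nc.
move=> cT; apply/eqP; rewrite -size_eq0 size_map size_filter -leqn0 leqNgt -has_count.
apply/hasPn=> r _; apply/negP=> cr; have /= := @lt_ncols T (r, c); rewrite mem_rcells => /(_ cr).
by rewrite ltnNge cT.
Qed.

(** * Reverse tableaux *)

Lemma entry_map (f : nat -> nat) T r c : c < row_len (shape T) r ->
  entry (map (map f) T) r c = f (entry T r c).
Proof.
move=> cr; have rT : r < size T.
  by move: cr; rewrite /row_len; case: (ltnP r (size T)) => // h; rewrite nth_default // size_map.
by rewrite /entry (nth_map [::]) // (nth_map 0) // -row_lenE.
Qed.

Lemma shape_map (f : nat -> nat) T : shape (map (map f) T) = shape T.
Proof. by rewrite /shape -map_comp; apply: eq_map => r /=; rewrite size_map. Qed.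

Lemma col_up_map (f : nat -> nat) T c : col_up (map (map f) T) c = map f (col_up T c).
Proof.
rewrite /col_up shape_map size_map -map_comp; apply/eq_in_map => r.
by rewrite mem_filter => /andP[cr _]; apply: entry_map.
Qed.

Lemma ncols_map (f : nat -> nat) T : ncols (map (map f) T) = ncols T.
Proof. by rewrite /ncols shape_map. Qed.

Section ReverseTableau.

Variables (lam : seq nat) (T : tableau).
Hypothesis lamP : is_part lam.
Hypothesis TSRT : T \in SRT lam.
Local Notation n := (sumn lam).
Local Notation e := (cell_entry T).
Local Notation sh := (shape T).

Lemma srt_shape : sh = lam.
Proof. by move: TSRT; rewrite mem_filter mem_fillings => /andP[_ /andP[/eqP]]. Qed.

Lemma srt_flatten : perm_eq (flatten T) (iota 1 n).
Proof. by move: TSRT; rewrite mem_filter mem_fillings => /andP[_ /andP[_]]. Qed.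

Lemma srt_perm : perm_eq (row_word T) (iota 1 n).
Proof. exact: perm_trans (perm_row_word T) srt_flatten. Qed.

Lemma srt_rows : all (sorted gtn) T.
Proof. by move: TSRT; rewrite mem_filter => /andP[/andP[]]. Qed.

Lemma col_up_out (T1 : tableau) c : ncols T1 <= c -> col_up T1 c = [::].
Proof.
move=> cT; apply/eqP; rewrite -size_eq0 size_map size_filter -leqn0 leqNgt -has_count.
apply/hasPn=> r _; apply/negP=> cr; have /= := @lt_ncols T1 (r, c); rewrite mem_rcells => /(_ cr).
by rewrite ltnNge cT.
Qed.

Lemma srt_cols c : sorted gtn (col_up T c).
Proof.
have [cT|cT] := ltnP c (ncols T); last by rewrite col_up_out.
move: TSRT; rewrite mem_filter => /andP[/andP[_ /allP H] _].
by apply: H; rewrite mem_iota.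
Qed.

Lemma srt_column_word : column_word T = col_word T.
Proof.
rewrite /column_word /cols_word /desc_cols /col_word -map_rev; congr flatten.
apply: eq_map => c; apply: (sorted_sort geq_trans).
by have := srt_cols c; rewrite gtn_sorted_uniq_geq => /andP[].
Qed.

Lemma srt_cells x y : x \in rcells sh -> y \in rcells sh -> x.1 <= y.1 -> x.2 <= y.2 -> e y <= e x.
Proof.
case: x y => [r c] [r' c'] xs ys /= rr cc.
have mids : (r, c') \in rcells sh.
  rewrite mem_rcells /=; move: ys; rewrite mem_rcells /= => c's; apply: leq_trans c's _.
  move: rr; rewrite leq_eqVlt => /orP[/eqP -> //|rr].
  have [r's|h] := ltnP r' (size sh); last by rewrite /row_len nth_default.
  move: (lamP); rewrite -srt_shape => /andP[_ sg].
  by apply: (sorted_ltn_nth (rev_trans leq_trans) 0 sg r r') => //; rewrite inE (ltn_trans rr).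
apply: (@leq_trans (e (r, c'))).
  move: rr; rewrite leq_eqVlt => /orP[/eqP -> //|rr].
  apply: ltnW; apply: (sorted_col_upP T c' (rev_trans ltn_trans) (srt_cols c')) => //.
    by rewrite -row_lenE; move: mids; rewrite mem_rcells.
  by rewrite -row_lenE; move: ys; rewrite mem_rcells.
move: cc; rewrite leq_eqVlt => /orP[/eqP -> //|cc].
have rT : r < size T.
  by move: mids; rewrite mem_rcells /= /row_len; case: (ltnP r (size T)) => // h; rewrite nth_default // size_map.
move: xs mids; rewrite !mem_rcells /= !row_lenE => cr c'r.
exact: ltnW (sorted_ltn_nth (rev_trans ltn_trans) 0 (allP srt_rows _ (mem_nth [::] rT)) c c' cr c'r cc).
Qed.

Lemma srt_mid x y : x \in rcells sh -> y \in rcells sh -> x.1 <= y.1 -> (x.1, y.2) \in rcells sh.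
Proof.
case: x y => [r c] [r' c'] xs ys /= rr.
rewrite mem_rcells /=; move: ys; rewrite mem_rcells /= => c's; apply: leq_trans c's _.
move: rr; rewrite leq_eqVlt => /orP[/eqP -> //|rr].
have [r's|h] := ltnP r' (size sh); last by rewrite /row_len nth_default.
move: (lamP); rewrite -srt_shape => /andP[_ sg].
by apply: (sorted_ltn_nth (rev_trans leq_trans) 0 sg r r') => //; rewrite inE (ltn_trans rr).
Qed.

(** If p+1 and p share a row, the column of t places it between them, in a lower row if t = p+2 and
    in a higher one if t = p-1. The corner of t's row below p, respectively above p+1, is squeezed
    between values already placed in other cells, so no value is left for it. *)
Lemma srt_not_same_row i p t x y : 2 <= i <= n.-1 ->
  p = i.-1 /\ t = i.+1 \/ p = i /\ t = i.-1 ->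
  (index p (column_word T) < index t (column_word T) < index p.+1 (column_word T)) ||
  (index p.+1 (column_word T) < index t (column_word T) < index p (column_word T)) ->
  x \in rcells sh -> y \in rcells sh -> e x = p.+1 -> e y = p -> x.1 = y.1 -> x.2 < y.2 -> False.
Proof.
move=> iN pt tb xs ys ex ey xy1 xy2.
have [p0 pn tn] : [/\ 0 < p, p < n & 0 < t <= n] by split; move: pt iN; clear; lia.
have [z zs ez] := cell_of srt_perm tn.
have /= := column_witness srt_perm p0 pn tn tb.
have cx : value_column T p.+1 = x.2 by rewrite -ex (value_column_entry srt_perm).
have cy : value_column T p = y.2 by rewrite -ey (value_column_entry srt_perm).
have cz : value_column T t = z.2 by rewrite -ez (value_column_entry srt_perm).
rewrite /column_before cx cy cz => h.
case: pt => -[pi ti].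
  have zp : e z = p.+2 by move: pi ti ez iN; clear; lia.
  have [cz1 cz2] : x.2 <= z.2 /\ z.2 < y.2.
    move: h xy2 zp; rewrite ez; move: (x.2) (y.2) (z.2) => a b c; clear; lia.
  have zx : z.1 < x.1.
    rewrite ltnNge; apply/negP=> xz; have := srt_cells xs zs xz cz1; rewrite ex zp; clear; lia.
  have us := srt_mid zs ys (leq_trans (ltnW zx) (eq_leq xy1)).
  have h1 := srt_cells us ys (leq_trans (ltnW zx) (eq_leq xy1)) (leqnn _).
  have h2 := srt_cells zs us (leqnn _) (ltnW cz2).
  have nu v : v \in rcells sh -> e (z.1, y.2) = e v -> (z.1 = v.1) /\ y.2 = v.2.
    by move=> vs /(entry_inj srt_perm us vs) <-.
  have n1 : e (z.1, y.2) <> p.+1.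
    by rewrite -ex => /(nu _ xs)[zx1]; move: zx; rewrite zx1 ltnn.
  have n2 : e (z.1, y.2) <> p.
    by rewrite -ey => /(nu _ ys)[zx1]; move: zx; rewrite zx1 xy1 ltnn.
  have n3 : e (z.1, y.2) <> p.+2.
    by rewrite -zp => /(nu _ zs)[_ zy]; move: cz2; rewrite zy ltnn.
  by move: h1 h2 n1 n2 n3; rewrite ey zp; clear; lia.
have zp : p = (e z).+1 by move: pi ti ez iN; clear; lia.
have [cz1 cz2] : x.2 < z.2 /\ z.2 <= y.2.
  move: h xy2 zp; rewrite ez; move: (x.2) (y.2) (z.2) => a b c; clear; lia.
have yz : y.1 < z.1.
  rewrite ltnNge; apply/negP=> zy; have := srt_cells zs ys zy cz2; rewrite ey zp; clear; lia.
have xz : x.1 <= z.1 by rewrite xy1 ltnW.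
have us : (z.1, x.2) \in rcells sh.
  by move: zs; rewrite !mem_rcells /=; apply: leq_trans; apply: ltnW.
have h1 := srt_cells xs us xz (leqnn _).
have h2 := srt_cells us zs (leqnn _) (ltnW cz1).
have nu v : v \in rcells sh -> e (z.1, x.2) = e v -> (z.1 = v.1) /\ x.2 = v.2.
  by move=> vs /(entry_inj srt_perm us vs) <-.
have n1 : e (z.1, x.2) <> p.+1.
  by rewrite -ex => /(nu _ xs)[zx1]; move: yz; rewrite zx1 xy1 ltnn.
have n2 : e (z.1, x.2) <> p.
  by rewrite -ey => /(nu _ ys)[zx1]; move: yz; rewrite zx1 ltnn.
have n3 : e (z.1, x.2) <> e z.
  by move=> /(nu _ zs)[_ zx]; move: cz1; rewrite zx ltnn.
by move: h1 h2 n1 n2 n3; rewrite ex; move: zp; clear; lia.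
Qed.

Lemma srt_dual i : 2 <= i <= n.-1 -> dual_tab col_word i T \in SRT lam /\
  col_word (dual_tab col_word i T) = dual_word i (col_word T).
Proof.
move=> iN; set f := dual_subst i (col_word T); set T' := dual_tab col_word i T.
have pw := perm_column_word srt_perm.
have fE : f =1 id \/ exists p t, [/\ f =1 exchange p, p = i.-1 /\ t = i.+1 \/ p = i /\ t = i.-1
    & (index p (column_word T) < index t (column_word T) < index p.+1 (column_word T)) ||
      (index p.+1 (column_word T) < index t (column_word T) < index p (column_word T))].
  by rewrite /f -srt_column_word; apply: dual_substE pw iN.
have flt u v : u < v -> (forall p t, f =1 exchange p -> p = i.-1 /\ t = i.+1 \/ p = i /\ t = i.-1 ->
    (index p (column_word T) < index t (column_word T) < index p.+1 (column_word T)) ||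
    (index p.+1 (column_word T) < index t (column_word T) < index p (column_word T)) ->
    u = p -> v = p.+1 -> False) -> f u < f v.
  move=> uv H; case: fE => [fid|[p [t [fe pt tb]]]]; first by rewrite !fid.
  by rewrite !fe; apply: exchange_lt => // -[up vp]; apply: (H p t fe pt tb up vp).
have cols c : sorted gtn (col_up T' c).
  rewrite col_up_map sorted_map -/f; apply: (sub_in_sorted (P := mem (col_up T c))) (srt_cols c); last exact/allP.
  move=> u v /mem_col_upE[x xs [xc ex]] /mem_col_upE[y ys [yc ey]] /= vu; apply: flt => // p t fe pt tb vp up.
  have [p0 pn tn] : [/\ 0 < p, p < n & 0 < t <= n] by split; move: pt iN; clear; lia.
  apply: (witness_columns srt_perm p0 pn tn tb).
  by rewrite -up -vp -ex -ey !(value_column_entry srt_perm) // xc yc.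
have rows : all (sorted gtn) T'.
  rewrite all_map; apply/(all_nthP [::]) => r rT /=; rewrite sorted_map -/f.
  have sr := allP srt_rows _ (mem_nth [::] rT).
  apply: (sub_in_sorted (P := mem (nth [::] T r))) sr; last exact/allP.
  move=> u v /(nthP 0)[c cr eu] /(nthP 0)[c' c'r ev] /= vu; apply: flt => // p t fe pt tb vp up.
  have cc' : c < c'.
    rewrite ltnNge leq_eqVlt; apply/negP=> /orP[/eqP cc|cc]; first by rewrite -eu -ev cc /gtn ltnn in vu.
    have /= := sorted_ltn_nth (rev_trans ltn_trans) 0 (allP srt_rows _ (mem_nth [::] rT)) c' c c'r cr cc.
    by rewrite eu ev => /(ltn_trans vu); rewrite ltnn.
  apply: (@srt_not_same_row i p t (r, c) (r, c')) => //; rewrite ?mem_rcells ?row_lenE //.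
    by rewrite -up -eu.
  by rewrite -vp -ev.
have wE : col_word T' = dual_word i (col_word T).
  rewrite {1}/col_word ncols_map /dual_word /col_word map_flatten -map_comp.
  by congr flatten; apply: eq_map => c /=; rewrite col_up_map.
split=> //; rewrite mem_filter rows mem_fillings shape_map srt_shape eqxx /=; apply/andP; split.
  exact/allP.
have -> : flatten T' = map f (flatten T) by rewrite map_flatten.
apply: perm_trans (perm_dual_word pw iN); rewrite /dual_word srt_column_word -/f perm_map //.
by rewrite (perm_trans srt_flatten) // perm_sym -srt_column_word.
Qed.

Lemma srt_excluded i : 2 <= i <= n - 2 ->
  (count (mem (window i)) (col_up T 0) == 2) && (count (mem (window i)) (col_up T 1) == 1) ->
  (i.+1 \in inv_descents (column_word T)) && (i.+1 \in inv_descents (dual_word i (column_word T))) \/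
  dual_word i (column_word T) = column_word T.
Proof.
move=> iN; have iN' : 2 <= i <= n.-1 by move: iN; clear; lia.
have cnt c : count (mem (window i)) (col_up T c) =
    (value_column T i.-1 == c) + (value_column T i == c) + (value_column T i.+1 == c).
  have uw : uniq (window i) by rewrite /= !inE; move: iN; clear; lia.
  have -> : count (mem (window i)) (col_up T c) = count (mem (col_up T c)) (window i).
    rewrite -!size_filter; apply: perm_size; apply: uniq_perm; rewrite ?filter_uniq ?(uniq_col_up srt_perm) //.
    by move=> v; rewrite !mem_filter andbC.
  rewrite /= !(mem_col_up srt_perm) addn0 addnA; move: iN; clear.
  move: (value_column T _ == c) (value_column T i == c) (value_column T i.+1 == c) => a b d.
  by case: i => [|[|i]] // iN; congr (nat_of_bool _ + nat_of_bool _ + nat_of_bool _); move: iN; clear; lia.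
rewrite !cnt => excl.
have [fid|[p [t [fe pt tb]]]] := dual_substE (perm_column_word srt_perm) iN'.
  by right; rewrite /dual_word (eq_map fid) map_id.
left; have [p0 pn tn] : [/\ 0 < p, p < n & 0 < t <= n] by split; move: pt iN; clear; lia.
have := column_witness srt_perm p0 pn tn tb; rewrite /column_before /= => h.
(* Now p and p+1 are in different columns and t shares the first column with one of them. Being read
   between the two, it comes first in that column, so it is the larger: t = i+1 and p = i-1. *)
have [c0 pi] : value_column T i.+1 = 0 /\ p = i.-1.
  case: pt h excl => -[-> ->]; rewrite ?prednK; try (by case/andP: iN; case: (i)).
    move: (value_column T i.-1) (value_column T i) (value_column T i.+1) => a b c; clear; lia.
  move: (value_column T i.-1) (value_column T i) (value_column T i.+1) => a b c; clear; lia.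
apply: (column0_descents srt_perm iN c0); rewrite fe exchangeE pi.
by move: iN; clear; case: i => [|i] //= _; rewrite !gtn_eqF // ltnW.
Qed.

End ReverseTableau.

Lemma srt_move lam S i : is_part lam -> S \in SRT lam -> 2 <= i <= sumn lam - 2 ->
  (i.+1 \in inv_descents (column_word S)) && (i.+1 \in inv_descents (dual_word i (column_word S))) \/
  exists S', [/\ S' \in SRT lam, quasi_dual_equiv lam S S' & column_word S' = dual_word i (column_word S)].
Proof.
move=> lamP SS iN; have iN' : 2 <= i <= (sumn lam).-1 by move: iN; clear; lia.
case excl: ((count (mem (window i)) (col_up S 0) == 2) && (count (mem (window i)) (col_up S 1) == 1)).
  have [|e] := srt_excluded SS iN excl; [by left | right].
  by exists S; split=> //; apply: rst_refl.
right; have [S'S wE] := srt_dual lamP SS iN'.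
exists (dual_tab col_word i S); rewrite (srt_column_word S'S) (srt_column_word SS); split=> //.
apply: rst_step; split=> //; exists i => //.
by rewrite /quasi_dual -[[:: i.-1; i; i.+1]]/(window i) excl.
Qed.

Lemma srt_insertion_inj lam S1 S2 : is_part lam -> S1 \in SRT lam -> S2 \in SRT lam ->
  insertion (column_word S1) = insertion (column_word S2) -> S1 = S2.
Proof.
move=> lamP S1S S2S eI; have sh12 : shape S1 = shape S2 by rewrite (srt_shape S1S) (srt_shape S2S).
have eC := insertion_column_word_inj (srt_perm S1S) (srt_perm S2S) (srt_rows S1S) (srt_rows S2S) sh12 eI.
have sz : size S1 = size S2 by rewrite -(size_map size S1) -(size_map size S2) -/(shape S1) sh12.
have eU c : col_up S1 c = col_up S2 c.
  have srt lam' S (SS : S \in SRT lam') : sort geq (col_up S c) = col_up S c.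
    apply: (sorted_sort geq_trans); have := srt_cols SS c.
    by rewrite gtn_sorted_uniq_geq => /andP[].
  by rewrite -(srt _ _ S1S) eC (srt _ _ S2S).
apply: eq_tableau => // r c cr; have := eU c; rewrite /col_up -sh12 -sz => /eq_in_map; apply.
rewrite mem_filter cr mem_iota /=.
by move: cr; rewrite /row_len; case: (ltnP r (size S1)) => // h; rewrite nth_default // size_map.
Qed.

(** Transport starts at T and ends at some S, quasi-dual equivalent to T, with the insertion tableau
    of T'; injectivity identifies S with T'. *)
Lemma quasi_dual_coarsens (k : 'I_3) lam T T' : is_part lam -> T \in SRT lam -> T' \in SRT lam ->
  perm_equiv k (col_word T) (col_word T') -> quasi_dual_equiv lam T T'.
Proof.
move=> lamP TS T'S [+ _]; rewrite -(srt_column_word TS) -(srt_column_word T'S) !rsk_insertion.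
rewrite (perm_size (perm_column_word (srt_perm TS))) size_iota => /syt_equiv_dual_R.
case/(@dual_R_equiv_lift _ (fun S => S \in SRT lam) column_word (quasi_dual_equiv lam)).
- by move=> S SS; apply: perm_column_word (srt_perm SS).
- by move=> S; apply: rst_refl.
- by move=> S1 S2 S3; apply: rst_trans.
- by move=> S i; apply: srt_move.
move=> /(_ T TS erefl)[S [SS ES eS]] _.
by rewrite -(srt_insertion_inj lamP SS T'S eS).
Qed.

(** * Composition tableaux *)

Lemma entry_map0 (f : nat -> nat) T r c : f 0 = 0 -> entry (map (map f) T) r c = f (entry T r c).
Proof.
move=> f0; have [cr|cr] := ltnP c (row_len (shape T) r); first exact: entry_map.
have out T1 : row_len (shape T1) r <= c -> entry T1 r c = 0.
  by rewrite row_lenE => h; rewrite /entry nth_default.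
by rewrite !out ?f0 // shape_map.
Qed.

Lemma entry_gt0 T r c : 0 < entry T r c -> c < row_len (shape T) r.
Proof. by rewrite row_lenE /entry; case: (ltnP c (size _)) => // h; rewrite nth_default. Qed.

Lemma row_len_size (T : tableau) r c : c < row_len (shape T) r -> r < size T.
Proof. by rewrite /row_len; case: (ltnP r (size T)) => // h; rewrite nth_default // size_map. Qed.

Lemma rows_gtnP (T : tableau) : reflect (forall r c, c.+1 < row_len (shape T) r -> entry T r c.+1 < entry T r c)
  (all (sorted gtn) T).
Proof.
apply: (iffP (all_nthP [::])) => H r.
  move=> c cr; have rT := row_len_size cr.
  by move: (H r rT) => /(sortedP 0) /(_ c); apply; rewrite -row_lenE.
by move=> rT; apply/(sortedP 0) => c cr; apply: H; rewrite row_lenE.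
Qed.

Lemma mem_SRCT a T : reflect
  [/\ shape T = a, perm_eq (flatten T) (iota 1 (sumn a)),
      forall r r', r < r' -> 0 < row_len a r -> 0 < row_len a r' -> entry T r' 0 < entry T r 0,
      forall r c, c.+1 < row_len a r -> entry T r c.+1 < entry T r c &
      forall r r' c, r' < r -> c < row_len a r -> entry T r c.+1 < entry T r' c.+1 -> entry T r' c.+1 < entry T r c -> False]
  (T \in SRCT a).
Proof.
rewrite mem_filter mem_fillings rev_sorted.
apply: (iffP idP) => [/andP[/and3P[c0 /rows_gtnP rows tri] /andP[/eqP <- pT]]|[<- pT c0 rows tri]].
  split=> //.
    move=> r r' rr' r0 r0'; apply: (sorted_col_upP T 0 (rev_trans ltn_trans) c0) => //; by rewrite -row_lenE.
  move=> r r' c rr' cr h1 h2.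
  have := allP tri r; rewrite mem_iota (row_len_size cr) => /(_ isT) /allP /(_ c).
  by rewrite mem_iota cr => /(_ isT) /allP /(_ r'); rewrite mem_iota rr' h1 h2 => /(_ isT).
rewrite eqxx pT !andbT; apply/and3P; split.
- apply/(sorted_col_upP _ _ (rev_trans ltn_trans)) => r r' rr' r0 r0'.
  by apply: c0; rewrite ?row_lenE.
- exact/rows_gtnP.
apply/allP=> r _; apply/allP=> c; rewrite mem_iota => /andP[_ cr].
apply/allP=> r'; rewrite mem_iota => /andP[_ rr']; apply/negP=> /andP[].
exact: tri.
Qed.

Section CompositionTableau.

Variables (a : seq nat) (T : tableau).
Hypothesis TS : T \in SRCT a.
Local Notation n := (sumn a).
Local Notation E := (entry T).

Lemma srct_shape : shape T = a. Proof. by case/mem_SRCT: TS. Qed.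

Lemma srct_perm : perm_eq (row_word T) (iota 1 n).
Proof. by case/mem_SRCT: TS => _ pT _ _ _; apply: perm_trans (perm_row_word T) pT. Qed.

Lemma srct_rows : all (sorted gtn) T.
Proof. by apply/rows_gtnP; rewrite srct_shape; case/mem_SRCT: TS. Qed.

Lemma srct_inj r c r' c' : 0 < E r c -> E r c = E r' c' -> r = r' /\ c = c'.
Proof.
move=> e0 ee; have cr := entry_gt0 e0; have cr' : c' < row_len (shape T) r' by apply: entry_gt0; rewrite -ee.
by have := @entry_inj _ _ srct_perm (r, c) (r', c'); rewrite !mem_rcells => /(_ cr cr' ee) [].
Qed.

Lemma srct_triple r r' c : r' < r -> 0 < E r c -> E r c.+1 < E r' c.+1 -> E r' c.+1 < E r c -> False.
Proof. by case/mem_SRCT: TS => sh _ _ _ tri rr' /entry_gt0; rewrite sh; apply: tri. Qed.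

(** The triple rule read the other way: an entry below and larger than b must also exceed the left
    neighbour of b, equality being excluded by distinctness. *)
Lemma srct_gap r r' c : r' < r -> 0 < E r c.+1 -> E r c.+1 < E r' c.+1 -> E r c.+1 < E r c < E r' c.+1.
Proof.
move=> rr' e0 lt; have lt0 : E r c.+1 < E r c.
  by case/mem_SRCT: TS => sh _ _ rows _; apply: rows; rewrite -sh; apply: entry_gt0.
rewrite lt0 /= ltn_neqAle leqNgt; apply/andP; split.
  by apply/eqP=> /srct_inj[]; [apply: leq_trans lt0 | move=> _ /n_Sn].
by apply/negP; apply: srct_triple => //; apply: leq_trans lt0.
Qed.

(** If k+1 were below k in such a column, the left neighbour of k would lie strictly between k and
    k+1. *)
Lemma srct_consecutive r r' c : 0 < E r c.+1 -> E r' c.+1 = (E r c.+1).+1 -> r < r'.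
Proof.
move=> e0 ee; rewrite ltnNge leq_eqVlt; apply/negP=> /orP[/eqP rr|rr].
  by move: ee; rewrite rr => /n_Sn.
have := srct_gap rr e0; rewrite ee => /(_ (ltnSn _)); rewrite ltnS => /andP[h1 h2].
by have := leq_trans h1 h2; rewrite ltnn.
Qed.

Lemma srct_map (f : nat -> nat) : injective f -> f 0 = 0 -> (forall v, 0 < v <= n -> 0 < f v <= n) ->
  (forall r r', r < r' -> E r' 0 < E r 0 -> f (E r' 0) < f (E r 0)) ->
  (forall r c, 0 < E r c.+1 -> E r c.+1 < E r c -> f (E r c.+1) < f (E r c)) ->
  (forall r r' c, r' < r -> 0 < E r c -> f (E r c.+1) < f (E r' c.+1) -> f (E r' c.+1) < f (E r c) -> False) ->
  map (map f) T \in SRCT a /\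
  forall v, 0 < v <= n -> value_column (map (map f) T) (f v) = value_column T v.
Proof.
move=> finj f0 fn c0f rowf trif; case/mem_SRCT: (TS) => sh pT c0 rows tri.
have en r c : (c < row_len a r) = (0 < E r c).
  apply/idP/idP=> [cr|/entry_gt0]; last by rewrite sh.
  by have /andP[] : 0 < cell_entry T (r, c) <= n by apply: (entry_bounds srct_perm); rewrite mem_rcells sh.
have pf : perm_eq (map f (flatten T)) (iota 1 n).
  have uT : uniq (map f (flatten T)) by rewrite map_inj_uniq // (perm_uniq pT) iota_uniq.
  apply: uniq_perm; rewrite ?iota_uniq //.
  have sub : {subset map f (flatten T) <= iota 1 n}.
    by move=> _ /mapP[v vT ->]; move: vT; rewrite (perm_mem pT) !mem_iota !add1n !ltnS; apply: fn.
  have sz : size (iota 1 n) <= size (map f (flatten T)) by rewrite size_map (perm_size pT).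
  by have [_] := uniq_min_size uT sub sz.
have T'S : map (map f) T \in SRCT a.
  apply/mem_SRCT; split.
  - by rewrite shape_map.
  - by rewrite -map_flatten.
  - by move=> r r' rr' r0 r0'; rewrite !entry_map0 // c0f // c0.
  - by move=> r c cr; rewrite !entry_map0 // rowf -?en // rows.
  by move=> r r' c rr' cr; rewrite !entry_map0 //; apply: trif; rewrite -?en.
split=> // v /(cell_of srct_perm)[x xs <-].
have p' : perm_eq (row_word (map (map f) T)) (iota 1 n).
  by rewrite row_word_map; apply: perm_trans pf; apply: perm_map; apply: perm_row_word.
have -> : f (cell_entry T x) = cell_entry (map (map f) T) x by rewrite /cell_entry entry_map0.
by rewrite (value_column_entry p') ?shape_map // (value_column_entry srct_perm).
Qed.

(** The two excluded positions are those that break a rule: p immediately right of p+1 reverses a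
    row, and p+1 lower down in the next column would land between the neighbour b and the new value
    of its left entry. *)
Lemma srct_exchange p rp cp rq cq : 0 < p < n -> E rp cp = p -> E rq cq = p.+1 -> cp <> cq ->
  ~ (rp = rq /\ cp = cq.+1) -> ~ (cq = cp.+1 /\ rq < rp) ->
  map (map (exchange p)) T \in SRCT a /\
  forall v, 0 < v <= n -> value_column (map (map (exchange p)) T) (exchange p v) = value_column T v.
Proof.
move=> /andP[p0 pn] eP eQ cpq V1 V2.
have posP r c : E r c = p -> r = rp /\ c = cp by move=> e; apply: srct_inj; rewrite e ?eP.
have posQ r c : E r c = p.+1 -> r = rq /\ c = cq by move=> e; apply: srct_inj; rewrite e ?eQ.
have f0 : exchange p 0 = 0 by rewrite exchangeE; move: p0; clear; case: p.
have lt_inv u v : exchange p u < exchange p v -> ~ (u = p.+1 /\ v = p) -> u < v.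
  move=> uv h; rewrite -(exchange_inv p u) -(exchange_inv p v); apply: exchange_lt => // -[fu fv].
  by apply: h; rewrite -(exchange_inv p u) -(exchange_inv p v) fu fv !exchangeE !eqxx gtn_eqF.
apply: srct_map => //; first exact: inv_inj (exchange_inv p).
- move=> v; rewrite exchangeE; do 2?case: eqP => //; move: p0 pn; clear; lia.
- move=> r r' rr' lt; apply: exchange_lt => // -[/posP[_ h1] /posQ[_ h2]].
  by apply: cpq; rewrite -h1 -h2.
- move=> r c e0 lt; apply: exchange_lt => // -[/posP[h1 h2] /posQ[h3 h4]].
  by apply: V1; rewrite -h1 -h2 -h3 -h4.
move=> r r' c rr' e0 /lt_inv h1 /lt_inv h2; apply: (srct_triple rr' e0).
  by apply: h1 => -[/posQ[_ h3] /posP[_ h4]]; apply: cpq; rewrite -h3 -h4.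
by apply: h2 => -[/posQ[h3 h4] /posP[h5 h6]]; apply: V2; rewrite -h3 -h4 -h5 -h6.
Qed.

(** The three window values occupy two adjacent cells of a row and a lower cell in the column of the
    right one. If the adjacent cells receive consecutive values, nothing fits between them and their
    triples hold. The other comparisons needed involve at most one window value, so f does not
    affect them. *)
Lemma srct_cycle (f : nat -> nat) q r c R : injective f -> 0 < q -> q.+1 < n ->
  (forall z, f z \in window q.+1 = (z \in window q.+1)) ->
  (forall z, z \notin window q.+1 -> f z = z) ->
  E r c \in window q.+1 -> E r c.+1 \in window q.+1 -> E R c.+1 \in window q.+1 -> R < r ->
  f (E r c) = (f (E r c.+1)).+1 ->
  map (map f) T \in SRCT a /\
  forall v, 0 < v <= n -> value_column (map (map f) T) (f v) = value_column T v.
Proof.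
move=> finj q0 qn fwin fout e1w e2w e3w Rr f12.
have win z : (z \in window q.+1) = [|| z == q, z == q.+1 | z == q.+2] by rewrite !inE.
have gt0 z : z \in window q.+1 -> 0 < z by rewrite win; move: q0; clear; lia.
have f0 : f 0 = 0 by apply: fout; rewrite win; move: q0; clear; lia.
have fcmp u v : ~~ ((u \in window q.+1) && (v \in window q.+1)) -> (f u < f v) = (u < v).
  case: (boolP (u \in window q.+1)) => uw; case: (boolP (v \in window q.+1)) => vw //= _.
  - by rewrite (fout v vw); move: (fwin u) uw vw; rewrite !win; clear; lia.
  - by rewrite (fout u uw); move: (fwin v) uw vw; rewrite !win; clear; lia.
  - by rewrite !fout.
have cells r1 c1 : E r1 c1 \in window q.+1 -> [\/ r1 = r /\ c1 = c, r1 = r /\ c1 = c.+1 | r1 = R /\ c1 = c.+1].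
  move=> w; have h x y : E r1 c1 = E x y -> r1 = x /\ c1 = y by apply: srct_inj; apply: gt0.
  have ne12 : E r c <> E r c.+1 by move/(srct_inj (gt0 _ e1w)) => [_ /n_Sn].
  have ne13 : E r c <> E R c.+1 by move/(srct_inj (gt0 _ e1w)) => [_ /n_Sn].
  have ne23 : E r c.+1 <> E R c.+1 by move/(srct_inj (gt0 _ e2w)) => [rR _]; move: Rr; rewrite rR ltnn.
  have : [\/ E r1 c1 = E r c, E r1 c1 = E r c.+1 | E r1 c1 = E R c.+1].
    move: w e1w e2w e3w ne12 ne13 ne23; rewrite !win.
    move: (E r1 c1) (E r c) (E r c.+1) (E R c.+1) => x y z t w1 w2 w3 w4 n1 n2 n3.
    have : x = y \/ x = z \/ x = t by move: w1 w2 w3 w4 n1 n2 n3; clear; lia.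
    by case=> [->|[->|->]]; [apply: Or31|apply: Or32|apply: Or33].
  by case=> /h h'; [apply: Or31|apply: Or32|apply: Or33].
apply: srct_map => //.
- move=> v vn; case: (boolP (v \in window q.+1)) => [vw|/fout -> //].
  by have := fwin v; rewrite vw win; move: q0 qn; clear; lia.
- move=> r1 r2 rr lt; rewrite fcmp //; apply/negP=> /andP[/cells h1 /cells h2].
  have r1r : r1 = r by case: h2 => -[].
  have r2r : r2 = r by case: h1 => -[].
  by move: rr; rewrite r1r r2r ltnn.
- move=> r1 c1 e0 lt; case: (boolP ((E r1 c1.+1 \in window q.+1) && (E r1 c1 \in window q.+1))) => [|h]; last by rewrite fcmp.
  case/andP=> /cells h1 /cells h2.
  have [-> ->] : r1 = r /\ c1 = c.
    case: h1 => -[h1 h1'].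
    - by case: h2 => -[_ h2']; exfalso; move: h1' h2'; clear; lia.
    - by split=> //; case: h1'.
    - case: h2 => -[h2 h2'].
      + by split.
      + by exfalso; move: h1' h2'; clear; lia.
      by exfalso; move: h1' h2'; clear; lia.
  by rewrite f12.
move=> r1 r2 c1 rr e0; case: (boolP ((r1 == r) && (c1 == c))) => [/andP[/eqP -> /eqP ->]|nrc].
  by rewrite f12 ltnS => h1 h2; have := leq_trans h1 h2; rewrite ltnn.
have nA : E r1 c1 \in window q.+1 -> c1 = c.+1.
  by move/cells => [] [h1 h2] //; move: nrc; rewrite h1 h2 !eqxx.
rewrite !fcmp; first exact: srct_triple.
  apply/negP=> /andP[/cells h1 /nA h2].
  by case: h1 => -[_]; rewrite h2; clear; lia.
apply/negP=> /andP[/cells h1 /cells h2].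
case: h1 => -[h1 h1'].
- by case: h2 => -[h2 h2']; move: rr; rewrite h1 h2 ?ltnn // h1' in h2' *; move: h2'; clear; lia.
- case: h2 => -[h2 h2'].
  + by move: rr; rewrite h1 h2 ltnn.
  + by move: rr; rewrite h1 h2 ltnn.
  by move: nrc; rewrite h1 eqxx /=; case: h1' => ->; rewrite eqxx.
case: h2 => -[h2 h2'].
- by move: h1' h2' ; clear; lia.
- by move: rr; rewrite h1 h2 => /(ltn_trans Rr); rewrite ltnn.
by move: rr; rewrite h1 h2 ltnn.
Qed.

End CompositionTableau.

Definition cycle_up (q z : nat) : nat :=
  if z == q then q.+1 else if z == q.+1 then q.+2 else if z == q.+2 then q else z.

Definition cycle_down (q z : nat) : nat :=
  if z == q then q.+2 else if z == q.+1 then q else if z == q.+2 then q.+1 else z.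

Lemma cycle_upE q : [/\ cycle_up q q = q.+1, cycle_up q q.+1 = q.+2, cycle_up q q.+2 = q &
  forall z, z \notin window q.+1 -> cycle_up q z = z].
Proof.
rewrite /cycle_up; split; try by do 3?case: eqP => //; lia.
by move=> z; rewrite !inE; do 3!case: eqP.
Qed.

Lemma cycle_downE q : [/\ cycle_down q q = q.+2, cycle_down q q.+1 = q, cycle_down q q.+2 = q.+1 &
  forall z, z \notin window q.+1 -> cycle_down q z = z].
Proof.
rewrite /cycle_down; split; try by do 3?case: eqP => //; lia.
by move=> z; rewrite !inE; do 3!case: eqP.
Qed.

Lemma cycle_upK q : cancel (cycle_up q) (cycle_down q).
Proof.
move=> z; have [u1 u2 u3 u4] := cycle_upE q; have [d1 d2 d3 d4] := cycle_downE q.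
case: (boolP (z \in window q.+1)) => [|zw]; last by rewrite u4 ?d4.
by rewrite !inE => /or3P[] /eqP ->; rewrite ?u1 ?u2 ?u3 ?d1 ?d2 ?d3.
Qed.

Lemma cycle_downK q : cancel (cycle_down q) (cycle_up q).
Proof.
move=> z; have [u1 u2 u3 u4] := cycle_upE q; have [d1 d2 d3 d4] := cycle_downE q.
case: (boolP (z \in window q.+1)) => [|zw]; last by rewrite d4 ?u4.
by rewrite !inE => /or3P[] /eqP ->; rewrite ?d1 ?d2 ?d3 ?u1 ?u2 ?u3.
Qed.

Lemma cycle_up_window q z : (cycle_up q z \in window q.+1) = (z \in window q.+1).
Proof.
have [u1 u2 u3 u4] := cycle_upE q; case: (boolP (z \in window q.+1)) => [|zw].
  by rewrite !inE => /or3P[] /eqP ->; rewrite ?u1 ?u2 ?u3 !eqxx ?orbT.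
by rewrite u4 // (negPf zw).
Qed.

Lemma cycle_down_window q z : (cycle_down q z \in window q.+1) = (z \in window q.+1).
Proof. by rewrite -cycle_up_window cycle_downK. Qed.

(** * Lifting the dual moves to composition tableaux *)

Section CompositionMoves.

Variables (a : seq nat) (T : tableau).
Hypothesis TS : T \in SRCT a.
Local Notation n := (sumn a).
Local Notation E := (entry T).
Local Notation w := (column_word T).

Lemma srct_column_move i (f : nat -> nat) : 2 <= i <= n.-1 ->
  map (map f) T \in SRCT a ->
  (forall v, 0 < v <= n -> value_column (map (map f) T) (dual_subst i w v) = value_column T v) ->
  exists S', [/\ S' \in SRCT a, True & column_word S' = dual_word i w].
Proof.
move=> iN S'S colE; exists (map (map f) T); split=> //.
have p' := srct_perm S'S.
apply: (column_word_dual (srct_perm TS) iN p' colE) => u; exact: (column_word_unique p').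
Qed.

(** The exchange lifts entrywise unless p and p+1 are in one of the two positions forbidden by
    [srct_exchange]. In each of them t = p+2 forces either the first column, where d_i^R is trivial,
    or a contradiction, while t = p-1 leads to a 3-cycle. *)
Lemma srct_move i : 2 <= i <= n - 2 ->
  (i.+1 \in inv_descents w) && (i.+1 \in inv_descents (dual_word i w)) \/
  exists S', [/\ S' \in SRCT a, True & column_word S' = dual_word i w].
Proof.
move=> iN; have iN' : 2 <= i <= n.-1 by move: iN; clear; lia.
have pT := srct_perm TS.
have [fid|[p [t [fe pt tb]]]] := dual_substE (perm_column_word pT) iN'.
  by right; exists T; split=> //; rewrite /dual_word (eq_map fid) map_id.
have [p0 pn tn] : [/\ 0 < p, p < n & 0 < t <= n] by split; move: pt iN; clear; lia.
have pn' : 0 < p <= n by rewrite p0 ltnW.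
have ppn : 0 < p.+1 <= n by [].
have [[rp cp] xp /= eP] := cell_of pT pn'; have [[rq cq] xq /= eQ] := cell_of pT ppn.
have [[rz cz] xz /= eZ] := cell_of pT tn.
have kP : value_column T p = cp by rewrite -eP (value_column_entry pT).
have kQ : value_column T p.+1 = cq by rewrite -eQ (value_column_entry pT).
have kZ : value_column T t = cz by rewrite -eZ (value_column_entry pT).
rewrite /cell_entry /= in eP eQ eZ.
have := column_witness pT p0 pn tn tb; rewrite /column_before kP kQ kZ /= => wit.
have cpq : cp <> cq by rewrite -kP -kQ; exact: (witness_columns pT p0 pn tn tb).
have eqr x y x' y' : 0 < E x y -> E x y = E x' y' -> x = x' /\ y = y' := @srct_inj _ _ TS x y x' y'.
have simple : ~ (rp = rq /\ cp = cq.+1) -> ~ (cq = cp.+1 /\ rq < rp) ->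
    exists S', [/\ S' \in SRCT a, True & column_word S' = dual_word i w].
  move=> V1 V2; have [|S'S colE] := srct_exchange TS _ eP eQ cpq V1 V2; first by rewrite p0.
  by apply: (srct_column_move iN' S'S) => v vn; rewrite fe colE.
case: (boolP ((rp == rq) && (cp == cq.+1))) => [/andP[/eqP r1 /eqP c1]|V1].
  move: eP kP wit; rewrite r1 c1 => eP kP wit {simple}; case: pt => -[pi ti].
    have tp : t = p.+2 by move: pi ti iN; clear; lia.
    have cze : cz = cq by move: wit tp; clear; lia.
    move: eZ kZ; rewrite cze tp => eZ kZ.
    case: cq eP eQ eZ kP kQ kZ {c1 cze xp xq xz wit cpq tb} => [|c] eP eQ eZ kP kQ kZ.
      left; apply: (column0_descents pT iN); first by rewrite -kZ pi; case/andP: iN; case: (i).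
      by rewrite fe exchangeE pi; move: iN; clear; case: i => [|i] //= _; rewrite !gtn_eqF // ltnW.
    (* Here p+2 is above p+1 by [srct_consecutive]. The entry right of p+2 is below p, so p, lower
       down in that next column, violates the triple rule. *)
    exfalso; have lt : rq < rz by apply: (srct_consecutive TS (c := c)); rewrite ?eQ ?eZ.
    have bp : E rz c.+2 < E rz c.+1.
      have [E0|E0] := posnP (E rz c.+2); first by rewrite E0 eZ.
      by case/mem_SRCT: (TS) => sh _ _ rows _; apply: rows; rewrite -sh; apply: entry_gt0.
    have n1 : E rz c.+2 <> p.
      by rewrite -eP => /esym/eqr[]; rewrite ?eP // => rr _; move: lt; rewrite rr ltnn.
    have n2 : E rz c.+2 <> p.+1 by rewrite -eQ => /esym/eqr[]; rewrite ?eQ // => _ /n_Sn.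
    apply: (srct_triple TS lt (c := c.+1)); rewrite ?eZ ?eP //.
    by move: bp n1 n2; rewrite eZ; clear; lia.
  have pe : p = t.+1 by move: pi ti iN; clear; lia.
  move: fe p0 pn pn' ppn eP eQ kP kQ wit; rewrite pe => fe p0 pn pn' ppn eP eQ kP kQ wit.
  have cze : cz = cq.+1 by move: wit; clear; lia.
  move: eZ kZ; rewrite cze => eZ kZ; right; have t0 : 0 < t by case/andP: tn.
  have lt : rz < rq by apply: (srct_consecutive TS (c := cq)); rewrite ?eP ?eZ.
  (* The adjacent cells holding p+1, p receive p, p-1, and the lower cell holding p-1 receives p+1.
     As sets, the two columns change exactly as under the exchange of p and p+1. *)
  have [u1 u2 u3 u4] := cycle_downE t.
  have [|||||S'S colE] := srct_cycle TS (can_inj (cycle_downK t)) t0 pn (cycle_down_window t) u4 (r := rq) (c := cq) (R := rz);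
    rewrite ?eP ?eQ ?eZ ?inE ?eqxx ?orbT ?u2 ?u3 //.
  apply: (srct_column_move iN' S'S) => v vn; rewrite fe exchangeE.
  have tE z : 0 < z <= n -> forall y, cycle_down t z = y ->
      value_column (map (map (cycle_down t)) T) y = value_column T z.
    by move=> zn y <-; apply: colE.
  case: eqP => [->|n1]; first by rewrite (tE t) ?tn // kZ kP.
  case: eqP => [->|n2]; first by rewrite (tE t.+2).
  case: (v =P t) => [->|n3]; first by rewrite (tE t.+1) // kZ kP.
  by rewrite (tE v) // u4 // !inE; move: n1 n2 n3; clear; lia.
case: (boolP ((cq == cp.+1) && (rq < rp))) => [/andP[/eqP c1 lt]|V2]; last first.
  right; apply: simple => [[h1 h2]|[h1 h2]]; first by move: V1; rewrite h1 h2 !eqxx.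
  by move: V2; rewrite h1 h2 eqxx.
move: eQ kQ wit; rewrite c1 => eQ kQ wit {simple}; case: pt => -[pi ti].
  have tp : t = p.+2 by move: pi ti iN; clear; lia.
  have cze : cz = cp by move: wit tp; clear; lia.
  move: eZ kZ; rewrite cze tp => eZ kZ.
  have bp : E rz cp.+1 < E rz cp.
    have [E0|E0] := posnP (E rz cp.+1); first by rewrite E0 eZ.
    by case/mem_SRCT: (TS) => sh _ _ rows _; apply: rows; rewrite -sh; apply: entry_gt0.
  (* If p+2 were above p+1, then p+1 would lie in the next column, below and between p+2 and its
     right neighbour. *)
  have rzq : rz <= rq.
    rewrite leqNgt; apply/negP=> rqz; apply: (srct_triple TS rqz (c := cp)); rewrite ?eZ ?eQ //.
    have n1 : E rz cp.+1 <> p.+1.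
      by rewrite -eQ => /esym/eqr[]; rewrite ?eQ // => rr _; move: rqz; rewrite rr ltnn.
    by move: bp n1; rewrite eZ; clear; lia.
  case: cp eP eQ eZ kP kQ kZ {c1 cze xp xq xz wit cpq tb V1 bp} => [|c] eP eQ eZ kP kQ kZ.
    left; apply: (column0_descents pT iN); first by rewrite -kZ pi; case/andP: iN; case: (i).
    by rewrite fe exchangeE pi; move: iN; clear; case: i => [|i] //= _; rewrite !gtn_eqF // ltnW.
  (* Outside the first column, p+2 below p forces the left neighbour of p to be p+1, which is in the
     column to the right of p. *)
  exfalso; have := srct_gap TS (leq_ltn_trans rzq lt) (c := c); rewrite eP eZ => /(_ p0 (leqW (ltnSn p))) h.
  have e1 : E rp c = E rq c.+2 by rewrite eQ; move: h; clear; lia.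
  have [|_] := eqr _ _ _ _ _ e1; first by case/andP: h => /(leq_ltn_trans (leq0n p)).
  by clear; lia.
have pe : p = t.+1 by move: pi ti iN; clear; lia.
move: fe p0 pn pn' ppn eP eQ kP kQ wit; rewrite pe => fe p0 pn pn' ppn eP eQ kP kQ wit.
have cze : cz = cp.+1 by move: wit; clear; lia.
move: eZ kZ; rewrite cze => eZ kZ; right; have t0 : 0 < t by case/andP: tn.
(* If p-1 were higher than p, its left neighbour would lie strictly between p-1 and p+1, so it would
   be p itself, in the wrong row. If it were lower, it would violate the triple rule for p and its
   right neighbour. *)
have rzp : rz = rp.
  case: (ltngtP rz rp) => [rr|rr|//]; exfalso; last first.
    have h := srct_gap TS (ltn_trans lt rr) (c := cp); rewrite eZ eQ in h.
    have e1 : E rz cp = E rp cp by rewrite eP; move: (h t0 (leqW (ltnSn t))); clear; lia.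
    have [|rzp _] := eqr _ _ _ _ _ e1; first by rewrite e1 eP.
    by move: rr; rewrite rzp ltnn.
  have bp : E rp cp.+1 < E rp cp.
    have [E0|E0] := posnP (E rp cp.+1); first by rewrite E0 eP.
    by case/mem_SRCT: (TS) => sh _ _ rows _; apply: rows; rewrite -sh; apply: entry_gt0.
  have n1 : E rp cp.+1 <> t.
    by rewrite -eZ => /esym/eqr[]; rewrite ?eZ // => rr' _; move: rr; rewrite rr' ltnn.
  apply: (srct_triple TS rr (c := cp)); rewrite ?eP ?eZ //.
  by move: bp n1; rewrite eP; clear; lia.
(* Now p and p-1 are adjacent in a row and p+1 is lower in the column of p-1. The cycle gives them
   p+1, p and p-1 respectively. *)
rewrite rzp in eZ; have [u1 u2 u3 u4] := cycle_upE t.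
have [|||||S'S colE] := srct_cycle TS (can_inj (cycle_upK t)) t0 pn (cycle_up_window t) u4 (r := rp) (c := cp) (R := rq);
  rewrite ?eP ?eQ ?eZ ?inE ?eqxx ?orbT ?u2 ?u1 //.
apply: (srct_column_move iN' S'S) => v vn; rewrite fe exchangeE.
have tE z : 0 < z <= n -> forall y, cycle_up t z = y ->
    value_column (map (map (cycle_up t)) T) y = value_column T z.
  by move=> zn y <-; apply: colE.
case: eqP => [->|n1]; first by rewrite (tE t.+1).
case: eqP => [->|n2]; first by rewrite (tE t) ?tn // kZ kQ.
case: (v =P t) => [->|n3]; first by rewrite (tE t.+2) // kZ kQ.
by rewrite (tE v) // u4 // !inE; move: n1 n2 n3; clear; lia.
Qed.

End CompositionMoves.

(** * The bent reading word of a composition tableau *)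

Definition column_cells (T : tableau) (c : nat) : seq cell :=
  [seq (r, c) | r <- [seq r <- iota 0 (size T) | c < row_len (shape T) r]].

Definition bent_cells (T : tableau) : seq cell :=
  flatten [seq if c == 0 then column_cells T c else rev (column_cells T c) | c <- rev (iota 0 (ncols T))].

Definition bent_before (x y : cell) : bool :=
  (y.2 < x.2) || (x.2 == y.2) && (if x.2 == 0 then x.1 < y.1 else y.1 < x.1).

Lemma bent_before_trans : transitive bent_before.
Proof.
move=> [y1 y2] [x1 x2] [z1 z2]; rewrite /bent_before /= => /orP[xy|/andP[/eqP -> xy]].
  by case/orP=> [yz|/andP[/eqP <- _]]; rewrite ?xy // (ltn_trans yz xy).
case/orP=> [-> //|/andP[/eqP <- yz]]; rewrite eqxx ltnn /=.
by move: xy yz; case: eqP => _ xy yz; [apply: ltn_trans yz | apply: ltn_trans xy].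
Qed.

Lemma bent_before_irr : irreflexive bent_before.
Proof. by move=> [x1 x2]; rewrite /bent_before /= !ltnn eqxx; case: ifP. Qed.

Lemma mem_column_cells T c x : (x \in column_cells T c) = (x \in rcells (shape T)) && (x.2 == c).
Proof.
case: x => r c'; rewrite mem_rcells /=; apply/mapP/andP => [[r']|[cr /eqP <-]].
  by rewrite mem_filter => /andP[cr _] [-> ->].
by exists r; rewrite // mem_filter cr mem_iota (row_len_size cr).
Qed.

Lemma sorted_column_cells T c : sorted (relpre fst ltn) (column_cells T c).
Proof. by rewrite sorted_map; apply: (sorted_filter ltn_trans); apply: iota_ltn_sorted. Qed.

Lemma sorted_bent_cells T : sorted bent_before (bent_cells T).
Proof.
have trc := bent_before_trans; rewrite /bent_cells.
have : sorted gtn (rev (iota 0 (ncols T))) by rewrite rev_sorted; apply: iota_ltn_sorted.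
elim: (rev _) => //= c cs IHcs sc.
have memc c' x : (x \in (if c' == 0 then column_cells T c' else rev (column_cells T c'))) = (x \in column_cells T c').
  by case: ifP; rewrite ?mem_rev.
rewrite (sorted_pairwise trc) pairwise_cat -!(sorted_pairwise trc) IHcs ?(path_sorted sc) // andbT.
apply/andP; split.
  apply/allrelP=> u v; rewrite memc mem_column_cells => /andP[_ /eqP uc] /flattenP[s /mapP[c' c's ->]].
  rewrite memc mem_column_cells => /andP[_ /eqP vc]; rewrite /bent_before uc vc.
  by move: sc; rewrite (path_sortedE (rev_trans ltn_trans)) => /andP[/allP /(_ c' c's) /= ->].
have sub (R : rel cell) (s : seq cell) : {subset s <= column_cells T c} -> sorted R s ->
    (forall x y, x.2 = c -> y.2 = c -> R x y -> bent_before x y) -> sorted bent_before s.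
  move=> ss sR H; apply: (sub_in_sorted (P := mem s)) sR; last exact/allP.
  by move=> x y /ss + /ss; rewrite !mem_column_cells => /andP[_ /eqP xc] /andP[_ /eqP yc]; apply: H.
case: ifP => [/eqP c0|c0].
  apply: (sub _ _ _ (sorted_column_cells T c)) => // x y xc yc /= xy.
  by rewrite /bent_before xc yc c0 eqxx xy orbT.
apply: (sub (relpre fst gtn)); first by move=> x; rewrite mem_rev.
  by rewrite rev_sorted; apply: sorted_column_cells.
by move=> x y xc yc /= xy; rewrite /bent_before xc yc c0 eqxx xy orbT.
Qed.

Lemma bent_word_cells T : bent_word T = map (cell_entry T) (bent_cells T).
Proof.
rewrite /bent_word /bent_cells map_flatten -map_comp; congr flatten; apply: eq_map => c /=.
have -> : col_up T c = map (cell_entry T) (column_cells T c) by rewrite -map_comp.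
by case: ifP; rewrite ?map_rev.
Qed.

Lemma mem_bent_cells T : bent_cells T =i rcells (shape T).
Proof.
have memc c' x : (x \in (if c' == 0 then column_cells T c' else rev (column_cells T c'))) = (x \in column_cells T c').
  by case: ifP; rewrite ?mem_rev.
move=> x; apply/flattenP/idP => [[s /mapP[c _ ->]]|xs].
  by rewrite memc mem_column_cells => /andP[].
exists (if x.2 == 0 then column_cells T x.2 else rev (column_cells T x.2)).
  by apply: map_f; rewrite mem_rev mem_iota lt_ncols.
by rewrite memc mem_column_cells xs eqxx.
Qed.

Section CompositionWords.

Variables (a : seq nat) (T : tableau).
Hypothesis TS : T \in SRCT a.
Local Notation n := (sumn a).

(** The two words order a column differently, but only consecutive values matter. In a common column
    k+1 precedes k in both words: by [srct_consecutive] outside the first column, and by its upward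
    reading inside it. *)
Lemma srct_bent_descents : inv_descents (bent_word T) = inv_descents (column_word T).
Proof.
have pT := srct_perm TS; have uc : uniq (bent_cells T).
  by apply: (sorted_uniq bent_before_trans bent_before_irr); apply: sorted_bent_cells.
have pc : perm_eq (bent_cells T) (rcells (shape T)).
  by apply: uniq_perm => //; [apply: uniq_rcells | apply: mem_bent_cells].
have pw : perm_eq (bent_word T) (iota 1 n).
  by rewrite bent_word_cells; apply: perm_trans pT; rewrite row_word_cells; apply: perm_map.
rewrite /inv_descents (perm_size pw) (perm_size (perm_column_word pT)) size_iota.
apply: eq_in_filter => k; rewrite mem_iota => kn.
have kn1 : 0 < k <= n by move: kn; clear; lia.
have kn2 : 0 < k.+1 <= n by move: kn; clear; lia.
rewrite (index_column_word pT) //.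
have [x xs ex] := cell_of pT kn1; have [y ys ey] := cell_of pT kn2.
have inj : {in bent_cells T &, injective (cell_entry T)}.
  by move=> u v; rewrite !mem_bent_cells; apply: (entry_inj pT).
have ix z : z \in rcells (shape T) -> index (cell_entry T z) (bent_word T) = index z (bent_cells T).
  by move=> zs; rewrite bent_word_cells (index_map_in inj) // mem_bent_cells.
have -> : (index k.+1 (bent_word T) < index k (bent_word T)) = bent_before y x.
  rewrite -{1}ey -[X in _ < index X _]ex !ix // (sorted_index_lt bent_before_trans bent_before_irr (sorted_bent_cells T)) //;
  by rewrite mem_bent_cells.
have kx : value_column T k = x.2 by rewrite -ex (value_column_entry pT).
have ky : value_column T k.+1 = y.2 by rewrite -ey (value_column_entry pT).
rewrite /bent_before /column_before kx ky ltnSn andbT.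
congr (_ || _); case: eqP => //= yx.
case: x y {ix kx ky} xs ys ex ey yx => [r c] [r' c'] /= xs ys; rewrite /cell_entry /= => ex ey ec; subst c'.
case: c xs ys ex ey => [|c] xs ys ex ey /=; last first.
  by apply: (srct_consecutive TS (c := c)); rewrite ?ex ?ey //; case/andP: kn1.
case/mem_SRCT: (TS) => sh _ c0 _ _; rewrite ltnNge leq_eqVlt; apply/negP=> /orP[/eqP rr|rr].
  by move: ey; rewrite -rr ex => /n_Sn.
move: xs ys; rewrite !mem_rcells sh /= => xs ys.
by have := c0 _ _ rr xs ys; rewrite ex ey ltnNge leqnSn.
Qed.

End CompositionWords.

(** A column is filled greedily from the top: each row takes the largest remaining value below its
    left neighbour. If T2 had the larger value in row r, then T1 would hold that value higher up,
    where the tableaux agree, or lower down, against the triple rule. Empty cells count as 0. *)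
Lemma srct_entry_leq a T1 T2 c : T1 \in SRCT a -> T2 \in SRCT a ->
  (forall c, col_up T1 c =i col_up T2 c) ->
  (forall r, entry T1 r c = entry T2 r c) -> forall r,
  (forall r', r < r' -> entry T1 r' c.+1 = entry T2 r' c.+1) ->
  entry T2 r c.+1 <= entry T1 r c.+1.
Proof.
move=> TS1 TS2 mem12 eqc r above; rewrite leqNgt; apply/negP=> lt.
have e2 : 0 < entry T2 r c.+1 by apply: leq_ltn_trans lt.
case/mem_SRCT: (TS2) => sh2 _ _ rows2 _.
have lt2 : entry T2 r c.+1 < entry T2 r c by apply: rows2; rewrite -sh2; apply: entry_gt0.
have : entry T2 r c.+1 \in col_up T1 c.+1.
  by rewrite mem12; apply/mem_col_upE; exists (r, c.+1); rewrite // mem_rcells; apply: entry_gt0.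
case/mem_col_upE => -[r' c'] _ [/= -> e1]; rewrite /cell_entry /= in e1.
case: (ltngtP r r') => [rr|rr|rr].
- have e3 : entry T2 r c.+1 = entry T2 r' c.+1 by rewrite -(above r' rr) e1.
  by have [rr' _] := srct_inj TS2 e2 e3; rewrite rr' ltnn in rr.
- apply: (srct_triple TS1 rr (c := c)); rewrite ?e1 ?eqc //.
  exact: ltn_trans lt2.
by move: lt; rewrite -e1 rr ltnn.
Qed.

Lemma srct_columns_inj a T1 T2 : T1 \in SRCT a -> T2 \in SRCT a ->
  (forall c, col_up T1 c =i col_up T2 c) -> T1 = T2.
Proof.
move=> TS1 TS2 mem12; case/mem_SRCT: (TS1) => sh1 _ c1 _ _; case/mem_SRCT: (TS2) => sh2 _ c2 _ _.
apply: eq_tableau; rewrite ?sh1 ?sh2 // => r c _.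
have out T r' c' : shape T = a -> row_len a r' <= c' -> entry T r' c' = 0.
  by move=> <-; rewrite row_lenE => h; rewrite /entry nth_default.
elim: c r => [|c IHc] r.
  have [r0|r0] := ltnP 0 (row_len a r); last by rewrite !out.
  have sz : size T1 = size T2 by rewrite -(size_map size T1) -(size_map size T2) -!/(shape _) sh1 sh2.
  have sc T : shape T = a -> (forall r r', r < r' -> 0 < row_len a r -> 0 < row_len a r' -> entry T r' 0 < entry T r 0) ->
      sorted gtn (col_up T 0).
    move=> sh c0; apply/(sorted_col_upP _ _ (rev_trans ltn_trans)) => r1 r2 rr h1 h2.
    by apply: c0; rewrite // -sh row_lenE.
  have : col_up T1 0 = col_up T2 0.
    by apply: (irr_sorted_eq (rev_trans ltn_trans) ltnn); [apply: sc | apply: sc | apply: mem12].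
  rewrite /col_up sh1 sh2 sz => /eq_in_map; apply.
  by rewrite mem_filter r0 mem_iota (@row_len_size T2 r 0) // sh2.
(* The rows of a column are compared from the top down; d bounds the number of rows from r upwards,
   and the induction starts outside the diagram. *)
have [d] : exists d, size a <= r + d by exists (size a); rewrite leq_addl.
elim: d r => [|d IHd] r rd.
  by rewrite !out // /row_len nth_default // -(addn0 r).
have above r' : r < r' -> entry T1 r' c.+1 = entry T2 r' c.+1.
  by move=> rr; apply: IHd; apply: leq_trans rd _; rewrite addnS -addSn leq_add2r.
apply/eqP; rewrite eqn_leq; apply/andP; split.
  apply: (srct_entry_leq TS2 TS1) => [c'|r'|r' rr]; [move=> v; by rewrite mem12 | by rewrite IHc | by rewrite above].
exact: (srct_entry_leq TS1 TS2).
Qed.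

Lemma srct_insertion_inj a T1 T2 : T1 \in SRCT a -> T2 \in SRCT a ->
  insertion (column_word T1) = insertion (column_word T2) -> T1 = T2.
Proof.
move=> TS1 TS2 eI; apply: (srct_columns_inj TS1 TS2) => c v.
have sh12 : shape T1 = shape T2 by rewrite (srct_shape TS1) (srct_shape TS2).
rewrite -(mem_sort geq (col_up T1 c)) -(mem_sort geq (col_up T2 c)).
by rewrite (insertion_column_word_inj (srct_perm TS1) (srct_perm TS2) (srct_rows TS1) (srct_rows TS2) sh12 eI).
Qed.

(** * Decomposition into classes *)

Lemma uniq_SRCT a : uniq (SRCT a).
Proof.
rewrite filter_uniq // map_inj_in_uniq ?permutations_uniq // => w1 w2.
rewrite !mem_permutations => /perm_size s1 /perm_size s2 e.
rewrite size_iota in s1 s2; have := congr1 flatten e.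
by rewrite reshapeKr ?s1 // reshapeKr ?s2.
Qed.

(** Closure under the relation lets the class of the first tableau be split off whole, with
    coefficient 1, leaving a shorter closed list. *)
Lemma nonneg_comb_classes (k : 'I_3) n (C : seq tableau) : uniq C ->
  (forall Y, Y \in C -> SYTn n Y) ->
  (forall Y Y', Y \in C -> syt_equiv k n Y Y' -> Y' \in C) ->
  nonneg_comb (class_function k) (fun m => (\sum_(Y <- C) fund_qsym n (ID Y) m)%R).
Proof.
move: {2}(size C) (leqnn (size C)) => N; elim: N C => [|N IHN] C szC uC CS closed.
  exists 0, (fun _ => 0), (fun _ _ => 0%R); split=> [[]//|m].
  by case: C szC {uC CS closed} => // _; rewrite big_nil big_ord0.
case: C szC uC CS closed => [|Y0 C]; first by move=> *; apply: IHN.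
set C1 := Y0 :: C => szC uC CS closed.
(* Excluded middle makes the relation boolean, as filtering the list by a class requires. *)
pose eqv Y : bool := if excluded_middle_informative (syt_equiv k n Y0 Y) then true else false.
have eqvP Y : reflect (syt_equiv k n Y0 Y) (eqv Y).
  by rewrite /eqv; case: excluded_middle_informative => h; constructor.
have Y0C : Y0 \in C1 by rewrite mem_head.
have eqv0 : eqv Y0 by apply/eqvP; apply: rst_refl.
have [||||p [c [f [Af fE]]]] := IHN [seq Y <- C1 | ~~ eqv Y].
- rewrite -ltnS; apply: leq_trans szC; rewrite size_filter ltn_neqAle count_size andbT -all_count.
  by apply/allPn; exists Y0; rewrite ?eqv0.
- exact: filter_uniq.
- by move=> Y; rewrite mem_filter => /andP[_ /CS].
- move=> Y Y'; rewrite !mem_filter => /andP[nY YC] YY'; rewrite (closed Y) // andbT.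
  by apply: contra nY => /eqvP h; apply/eqvP; apply: rst_trans h (rst_sym _ _ _ _ YY').
pose f0 : pseries := fun m => (\sum_(Y <- [seq Y <- C1 | eqv Y]) fund_qsym n (ID Y) m)%R.
exists p.+1, (fun i => if unlift ord0 i is Some j then c j else 1),
  (fun i => if unlift ord0 i is Some j then f j else f0); split=> [i|m].
  case: (unliftP ord0 i) => [j _|_]; first exact: Af.
  exists n, Y0, [seq Y <- C1 | eqv Y]; split=> //; [exact: CS | exact: filter_uniq |].
  move=> Y; rewrite mem_filter; split=> [/andP[/eqvP h /CS] //|[_ h]].
  by rewrite (closed Y0) // andbT; apply/eqvP.
rewrite big_ord_recl unlift_none GRing.mulr1n (bigID eqv) /=.
congr (_ + _)%R; first by rewrite -big_filter.
by rewrite -big_filter fE; apply: eq_bigr => i _; rewrite liftK.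
Qed.

(** Injectivity makes the list of insertion tableaux of SRCT(alpha) free of repetitions, transport
    with the trivial relation makes it closed, and preservation of inverse descents turns its
    generating function into the quasisymmetric Schur function. *)
Lemma qschur_classes (k : 'I_3) a : nonneg_comb (class_function k) (qschur a).
Proof.
set n := sumn a; pose P T := insertion (column_word T).
have pw T : T \in SRCT a -> perm_eq (column_word T) (iota 1 n).
  by move=> TS; apply: perm_column_word (srct_perm TS).
have [||| p [c [f [Af fE]]]] := @nonneg_comb_classes k n [seq P T | T <- SRCT a].
- by rewrite map_inj_in_uniq ?uniq_SRCT // => T1 T2; apply: srct_insertion_inj.
- by move=> _ /mapP[T TS ->]; apply: insertion_SYT (pw T TS).
- move=> _ Y' /mapP[T TS ->] /syt_equiv_dual_R.
  case/(@dual_R_equiv_lift _ (fun S => S \in SRCT a) column_word (fun _ _ => True)) => //.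
    by move=> S i SS iN; exact: (srct_move SS iN).
  by move=> /(_ T TS erefl)[S [SS _ <-]] _; apply: map_f.
exists p, c, f; split=> // m; rewrite -fE big_map; apply: eq_big_seq => T TS.
rewrite /ID inv_descents_insertion ?(srct_bent_descents TS) //.
by rewrite (perm_uniq (pw T TS)) iota_uniq.
Qed.

Theorem theorem3p7 (k : 'I_3) :
  (forall (lam : seq nat) (T T' : tableau),
      is_part lam -> T \in SRT lam -> T' \in SRT lam ->
      perm_equiv k (col_word T) (col_word T') -> quasi_dual_equiv lam T T')
  /\ (forall alpha : seq nat,
      is_comp alpha -> nonneg_comb (class_function k) (qschur alpha)).
Proof.
split; first by move=> lam T T'; apply: quasi_dual_coarsens.
by move=> alpha _; apply: qschur_classes.
Qed.
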